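(* Let $k_0\in[0,1)$, let $k_0\le\lambda_1\le\lambda_2\le 1$ with $\lambda:=\lambda_1+\lambda_2\in(1,2]$, set $\alpha:=\lambda-1$, and let $\Psi(x,y)=x^{\lambda_1}y^{\lambda_2}+x^{\lambda_2}y^{\lambda_1}$ for $(x,y)\in(0,\infty)^2$. Let $\beta\ge 0$ be a measurable function on $(0,1)$ with $$\int_0^1 z\,\beta(z)\,dz=1\quad\text{and}\quad \int_0^1 z^{k_0}\beta(z)\,dz<\infty,$$ and let $$f(z,x,y)=\frac1x\,\beta\Big(\frac zx\Big)\mathbf 1_{(0,x)}(z)+\frac1y\,\beta\Big(\frac zy\Big)\mathbf 1_{(0,y)}(z),\qquad (x,y)\in(0,\infty)^2 .$$ Then there exists at least one self-similar profile $\eta$ (in the sense defined in the context) for the collision-induced breakage equation with collision kernel $\Psi$ and breakage function $f$, and it satisfies $$\eta\in L_\infty((0,\infty),x^{k_0+1}dx)\cap\bigcap_{k\ge k_0}\mathcal S_k .$$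
   Context: For $r\in\mathbb R$, $\mathcal S_r:=L^1((0,\infty),x^r dx)$ and $M_r(g):=\int_0^\infty x^r g(x)\,dx$ for $g\in\mathcal S_r$. The notation $\eta\in L_\infty((0,\infty),x^{k_0+1}dx)$ means that $x\mapsto x^{k_0+1}\eta(x)$ is essentially bounded on $(0,\infty)$. Let $\mathcal T^1$ be the set of (globally) Lipschitz continuous functions $\varsigma:[0,\infty)\to\mathbb R$ with $\varsigma(0)=0$. Definition (self-similar profile). With $\alpha=\lambda_1+\lambda_2-1$, a self-similar profile for the collision-induced breakage equation with collision kernel $\Psi$ and breakage function $f$ is a function $\eta\ge 0$ a.e. in $(0,\infty)$ such that $\eta\in\mathcal S_{\lambda_1}\cap\mathcal S_{1+\lambda_2}$, $M_1(\eta)=1$, and $$\int_0^\infty[\varsigma(x)-x\varsigma'(x)]\eta(x)\,dx=\frac\alpha2\int_0^\infty\int_0^\infty\Upsilon_\varsigma(x,y)\Psi(x,y)\eta(x)\eta(y)\,dy\,dx$$ for all $\varsigma\in\mathcal T^1$, where $$\Upsilon_\varsigma(x,y):=\int_0^{x+y}\varsigma(z)f(z,x,y)\,dz-\varsigma(x)-\varsigma(y).$$ (This is the weak form of $2\eta+x\eta'=\alpha\,\mathcal N\eta$, where $\mathcal N\eta(x)=\frac12\int_x^\infty\int_0^y f(x,y-z,z)\Psi(y-z,z)\eta(y-z)\eta(z)\,dz\,dy-\int_0^\infty\Psi(x,y)\eta(x)\eta(y)\,dy$.) *)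

(* Defs.v *)
From mathcomp Require Import all_boot all_order all_algebra.
From mathcomp Require Import all_classical all_reals all_analysis.

Set Implicit Arguments.
Unset Strict Implicit.
Unset Printing Implicit Defensive.

Import Order.TTheory GRing.Theory Num.Theory.
Import numFieldNormedType.Exports.

Local Open Scope classical_set_scope.
Local Open Scope ring_scope.

(* Functions on (0,oo), (0,1) or [0,oo) are represented by total functions
   R -> R; no definition below depends on the values outside those domains.
   Measurability is Borel measurability. *)

Section Defs.
Context {R : realType}.
Implicit Types (r : R) (g eta beta sigma : R -> R).

Local Notation mu := (@lebesgue_measure R).
Local Notation Rpos := (`]0, +oo[%classic : set R).

(* L^1((0,oo), x^r dx); integrability of x^r g includes its measurability on
   (0,oo), which is that of g. *)
Definition in_S r g : Prop :=
  mu.-integrable Rpos (fun x => (x `^ r * g x)%:E).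

Definition moment r g : R := \int[mu]_(x in Rpos) (x `^ r * g x).

Definition in_weighted_Linfty r g : Prop :=
  measurable_fun Rpos g /\
  exists C : R, {ae mu, forall x, 0 < x -> `|x `^ r * g x| <= C}.

Definition in_T1 sigma : Prop :=
  [lipschitz sigma x | x in `[0, +oo[] /\ sigma 0 = 0.

(* Breakage functions take their arguments in the order (z, x, y). *)
Definition Upsilon (f : R -> R -> R -> R) sigma (x y : R) : R :=
  (\int[mu]_(z in `]0, (x + y)[) (sigma z * f z x y)) - sigma x - sigma y.

(* [derive1 sigma] is the pointwise derivative, with a default value at points of
   non-differentiability; these form a Lebesgue null set when sigma is
   Lipschitz.  [Rintegral] returns 0 on an infinite integral, which does not
   happen for the product kernel and the breakage functions below:
   |sigma x - x sigma' x| <= 2 L x and |Upsilon f sigma x y| <= 2 L (x + y) for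
   an L-Lipschitz sigma, and eta has finite moments of all orders in
   [lam1, 1 + lam2]. *)
Definition self_similar_profile (lam1 lam2 : R) (Psi : R -> R -> R)
    (f : R -> R -> R -> R) eta : Prop :=
  let alpha := lam1 + lam2 - 1 in
  [/\ {ae mu, forall x, 0 < x -> 0 <= eta x},
      in_S lam1 eta,
      in_S (1 + lam2) eta,
      moment 1 eta = 1
    & forall sigma, in_T1 sigma ->
      \int[mu]_(x in Rpos) ((sigma x - x * derive1 sigma x) * eta x) =
      alpha / 2 *
        \int[mu]_(x in Rpos) \int[mu]_(y in Rpos)
          (Upsilon f sigma x y * Psi x y * eta x * eta y)].

Definition product_kernel (lam1 lam2 x y : R) : R :=
  x `^ lam1 * y `^ lam2 + x `^ lam2 * y `^ lam1.

Definition breakage beta (z x y : R) : R :=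
  x^-1 * beta (z / x) * \1_(`]0, x[%classic) z +
  y^-1 * beta (z / y) * \1_(`]0, y[%classic) z.

End Defs.

(* Main.v *)
Require Import Defs.
From HB Require Import structures.
From mathcomp Require Import all_boot all_order all_algebra.
From mathcomp Require Import all_classical all_reals all_analysis.
From mathcomp Require Import measurable_realfun ring lra.

(** Let nu(dz) = z beta(z) dz, a probability measure on (0,1): it is the law of
    the relative mass of the fragment that carries a tagged atom when a particle
    breaks.

    _Linearisation._  For the given breakage function, Upsilon(x,y) = U(x) + U(y)
    with U(y) = int_0^1 sigma(yz) beta(z) dz - sigma(y) ([Upsilon_breakage]).  As
    the kernel is a sum of two products, the right-hand side of the weak equation
    is int U(y) (A y^lam1 + B y^lam2) eta(y) dy, with A = alpha M_lam2(eta) and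
    B = alpha M_lam1(eta) ([integral_symmetric_kernel]).  The nonlinearity is thus
    reduced to the two numbers A and B.

    _The linear problem._  Put d(x) = A x^(lam1-1) + B x^(lam2-1).  Let P be a
    nonincreasing function from 1 at 0 to 0 at infinity, let
    Q(x) = int P(x/z) nu(dz) ([fragment_tail]), and suppose that P' = d (Q - P).
    Then psi = d (P - Q) is a probability density, and Fubini's theorem gives, for
    every weight phi >= 0,
      int phi (P - Q) dx = int psi(y) int (int_{zy}^y phi) nu(dz) dy
    ([flux_identity]).  With ell = int - ln z nu(dz), the function
    eta(x) = (P(x) - Q(x)) / (ell x^2) ([profile]) is the solution.  Indeed
    phi = x^(r-2) expresses its moments: M_r(eta) = c_r N_r / ell, where
    c_r = int int_z^1 t^(r-2) dt nu(dz) ([mean_powint]) and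
    N_r = int y^(r-1) psi(y) dy ([tail_moment]); in particular M_1(eta) = 1.  And
    taking for phi the derivative of sigma(x) / x, made nonnegative by adding a
    multiple of 1/x, gives the weak equation for these A and B ([weak_flux]).

    _The fixed point._  It remains to find P such that A = alpha c_lam2 N_lam2 / ell
    and B = alpha c_lam1 N_lam1 / ell.  Let [step] map P to the solution of the linear
    equation whose coefficients A and B and source Q are computed from P.  For r <= 1
    the moment N_r decreases when P increases, hence so does d, while Q increases;
    solutions stay above their source, so both changes raise the solution, and
    [step] is nondecreasing ([step_mono]).  The supremum of the P <= [step P] is then a
    fixed point, as in the theorem of Knaster and Tarski ([exists_fixpoint]).  The
    iteration is confined between the barriers 1 - (x/x1)^(1-k0+lam1) and
    exp(1 - (x/s)^lam1): the first is a subsolution because int z^(k0-1) dnu is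
    finite ([step_lower]), the second a supersolution because int z^lam1 dnu < 1
    ([step_upper]), for suitable x1 and s whose existence rests on lam1 + lam2 > 1
    ([stationary_tail]).  The first barrier also gives
    P - Q <= 1 - Q = O(x^(1-k0)), that is, the bound on x^(k0+1) eta, and together
    with the second one all the moments of order at least k0.

    _Test functions._  They are only Lipschitz, so sigma(x) / x is recovered
    from its almost everywhere derivative ([lipschitz_FTC],
    [lipschitz_quotient_FTC]).  This derivative agrees with [derive1 sigma] off a
    null set, which suffices even if the latter is not measurable
    ([ae_eq_integral_nonmeas]). *)

Set Implicit Arguments.
Unset Strict Implicit.
Unset Printing Implicit Defensive.

Import Order.TTheory GRing.Theory Num.Theory.
Import numFieldNormedType.Exports.

Local Open Scope classical_set_scope.
Local Open Scope ring_scope.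

(** * Lipschitz functions as integrals of their derivatives *)

Section lip.
Context {R : realType}.
Local Notation mu := (@lebesgue_measure R).

Lemma complementary_monotone_lipschitz (F G : R -> R) :
  {homo F : x y / x <= y} -> {homo G : x y / x <= y} ->
  (forall x, F x + G x = x) -> forall x y, `|F x - F y| <= `|x - y|.
Proof.
move=> ndF ndG FG x y; wlog xy : x y / x <= y.
  move=> H; case: (leP x y) => [|/ltW] /H //.
  by rewrite distrC [in X in _ <= X]distrC.
have := ndF _ _ xy; have := ndG _ _ xy; have := FG x; have := FG y.
move=> *; rewrite !ler0_norm; lra.
Qed.

Lemma lipschitz_continuous (h : R -> R) K :
  (forall x y, `|h x - h y| <= K * `|x - y|) -> continuous h.
Proof.
move=> hl x; apply/cvgrPdist_lt => e e0.
have K1 : 0 < `|K| + 1 by have := normr_ge0 K; lra.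
near=> t; apply: (le_lt_trans (hl _ _)).
apply: (@le_lt_trans _ _ ((`|K| + 1) * `|x - t|)).
  apply: ler_wpM2r => //; have := ler_norm K; lra.
rewrite mulrC -ltr_pdivlMr//; near: t.
by apply: cvgr_dist_lt => //; rewrite divr_gt0.
Unshelve. all: by end_near. Qed.

Lemma is_derive_of_derive1 (f : R -> R) x l :
  derivable f x 1 -> derive1 f x = l -> is_derive x 1 f l.
Proof. by move=> d <-; split => //; rewrite derive1E. Qed.

Lemma near_eq_derive1_shift (f F : R -> R) c x l :
  derivable f x 1 -> derive1 f x = l -> (\near x, f x = F x - c) ->
  derivable F x 1 /\ derive1 F x = l.
Proof.
move=> d1 d2 fF; have d := is_deriveD (is_derive_of_derive1 d1 d2) (is_derive_cst c x 1).
have {}d : is_derive x 1 F l.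
  rewrite -[l]addr0; apply: (near_eq_is_derive _ d).
  near=> y; change (f y + c = F y).
  have -> : f y = F y - c by near: y.
  by rewrite subrK.
by split; [exact: ex_derive|rewrite derive1E derive_val].
Unshelve. all: by end_near. Qed.

(** The Stieltjes measures of [F] and [G] add up to Lebesgue measure, so that of
    [F] is dominated by it and has a Radon-Nikodym density, to which Lebesgue's
    differentiation theorem applies. *)
Lemma complementary_monotone_FTC (F G : R -> R) (a b : R) : a < b ->
  {homo F : x y / x <= y} -> {homo G : x y / x <= y} ->
  (forall x, F x + G x = x) ->
  exists g : R -> R, [/\ mu.-integrable `[a, b] (EFin \o g),
    forall c, a <= c <= b -> \int[mu]_(x in `[a, c]) g x = F c - F a
    & {ae mu, forall x, a < x < b -> derivable F x 1 /\ derive1 F x = g x}].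
Proof.
move=> ab ndF ndG FG.
have lipF := complementary_monotone_lipschitz ndF ndG FG.
have lipG : forall x y, `|G x - G y| <= `|x - y|.
  by apply: (complementary_monotone_lipschitz ndG ndF) => x; rewrite addrC.
have cF : continuous F.
  by apply: (@lipschitz_continuous _ 1) => x y; rewrite mul1r.
have cG : continuous G.
  by apply: (@lipschitz_continuous _ 1) => x y; rewrite mul1r.
have rcF : right_continuous F by move=> x; apply: cvg_at_right_filter; exact: cF.
have rcG : right_continuous G by move=> x; apply: cvg_at_right_filter; exact: cG.
pose F' : cumulative R R := HB.pack F (isCumulative.Build R _ R F ndF rcF).
pose G' : cumulative R R := HB.pack G (isCumulative.Build R _ R G ndG rcG).
pose mF := lebesgue_stieltjes_measure F'.
pose mG := lebesgue_stieltjes_measure G'.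
have mFoc x y : x <= y -> mF `]x, y]%classic = (F y - F x)%:E.
  move=> xy; rewrite /mF /lebesgue_stieltjes_measure /measure_extension.
  by rewrite measurable_mu_extE/= ?wlength_itv_bnd//; exact: is_ocitv.
have mGoc x y : x <= y -> mG `]x, y]%classic = (G y - G x)%:E.
  move=> xy; rewrite /mG /lebesgue_stieltjes_measure /measure_extension.
  by rewrite measurable_mu_extE/= ?wlength_itv_bnd//; exact: is_ocitv.
have muE A : measurable A -> mu A = (mF A + mG A)%E.
  move=> mA; rewrite -measure_addE.
  apply: lebesgue_measure_unique => // X /ocitvP[->|[[x y]/= xy ->]].
    by rewrite !measure0.
  transitivity (mF `]x, y]%classic + mG `]x, y]%classic)%E; last exact/esym/measure_addE.
  rewrite (mFoc _ _ (ltW xy)) (mGoc _ _ (ltW xy)) lebesgue_measure_itv/= lte_fin xy.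
  rewrite -!EFinD; congr EFin; have := FG x; have := FG y; lra.
have mFle A : measurable A -> (mF A <= mu A)%E.
  by move=> mA; rewrite muE// leeDl.
have mI : measurable (`]a, b]%classic : set (measurableTypeR R)) by exact: measurable_itv.
have Ioo : (mF `]a, b]%classic < +oo)%E by rewrite mFoc ?ltW// ltry.
pose nu := mfrestr mI Ioo.
have nudom : nu `<< mu.
  apply/null_content_dominatesP => A mA muA0; apply/eqP.
  rewrite -measure_le0 -muA0 /nu /mfrestr /mrestr.
  apply: (le_trans _ (mFle _ mA)); apply: le_measure; rewrite ?inE//.
  exact: measurableI.
pose f := Radon_Nikodym_SigmaFinite.f nu mu.
have fE A : measurable A -> nu A = (\int[mu]_(x in A) f x)%E.
  by move=> mA; exact: Radon_Nikodym_SigmaFinite.f_integral.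
have fint : mu.-integrable setT f by exact: Radon_Nikodym_SigmaFinite.f_integrable.
pose g := fine \o f.
have gE : EFin \o g = f.
  by apply/funext => x /=; rewrite fineK//; exact: Radon_Nikodym_SigmaFinite.f_fin_num.
have gint : mu.-integrable setT (EFin \o g) by rewrite gE.
exists g.
have gabint : mu.-integrable `[a, b] (EFin \o g) by exact: integrableS gint.
have gcE c : a <= c <= b -> \int[mu]_(x in `[a, c]) g x = F c - F a.
  move=> /andP[ac cb].
  rewrite -Rintegral_itv_obnd_cbnd; last first.
    exact: integrableS gint.
  rewrite /Rintegral.
  under eq_integral do rewrite -/(comp EFin g _) gE.
  rewrite -fE; last exact: measurable_itv.
  rewrite /nu /mfrestr /mrestr setIidl; first by rewrite mFoc.
  by apply: subset_itvl; rewrite bnd_simp.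
split => //.
have locg : locally_integrable setT g.
  by apply: open_integrable_locally; [exact: openT|exact: gint].
have gy y : mu.-integrable [set` Interval (BLeft a) (BRight y)] (EFin \o g).
  exact: integrableS gint.
have := @FTC1 R g (BLeft a) gy locg.
apply: filterS; first exact: (ae_filter_ringOfSetsType mu).
move=> x /= H /andP[ax xb]; clear - F G a b ab g gcE H ax xb.
have [d1 d2] := H ltac:(by rewrite lte_fin).
apply: (@near_eq_derive1_shift _ F (F a) x (g x) d1 d2).
near=> y; apply: gcE; apply/andP; split; near: y.
  exists (x - a) => [|t]; rewrite /= ?subr_gt0//.
  by rewrite ltr_norml => /andP[_ h]; lra.
exact: lt_le_nbhsl.
Unshelve. all: by end_near. Qed.

(** A [K]-Lipschitz [h] is an affine combination of [(x + h x / K) / 2] and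
    [(x - h x / K) / 2], two nondecreasing functions of sum [x]. *)
Lemma lipschitz_FTC_itv (h : R -> R) K (a b : R) : a < b -> 0 < K ->
  (forall x y, `|h x - h y| <= K * `|x - y|) ->
  exists g : R -> R, [/\ mu.-integrable `[a, b] (EFin \o g),
    forall c, a <= c <= b -> \int[mu]_(x in `[a, c]) g x = h c - h a
    & {ae mu, forall x, a < x < b -> derivable h x 1 /\ derive1 h x = g x}].
Proof.
move=> ab K0 hl.
have hl2 x y : x <= y -> - (y - x) <= (h y - h x) / K <= y - x.
  move=> xy; have := hl y x; rewrite [X in _ * X]ger0_norm ?subr_ge0//.
  by rewrite -ler_pdivrMl// mulrC -{1}(gtr0_norm K0) -normfV -normrM ler_norml.
pose F x := (x + h x / K) / 2; pose G x := (x - h x / K) / 2.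
have [||x|g [ig gE gd]] := @complementary_monotone_FTC F G a b ab.
- by move=> x y /hl2; rewrite mulrBl /F => /andP[]; lra.
- by move=> x y /hl2; rewrite mulrBl /G => /andP[]; lra.
- by rewrite /F /G; lra.
have K1 : K \is a GRing.unit by rewrite unitfE gt_eqF.
have hE x : h x = 2 * K * F x - K * x.
  by rewrite /F mulrCA mulrA; field; rewrite gt_eqF.
pose g' x := 2 * K * g x - K.
have i1 c : a <= c <= b -> mu.-integrable `[a, c] (EFin \o cst K).
  move=> _; apply: continuous_compact_integrable; first exact: segment_compact.
  by apply: continuous_subspaceT => x; exact: cvg_cst.
have i2 c : a <= c <= b -> mu.-integrable `[a, c] (EFin \o (fun x => 2 * K * g x)).
  move=> /andP[ac cb].
  have := @integrableZl _ _ R mu `[a, c] (measurable_itv _) (2 * K) (EFin \o g).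
  apply; apply: integrableS ig => //.
  by apply: subset_itvl; rewrite bnd_simp.
exists g'; split.
- have abb : a <= b <= b by rewrite (ltW ab) lexx.
  exact: (integrableB _ (i2 b abb) (i1 b abb)).
- move=> c cab; rewrite /g' RintegralB//; [|exact: i2|exact: i1].
  case/andP: (cab) => ac cb.
  rewrite RintegralZl//; last first.
    by apply: integrableS ig => //; apply: subset_itvl; rewrite bnd_simp.
  rewrite gE// Rintegral_cst//= lebesgue_measure_itv/= lte_fin !hE.
  move: ac; rewrite le_eqVlt => /predU1P[->|ac]; first by rewrite ltxx/=; ring.
  by rewrite ac/=; ring.
- move: gd; apply: filterS; first exact: (ae_filter_ringOfSetsType mu).
  move=> x /= H /H[dF F'].
  have d : is_derive x 1 F (g x).
    by apply: DeriveDef => //; rewrite -derive1E.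
  have d1 := is_deriveD (is_deriveZ (2 * K) d) (is_deriveZ (- K) (is_derive_id x 1)).
  have {}d : is_derive x 1 h (g' x).
    have -> : g' x = (2 * K) *: g x + (- K) *: 1 by rewrite /g' /GRing.scale/=; ring.
    apply: (near_eq_is_derive _ d1); near=> y.
    change (2 * K * F y + - K * y = h y).
    by rewrite hE; ring.
  by split; [exact: ex_derive|rewrite derive1E derive_val].
Unshelve. all: by end_near. Qed.

Lemma lipschitz_ae_derivable (h : R -> R) K : 0 < K ->
  (forall x y, `|h x - h y| <= K * `|x - y|) ->
  {ae mu, forall x, derivable h x 1}.
Proof.
move=> K0 hl.
have H (n : nat) : {ae mu, forall x, - n.+1%:R < x < n.+1%:R -> derivable h x 1}.
  have [|g [_ _]] := @lipschitz_FTC_itv h K (- n.+1%:R) n.+1%:R _ K0 hl.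
    by rewrite gt0_cp.
  apply: filterS; first exact: (ae_filter_ringOfSetsType mu).
  by move=> x /= H /H [].
have := ae_foralln H; apply: filterS => //.
move=> x /= /(_ (Num.trunc `|x|)) ; apply.
by rewrite -ltr_norml Num.Theory.truncnS_gt.
Qed.

(** The densities obtained on bounded intervals depend on the interval; the
    difference quotients of [h] along [1 / n] produce one function [g] for the
    whole line, truncated so that the bound [K] holds everywhere. *)
Lemma lipschitz_FTC (h : R -> R) K : 0 < K ->
  (forall x y, `|h x - h y| <= K * `|x - y|) ->
  exists g : R -> R, [/\ measurable_fun setT g, forall x, `|g x| <= K,
    {ae mu, forall x, derivable h x 1 /\ derive1 h x = g x}
    & forall a b, a <= b -> \int[mu]_(x in `[a, b]) g x = h b - h a].
Proof.
move=> K0 hl.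
have ch : continuous h := lipschitz_continuous hl.
pose u (n : nat) x := n.+1%:R * (h (x + n.+1%:R^-1) - h x).
have uK n x : `|u n x| <= K.
  rewrite /u normrM; apply: (le_trans (ler_wpM2l _ (hl _ _))) => //.
  rewrite addrC addKr mulrCA -normrM mulfV ?pnatr_eq0// normr1 mulr1//.
pose g x := Num.max (- K) (Num.min K (limn_sup (u ^~ x))).
have mu_ n : measurable_fun setT (u n).
  apply: continuous_measurable_fun => x.
  apply: cvgM; first exact: cvg_cst.
  apply: cvgB; last exact: ch.
  apply: (@continuous_comp R R R (fun y => y + n.+1%:R^-1)); last exact: ch.
  by apply: cvgD; [exact: cvg_id|exact: cvg_cst].
have mg : measurable_fun setT g.
  apply: measurable_maxr; first exact: measurable_cst.
  apply: measurable_minr; first exact: measurable_cst.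
  apply: measurable_fun_limn_sup => // t _.
    by exists K => _ [n _ <-]; have := uK n t; rewrite ler_norml => /andP[].
  by exists (- K) => _ [n _ <-]; have := uK n t; rewrite ler_norml => /andP[].
have gK x : `|g x| <= K.
  rewrite ler_norml /g le_max lexx/= ge_max; apply/andP; split; first lra.
  by rewrite ge_min lexx.
have dg x : derivable h x 1 -> derive1 h x = g x.
  move=> dh.
  have cu : u ^~ x @ \oo --> derive1 h x.
    have dcv : (y^-1 *: (h (y + x) - h x)) @[y --> 0^'] --> derive1 h x.
      rewrite derive1E.
      have -> : (fun y : R => y^-1 *: (h (y + x) - h x)) =
        (fun y : R => y^-1 *: (h (y *: 1 + x) - h x)).
        by apply/funext => y; rewrite /GRing.scale/= mulr1.
      exact: dh.
    have -> : u ^~ x = (fun y : R => y^-1 *: (h (y + x) - h x)) \o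
        (fun n : nat => n.+1%:R^-1 : R).
      by apply/funext => n /=; rewrite invrK [_ + x]addrC.
    apply: (cvg_comp _ _ _ dcv) => A A0.
    have : (fun n : nat => n.+1%:R^-1 : R) @ \oo --> (0 : R) by exact: cvg_harmonic.
    move=> /(_ _ A0) H.
    have {}H : \forall n \near \oo, (n.+1%:R^-1 : R) != 0 -> A n.+1%:R^-1 := H.
    change (\forall n \near \oo, A n.+1%:R^-1); apply: filterS H => n; apply.
    by rewrite invr_eq0 pnatr_eq0.
  have [_ cs] := cvg_limn_inf_sup cu.
  have d1 : derive1 h x <= K.
    apply: (cvgr_to_le cu); apply: nearW => n.
    by have := uK n x; rewrite ler_norml => /andP[].
  have d2 : - K <= derive1 h x.
    apply: (cvgr_to_ge cu); apply: nearW => n.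
    by have := uK n x; rewrite ler_norml => /andP[].
  by rewrite /g cs min_r// max_r.
exists g; split => //.
  have := lipschitz_ae_derivable K0 hl; apply: filterS.
    exact: (ae_filter_ringOfSetsType mu).
  by move=> x /= d; split => //; exact: dg.
move=> a b; rewrite le_eqVlt => /predU1P[->|ab].
  by rewrite set_itv1 Rintegral_set1 subrr.
have [g' [ig gE gd]] := lipschitz_FTC_itv ab K0 hl.
rewrite -gE ?(ltW ab) ?lexx// /Rintegral; congr fine.
have mg' : measurable_fun `[a, b] g'.
  by move/integrableP : ig => -[/measurable_EFinP].
rewrite [LHS]integral_itv_bndoo; last first.
  by apply/measurable_EFinP; exact: measurable_funS mg.
rewrite [RHS]integral_itv_bndoo; last first.
  apply/measurable_EFinP; apply: measurable_funS mg' => //.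
  exact: subset_itv_oo_cc.
apply: ae_eq_integral => //.
- by apply/measurable_EFinP; exact: measurable_funS mg.
- apply/measurable_EFinP; apply: measurable_funS mg' => //.
  exact: subset_itv_oo_cc.
move: gd; apply: filterS; first exact: (ae_filter_ringOfSetsType mu).
by move=> x /= H; rewrite in_itv/= => /H[dx <-]; rewrite dg.
Unshelve. all: by end_near. Qed.

End lip.

Section nonmeasurable.
Context d (T : measurableType d) (R : realType) (mu : {measure set T -> \bar R}).

Import HBNNSimple.

Lemma ge0_le_integral_off_null (f g : T -> \bar R) (N : set T) :
  measurable N -> mu N = 0%E -> (forall x, 0 <= f x)%E -> (forall x, 0 <= g x)%E ->
  (forall x, ~ N x -> f x = g x) ->
  (\int[mu]_x f x <= \int[mu]_x g x)%E.
Proof.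
move=> mN N0 f0 g0 fg; rewrite [leLHS]ge0_integralTE//.
apply: ge_ereal_sup => _ [h /= hf <-].
rewrite -integralT_nnsfun.
have mNC : measurable (~` N) by exact: measurableC.
pose k := mul_nnsfun h (indic_nnsfun R mNC).
have kE x : k x = h x * \1_(~` N) x by [].
have -> : (\int[mu]_x (h x)%:E = \int[mu]_x (k x)%:E)%E.
  apply: ge0_ae_eq_integral => //.
  - by apply/measurable_EFinP.
  - by apply/measurable_EFinP.
  - by move=> x _; rewrite lee_fin.
  - by move=> x _; rewrite lee_fin.
  exists N; split => // x /= H; apply: contrapT => Nx; apply: H => _.
  by rewrite (_ : mindic R mNC x = 1) ?mulr1// /mindic indicE mem_set.
rewrite integralT_nnsfun ge0_integralTE//; apply: ereal_sup_ubound.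
exists k => //; move=> x; rewrite -/k kE indicE.
have [Nx|Nx] := pselect (N x); first by rewrite memNset ?mulr0//; exact.
by rewrite mem_set// mulr1 -fg.
Qed.

(** Meant for functions built from [derive1 sigma], which can fail to be
    measurable even if [sigma] is Lipschitz.  A simple function below [f] stays below [g] once it is
    set to 0 on a measurable null set that contains the exceptional points. *)
Lemma ae_eq_integral_nonmeas (f g : T -> \bar R) (D : set T) :
  {ae mu, forall x, D x -> f x = g x} ->
  (\int[mu]_(x in D) f x = \int[mu]_(x in D) g x)%E.
Proof.
move=> [N [mN N0 NP]].
have fgN x : ~ N x -> (f \_ D) x = (g \_ D) x.
  move=> Nx; rewrite !patchE; case: ifPn => // /set_mem Dx.
  by apply: contrapT => H; apply: Nx; apply: NP => /= /(_ Dx).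
have E p q : (forall x, 0 <= p x)%E -> (forall x, 0 <= q x)%E ->
    (forall x, ~ N x -> p x = q x) -> (\int[mu]_x p x = \int[mu]_x q x)%E.
  move=> p0 q0 pq; apply/eqP; rewrite eq_le; apply/andP; split.
    exact: (@ge0_le_integral_off_null _ _ N).
  by apply: (@ge0_le_integral_off_null _ _ N) => // x /pq.
rewrite [LHS]integral_mkcond [RHS]integral_mkcond [LHS]integralE [RHS]integralE.
by congr (_ - _)%E; apply: E => // x Nx; rewrite ?funeposE ?funenegE (fgN x Nx).
Qed.

End nonmeasurable.

(** * Calculus on the half-line *)

Section calculus.
Context {R : realType}.
Local Notation mu := (@lebesgue_measure R).
Local Notation Rpos := (`]0, +oo[%classic : set R).
Implicit Types (f df g G : R -> R) (a b x y l : R).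

Lemma is_derive_continuous f x l : is_derive x 1 f l -> {for x, continuous f}.
Proof. by move=> d; apply: differentiable_continuous; apply/derivable1_diffP; exact: ex_derive. Qed.

Lemma ge0_derive_le f df a b : a <= b ->
  (forall x, a <= x <= b -> is_derive x 1 f (df x)) ->
  (forall x, a <= x <= b -> 0 <= df x) -> f a <= f b.
Proof.
rewrite le_eqVlt => /predU1P[->//|ab] dfE df0.
have [||c cab fE] := @MVT R f df a b ab.
- by move=> x; rewrite in_itv/= => /andP[/ltW ax /ltW xb]; apply: dfE; rewrite ax.
- apply: continuous_in_subspaceT => x; rewrite inE/= in_itv/= => xab.
  exact: is_derive_continuous (dfE _ xab).
rewrite -subr_ge0 fE mulr_ge0 ?subr_ge0 ?(ltW ab)//; apply: df0.
by move: cab; rewrite in_itv/= => /andP[/ltW -> /ltW ->].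
Qed.

Lemma continuous_gt0_measurable g : (forall x, 0 < x -> {for x, continuous g}) ->
  measurable_fun Rpos g.
Proof.
move=> cg; apply: open_continuous_measurable_fun; first exact: interval_open.
by move=> x; rewrite inE/= in_itv/= andbT; exact: cg.
Qed.

Lemma FTC_segment g G a b : 0 < a -> a <= b ->
  (forall x, 0 < x -> {for x, continuous g}) ->
  (forall x, 0 < x -> is_derive x 1 G (g x)) ->
  (\int[mu]_(x in `[a, b]) (g x)%:E = (G b - G a)%:E)%E.
Proof.
move=> a0; rewrite le_eqVlt => /predU1P[-> _ _|ab cg dG].
  by rewrite set_itv1 integral_set1 subrr.
have b0 : 0 < b by exact: lt_trans ab.
rewrite (@continuous_FTC2 _ g G)//.
- apply: continuous_in_subspaceT => x; rewrite inE/= in_itv/= => /andP[ax _].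
  by apply: cg; exact: lt_le_trans ax.
- split.
  + move=> x; rewrite in_itv/= => /andP[ax _].
    by apply: ex_derive; apply: dG; exact: lt_trans ax.
  + by apply: cvg_at_right_filter; exact: (is_derive_continuous (dG _ a0)).
  + by apply: cvg_at_left_filter; exact: (is_derive_continuous (dG _ b0)).
- move=> x; rewrite in_itv/= => /andP[ax _].
  by rewrite derive1E; have -> := @derive_val _ _ _ _ _ _ _ (dG _ (lt_trans a0 ax)).
Qed.

Lemma FTC_at_infinity g G a l : 0 < a -> (forall x, 0 < x -> 0 <= g x) ->
  (forall x, 0 < x -> {for x, continuous g}) ->
  (forall x, 0 < x -> is_derive x 1 G (g x)) ->
  G x @[x --> +oo] --> l ->
  (\int[mu]_(x in `[a, +oo[) (g x)%:E = (l - G a)%:E)%E.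
Proof.
move=> a0 g0 cg dG Gl.
rewrite (@ge0_continuous_FTC2y _ g G a l)//.
- by move=> x ax; apply: g0; exact: lt_le_trans ax.
- apply: continuous_in_subspaceT => x; rewrite inE/= in_itv/= andbT => ax.
  by apply: cg; exact: lt_le_trans ax.
- by move=> x ax; apply: ex_derive; apply: dG; exact: lt_trans ax.
- by apply: cvg_at_right_filter; exact: (is_derive_continuous (dG _ a0)).
- move=> x; rewrite in_itv/= andbT => ax.
  by rewrite derive1E; have -> := @derive_val _ _ _ _ _ _ _ (dG _ (lt_trans a0 ax)).
Qed.

(** Exhaustion of the interval by the segments [[b / n, b]]. *)
Lemma FTC_at_zero g G b l : 0 < b -> (forall x, 0 < x -> 0 <= g x) ->
  (forall x, 0 < x -> {for x, continuous g}) ->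
  (forall x, 0 < x -> is_derive x 1 G (g x)) ->
  G x @[x --> 0^'+] --> l ->
  (\int[mu]_(x in `]0%R, b]) (g x)%:E = (G b - l)%:E)%E.
Proof.
move=> b0 g0 cg dG Gl.
pose F n := `[b / n.+1%:R, b]%classic : set R.
have bn n : 0 < b / n.+1%:R by rewrite divr_gt0.
have FE : \bigcup_n F n = `]0%R, b]%classic.
  apply/seteqP; split => x /=.
    move=> [n _]; rewrite /F /= !in_itv/= => /andP[h ->]; rewrite andbT.
    exact: lt_le_trans h.
  rewrite in_itv/= => /andP[x0 xb].
  exists (Num.trunc (b / x)) => //=; rewrite /F /= in_itv/= xb andbT.
  by rewrite ler_pdivrMr// mulrC -ler_pdivrMr// ltW// truncnS_gt.
have := @ge0_nondecreasing_set_cvg_integral _ (measurableTypeR R) R F (EFin \o g) mu.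
rewrite FE => H; apply: (cvg_unique (@ereal_hausdorff R) (H _ _ _ _)).
- move=> m n mn; rewrite subsetEset => x; rewrite /F /= !in_itv/= => /andP[h ->].
  rewrite andbT; apply: le_trans h; rewrite ler_pM2l// lef_pV2 ?posrE//.
  by rewrite ler_nat.
- by move=> i; exact: measurable_itv.
- move=> i; apply/measurable_EFinP; apply: measurable_funS (continuous_gt0_measurable cg) => //.
  move=> x; rewrite /F /= !in_itv/= andbT => /andP[h _]; exact: lt_le_trans h.
- move=> i x; rewrite /F /= !in_itv/= lee_fin => /andP[h _]; apply: g0.
  exact: lt_le_trans h.
have -> : (fun i => \int[mu]_(x in F i) (EFin \o g) x)%E =
    (fun i => (G b - G (b / i.+1%:R))%:E).
  apply/funext => i; apply: FTC_segment => //.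
  by rewrite ler_pdivrMr// ler_peMr ?(ltW b0)// ler1n.
apply: cvg_EFin; first by apply: nearW.
apply: cvgB; first exact: cvg_cst.
have G' : (G \o (fun n : nat => b / n.+1%:R)) @ \oo --> l.
  move/cvg_at_rightP : Gl; apply; split=> //.
  rewrite -(mulr0 b); apply: cvgM; first exact: cvg_cst.
  exact: cvg_harmonic.
exact: G'.
Qed.

End calculus.

(** * A linear first-order equation *)

Section duhamel.
Context {R : realType}.
Local Notation mu := (@lebesgue_measure R).
Local Notation Rpos := (`]0, +oo[%classic : set R).
Implicit Types (g dg : R -> R) (x z a b t C : R).
Variables (d Lam Q : R -> R).
Hypothesis d_ge0 : forall x, 0 < x -> 0 <= d x.
Hypothesis d_cont : forall x, 0 < x -> {for x, continuous d}.
Hypothesis Lam_d : forall x, 0 < x -> is_derive x 1 Lam (d x).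
Hypothesis Lam_cvg0 : Lam x @[x --> 0^'+] --> 0.
Hypothesis Q_cont : forall x, 0 < x -> {for x, continuous Q}.
Hypothesis Q01 : forall x, 0 < x -> 0 <= Q x <= 1.
Hypothesis Q_nincr : forall x y, 0 < x -> x <= y -> Q y <= Q x.

Let f t := Q t * d t * expR (Lam t).
Let f1 t := d t * expR (Lam t).

Let expLam_d x : 0 < x -> is_derive x 1 (fun t => expR (Lam t)) (f1 x).
Proof.
move=> x0; have := is_derive1_comp (is_derive_expR (Lam x)) (Lam_d x0).
by rewrite /f1 mulrC.
Qed.

Let expLam_cont x : 0 < x -> {for x, continuous (fun t => expR (Lam t))}.
Proof. by move=> x0; exact: is_derive_continuous (expLam_d x0). Qed.

Let f1_cont x : 0 < x -> {for x, continuous f1}.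
Proof. by move=> x0; apply: cvgM; [exact: d_cont|exact: expLam_cont]. Qed.

Let f_cont x : 0 < x -> {for x, continuous f}.
Proof.
move=> x0; apply: cvgM; last exact: expLam_cont.
by apply: cvgM; [exact: Q_cont|exact: d_cont].
Qed.

Let f1_ge0 x : 0 < x -> 0 <= f1 x.
Proof. by move=> x0; rewrite mulr_ge0 ?expR_ge0// d_ge0. Qed.

Let f_ge0 x : 0 < x -> 0 <= f x.
Proof. by move=> x0; rewrite !mulr_ge0 ?expR_ge0 ?d_ge0//; case/andP: (Q01 x0). Qed.

Let f_le x : 0 < x -> f x <= f1 x.
Proof.
move=> x0; rewrite /f -mulrA ler_piMl//; first exact: f1_ge0.
by case/andP: (Q01 x0).
Qed.

Let expLam_cvg : expR (Lam x) @[x --> 0^'+] --> (1 : R).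
Proof. by rewrite -expR0; apply: continuous_cvg => //; exact: continuous_expR. Qed.

Let int_f1 b : 0 < b -> (\int[mu]_(t in `]0%R, b]) (f1 t)%:E = (expR (Lam b) - 1)%:E)%E.
Proof. by move=> b0; apply: (@FTC_at_zero _ _ (fun t => expR (Lam t))) => //. Qed.

Let mf g b : (forall x, 0 < x -> {for x, continuous g}) ->
  measurable_fun (`]0%R, b]%classic : set R) g.
Proof.
move=> cg; apply: measurable_funS (continuous_gt0_measurable cg) => //.
by apply: subset_itvl.
Qed.

Let f1_int b : 0 < b -> mu.-integrable (`]0%R, b]%classic : set R) (EFin \o f1).
Proof.
move=> b0; apply/integrableP; split; first by apply/measurable_EFinP; exact: mf.
under eq_integral => x.
  rewrite inE/= in_itv/= => /andP[x0 _].
  rewrite ger0_norm ?f1_ge0//; over.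
by rewrite int_f1// ltry.
Qed.

Let f_int b : 0 < b -> mu.-integrable (`]0%R, b]%classic : set R) (EFin \o f).
Proof.
move=> b0; apply: (le_integrable _ _ _ (f1_int b0)) => //.
  by apply/measurable_EFinP; exact: mf.
move=> x /=; rewrite in_itv/= => /andP[x0 _].
by rewrite lee_fin !ger0_norm ?f_ge0 ?f1_ge0// f_le.
Qed.

(** Variation of constants for [y' = d (Q - y)] with [y(0+) = 1]; [Lam] is the
    primitive of [d] that vanishes at 0. *)
Definition duhamel x : R :=
  expR (- Lam x) * (1 + \int[mu]_(t in `]0%R, x]) (Q t * d t * expR (Lam t))).

Local Notation y := duhamel.

Let F x : R := 1 + \int[mu]_(t in `]0%R, x]) f t.

Let FE x : y x * expR (Lam x) = F x.
Proof. by rewrite /duhamel mulrAC -expRD addNr expR0 mul1r. Qed.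

Let F_derive x : 0 < x -> is_derive x 1 F (f x).
Proof.
move=> x0.
have xx : x < x + 1 by rewrite ltrDl.
have [d1 d2] := @continuous_FTC1 R f (BRight 0) x (x + 1) xx (f_int (lt_trans x0 xx)) x0 (f_cont x0).
rewrite derive1E in d2.
have d3 := DeriveDef d1 d2.
by have := is_deriveD (is_derive_cst (1 : R) x 1) d3; rewrite add0r.
Qed.

Lemma duhamel_derive x : 0 < x -> is_derive x 1 y (d x * (Q x - y x)).
Proof.
move=> x0.
have dN := is_deriveN (Lam_d x0).
have de := @is_derive1_comp R expR (- Lam) x _ _ (is_derive_expR _) dN.
have := is_deriveM de (F_derive x0).
rewrite /GRing.scale/= /f => H; apply: (is_derive_eq H).
rewrite /duhamel -/f -/(F x) /comp.
have -> : (- Lam) x = - Lam x by [].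
by rewrite expRN; field; rewrite gt_eqF// expR_gt0.
Qed.

Lemma duhamel_exp_bounds x : 0 < x -> 1 <= y x * expR (Lam x) <= expR (Lam x).
Proof.
move=> x0; rewrite FE /F lerDl -lerBrDl; apply/andP; split.
  by apply: Rintegral_ge0 => t /=; rewrite in_itv/= => /andP[t0 _]; exact: f_ge0.
have := int_f1 x0; move/(congr1 fine) => /= <-.
by apply: le_Rintegral => //; [exact: f_int|exact: f1_int|]
  => t /=; rewrite in_itv/= => /andP[t0 _]; exact: f_le.
Qed.

Lemma duhamel_le1 x : 0 < x -> y x <= 1.
Proof.
by move=> /duhamel_exp_bounds /andP[_]; rewrite -ler_pdivlMr ?expR_gt0// mulfV// gt_eqF// expR_gt0.
Qed.

(** As [Q] is nonincreasing, the source on [(0, x]] is at least [Q x], and the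
    constant [Q x] is exceeded by the initial value 1. *)
Lemma duhamel_geQ x : 0 < x -> Q x <= y x.
Proof.
move=> x0; rewrite -(ler_pM2r (expR_gt0 (Lam x))) FE /F.
have := int_f1 x0; move/(congr1 fine) => /= E.
have : Q x * (expR (Lam x) - 1) <= \int[mu]_(t in `]0%R, x]) f t.
  rewrite -E -RintegralZl//; last exact: f1_int.
  apply: le_Rintegral => //; [|exact: f_int|].
    exact: (@integrableZl _ _ _ _ _ _ (Q x) _ (f1_int x0)).
  move=> t /=; rewrite in_itv/= => /andP[t0 tx].
  by rewrite /f -mulrA ler_wpM2r ?Q_nincr// f1_ge0.
by case/andP: (Q01 x0); lra.
Qed.

(* Both comparison lemmas below multiply [g - y] by the integrating factor
   [expR (Lam _)], which turns the differential inequality into monotonicity. *)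
Let diff_derive g (g' : R) x : 0 < x -> is_derive x (1:R) g g' ->
  is_derive x 1 (fun t => (g t - y t) * expR (Lam t))
    ((g' - d x * (Q x - g x)) * expR (Lam x)).
Proof.
move=> x0 Hg.
have := is_deriveM (is_deriveB Hg (duhamel_derive x0)) (expLam_d x0).
rewrite /GRing.scale/= /f1 => H; apply: (is_derive_eq H).
have -> : (g - y) x = g x - y x by [].
ring.
Qed.

(** The comparison starts at 0, from [g <= 1 = y(0+)]. *)
Lemma duhamel_ge_subsolution g dg b : 0 < b ->
  (forall x, 0 < x <= b -> is_derive x (1:R) g (dg x)) ->
  (forall x, 0 < x <= b -> dg x <= d x * (Q x - g x)) ->
  (forall x, 0 < x <= b -> g x <= 1) -> g b <= y b.
Proof.
move=> b0 Hg dgle g1.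
rewrite -subr_le0 -(pmulr_lle0 _ (expR_gt0 (Lam b))).
have H x : 0 < x <= b -> (g b - y b) * expR (Lam b) <= expR (Lam x) - 1.
  move=> /andP[x0 xb].
  have xP t : x <= t <= b -> 0 < t <= b by move=> /andP[xt ->]; rewrite andbT (lt_le_trans x0).
  pose D t := - ((g t - y t) * expR (Lam t)).
  have : D x <= D b.
    apply: (@ge0_derive_le _ D (fun t => - ((dg t - d t * (Q t - g t)) * expR (Lam t)))) => // t /xP tb.
      by apply: is_deriveN; apply: diff_derive (Hg _ tb); case/andP: tb.
    by rewrite oppr_ge0 pmulr_lle0 ?expR_gt0// subr_le0 dgle.
  rewrite /D lerN2 => h; apply: (le_trans h).
  have := duhamel_exp_bounds x0 => /andP[h1 _].
  by rewrite mulrBl lerB// ler_piMl ?expR_ge0// g1// x0 xb.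
have : (fun x => expR (Lam x) - 1) @ 0^'+ --> (1 - 1 : R).
  by apply: cvgB => //; exact: cvg_cst.
rewrite subrr => /cvgr_to_ge; apply.
near=> x; apply: H; apply/andP; split => //; near: x.
exact: nbhs_right_le.
Unshelve. all: by end_near. Qed.

Lemma duhamel_le_supersolution g dg a b : 0 < a -> a <= b ->
  (forall x, a <= x <= b -> is_derive x 1 g (dg x)) ->
  (forall x, a <= x <= b -> d x * (Q x - g x) <= dg x) ->
  y a <= g a -> y b <= g b.
Proof.
move=> a0 ab Hg dgle ga.
rewrite -subr_ge0 -(pmulr_lge0 _ (expR_gt0 (Lam b))).
have : (g a - y a) * expR (Lam a) <= (g b - y b) * expR (Lam b).
  apply: (@ge0_derive_le _ (fun t => (g t - y t) * expR (Lam t))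
    (fun t => (dg t - d t * (Q t - g t)) * expR (Lam t))) => // t tb.
    by apply: diff_derive (Hg _ tb); case/andP: tb => /(lt_le_trans a0).
  by rewrite pmulr_lge0 ?expR_gt0// subr_ge0 dgle.
by apply: le_trans; rewrite pmulr_lge0 ?expR_gt0// subr_ge0.
Qed.

Lemma duhamel_nincr x z : 0 < x -> x <= z -> y z <= y x.
Proof.
move=> x0 xz; rewrite -lerN2.
apply: (@ge0_derive_le _ (fun t => - y t) (fun t => - (d t * (Q t - y t)))) => // t /andP[xt _].
  by apply: is_deriveN; apply: duhamel_derive; exact: lt_le_trans xt.
have t0 := lt_le_trans x0 xt.
by rewrite oppr_ge0 mulr_ge0_le0 ?d_ge0// subr_le0 duhamel_geQ.
Qed.

(** [y + C ln] is nondecreasing, because [- t y'(t) = t d(t) (y - Q)(t) <= C]. *)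
Lemma duhamel_log_lipschitz C x z : 0 < x -> x <= z ->
  (forall t, 0 < t -> t * d t * (y t - Q t) <= C) ->
  y x - y z <= C * (ln z - ln x).
Proof.
move=> x0 xz HC.
have : y x + C * ln x <= y z + C * ln z.
  apply: (@ge0_derive_le _ (fun t => y t + C * ln t)
    (fun t => d t * (Q t - y t) + C * t^-1)) => // t /andP[xt _].
    have t0 := lt_le_trans x0 xt.
    exact: is_deriveD (duhamel_derive t0) (is_deriveZ C (is_derive1_ln t0)).
  have t0 := lt_le_trans x0 xt.
  have := HC t t0; rewrite -(ler_pM2r (_ : 0 < t^-1)) ?invr_gt0//.
  rewrite (_ : t * d t * (y t - Q t) / t = d t * (y t - Q t)); first by lra.
  by field; rewrite gt_eqF.
by lra.
Qed.

End duhamel.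

(** * Tails and their average over fragments *)

Section scattering.
Context {R : realType}.
Local Notation mu := (@lebesgue_measure R).
Local Notation Rpos := (`]0, +oo[%classic : set R).
Local Notation I := (`]0, 1[%classic : set R).
Implicit Types (P : R -> R) (x y z C : R).
Variable nu : {finite_measure set (measurableTypeR R) -> \bar R}.
Hypothesis nuI : nu I = 1%E.

Lemma bounded_nu_integrable (f : R -> R) M : measurable_fun I f ->
  (forall z, 0 < z < 1 -> `|f z| <= M) -> nu.-integrable I (EFin \o f).
Proof.
move=> mf fM; apply: measurable_bounded_integrable => //.
  by rewrite [X in (X < _)%E]nuI ltry.
by exists M; split; [exact: num_real|move=> N MN z /=; rewrite in_itv/= => /fM /le_trans; apply; exact: ltW].
Qed.

Lemma nu_cst c : \int[nu]_(z in I) c = c.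
Proof. by rewrite Rintegral_cst//= nuI mulr1. Qed.

Lemma nu_cst_integrable c : nu.-integrable I (EFin \o cst c).
Proof. by apply: (@bounded_nu_integrable _ `|c|). Qed.

Lemma le_nu_integral (f g : R -> R) :
  nu.-integrable I (EFin \o f) -> nu.-integrable I (EFin \o g) ->
  (forall z, 0 < z < 1 -> f z <= g z) ->
  \int[nu]_(z in I) f z <= \int[nu]_(z in I) g z.
Proof. by move=> mf mg fg; apply: le_Rintegral => // z /=; rewrite in_itv/=; exact: fg. Qed.

(** If [Y] has tail [P] and [Z] is independent of law [nu], this is the tail of
    [Y Z]: the mass of the fragment that carries a tagged atom of a particle of
    mass [Y]. *)
Definition fragment_tail P x := \int[nu]_(z in I) P (x / z).

(** The Lipschitz condition in [ln x], rather than in [x], is invariant under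
    dilations, hence preserved by [fragment_tail].  It makes pointwise suprema
    of such functions continuous. *)
Definition tail_fun C P :=
  (forall x, 0 < x -> 0 <= P x <= 1) /\
  (forall x y, 0 < x -> x <= y -> P y <= P x /\ P x - P y <= C * (ln y - ln x)).

Lemma tail_fun_continuous C P x : tail_fun C P -> 0 < x -> {for x, continuous P}.
Proof.
move=> [P01 PC] x0.
have H t : 0 < t -> `|P x - P t| <= C * `|ln t - ln x|.
  move=> t0; have [xt|/ltW tx] := leP x t.
    have [h1 h2] := PC _ _ x0 xt.
    by rewrite !ger0_norm ?subr_ge0// ler_ln.
  have [h1 h2] := PC _ _ t0 tx.
  by rewrite distrC [in X in _ <= X]distrC !ger0_norm ?subr_ge0// ler_ln.
apply/cvgrPdist_le => e e0.
have C1 : 0 < `|C| + 1 by have := normr_ge0 C; lra.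
have /cvgrPdist_le L := continuous_ln x0.
near=> t.
have t0 : 0 < t by near: t; exact: lt_nbhsr.
apply: (le_trans (H _ t0)).
apply: (@le_trans _ _ ((`|C| + 1) * `|ln x - ln t|)).
  rewrite distrC; apply: ler_wpM2r => //; have := ler_norm C; lra.
rewrite mulrC -ler_pdivlMr//; near: t.
by apply: L; rewrite divr_gt0.
Unshelve. all: by end_near. Qed.

Lemma tail_fun_measurable C P : tail_fun C P -> measurable_fun Rpos P.
Proof. by move=> PC; apply: continuous_gt0_measurable => x; exact: tail_fun_continuous PC. Qed.

Lemma measurable_inv_itv01 : measurable_fun I (@GRing.inv R).
Proof.
apply: open_continuous_measurable_fun; first exact: interval_open.
move=> z; rewrite inE/= in_itv/= => /andP[z0 _].
by apply: inv_continuous; rewrite gt_eqF.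
Qed.

Lemma measurable_scaled P x : 0 < x -> measurable_fun Rpos P ->
  measurable_fun I (fun z => P (x / z)).
Proof.
move=> x0 mP; apply: (measurable_comp _ _ mP) => //.
- by move=> _ [z + <-]; rewrite /= !in_itv/= andbT => /andP[z0 _]; rewrite divr_gt0.
- by apply: measurable_funM => //; exact: measurable_inv_itv01.
Qed.

Lemma le_scaled x z : 0 < x -> 0 < z < 1 -> x <= x / z.
Proof.
by move=> x0 /andP[z0 z1]; rewrite ler_pdivlMr// ler_piMr// ltW.
Qed.

Lemma tail_fun_scaled_integrable C P x : tail_fun C P -> 0 < x ->
  nu.-integrable I (EFin \o (fun z => P (x / z))).
Proof.
move=> PC x0; apply: (@bounded_nu_integrable _ 1).
  by apply: measurable_scaled => //; exact: tail_fun_measurable PC.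
case: PC => P01 _ z /andP[z0 z1].
have /andP[h0 h1] := P01 _ (divr_gt0 x0 z0).
by rewrite ger0_norm.
Qed.

Lemma fragment_tail_ge0 P x : (forall t, 0 < t -> 0 <= P t) -> 0 < x -> 0 <= fragment_tail P x.
Proof.
move=> P0 x0; apply: Rintegral_ge0 => z /=; rewrite in_itv/= => /andP[z0 _].
by apply: P0; rewrite divr_gt0.
Qed.

Lemma fragment_tail_le C P x : tail_fun C P -> 0 < x -> fragment_tail P x <= P x.
Proof.
move=> PC x0; rewrite -[leRHS]nu_cst; apply: le_nu_integral.
- exact: tail_fun_scaled_integrable PC x0.
- exact: nu_cst_integrable.
- by move=> z z01; have [+ _] := PC.2 _ _ x0 (le_scaled x0 z01).
Qed.

Lemma fragment_tail_mono C1 C2 P1 P2 x : tail_fun C1 P1 -> tail_fun C2 P2 -> 0 < x ->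
  (forall t, 0 < t -> P1 t <= P2 t) -> fragment_tail P1 x <= fragment_tail P2 x.
Proof.
move=> PC1 PC2 x0 P12; apply: le_nu_integral.
- exact: tail_fun_scaled_integrable PC1 x0.
- exact: tail_fun_scaled_integrable PC2 x0.
- by move=> z /andP[z0 _]; apply: P12; rewrite divr_gt0.
Qed.

Lemma fragment_tail_tail_fun C P : tail_fun C P -> tail_fun C (fragment_tail P).
Proof.
move=> PC; split.
  move=> x x0; rewrite fragment_tail_ge0//=; last by move=> t /(PC.1 _) /andP[].
  by apply: (le_trans (fragment_tail_le PC x0)); have /andP[] := PC.1 _ x0.
move=> x y x0 xy; have y0 := lt_le_trans x0 xy.
have ix := tail_fun_scaled_integrable PC x0.
have iy := tail_fun_scaled_integrable PC y0.
have H z : 0 < z < 1 -> P (y / z) <= P (x / z) /\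
    P (x / z) - P (y / z) <= C * (ln y - ln x).
  move=> /andP[z0 _].
  have xyz : x / z <= y / z by rewrite ler_pM2r ?invr_gt0.
  have := PC.2 _ _ (divr_gt0 x0 z0) xyz.
  rewrite !ln_div ?posrE//.
  by have -> : ln y - ln z - (ln x - ln z) = ln y - ln x by lra.
split; first by apply: le_nu_integral => // z /H[].
rewrite /fragment_tail -RintegralB// -[leRHS]nu_cst; apply: le_nu_integral.
- exact: (integrableB _ ix iy).
- exact: nu_cst_integrable.
- by move=> z /H[].
Qed.

Lemma fragment_tail_ub C P f x : tail_fun C P -> 0 < x -> nu.-integrable I (EFin \o f) ->
  (forall z, 0 < z < 1 -> P (x / z) <= f z) -> fragment_tail P x <= \int[nu]_(z in I) f z.
Proof.
by move=> PC x0 fi H; apply: le_nu_integral => //; exact: tail_fun_scaled_integrable PC x0.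
Qed.

Lemma fragment_tail_lb C P f x : tail_fun C P -> 0 < x -> nu.-integrable I (EFin \o f) ->
  (forall z, 0 < z < 1 -> f z <= P (x / z)) -> \int[nu]_(z in I) f z <= fragment_tail P x.
Proof.
by move=> PC x0 fi H; apply: le_nu_integral => //; exact: tail_fun_scaled_integrable PC x0.
Qed.

End scattering.

(** * Powers, rates and moments of tails *)

Section powers.
Context {R : realType}.
Local Notation mu := (@lebesgue_measure R).
Local Notation Rpos := (`]0, +oo[%classic : set R).
Implicit Types (x y a b p q r : R).

Lemma powR_continuous p x : 0 < x -> {for x, continuous (fun t => t `^ p)}.
Proof. by move=> x0; apply: is_derive_continuous (is_derive1_powR p x0). Qed.

Lemma powR_cvgy p : p < 0 -> x `^ p @[x --> +oo] --> (0 : R).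
Proof.
move=> p0; apply/cvgrPdist_le => e e0.
near=> x.
have x0 : 0 < x by near: x; exact: nbhs_pinfty_gt.
rewrite sub0r normrN ger0_norm ?powR_ge0//.
rewrite -(opprK p) powRN -[leRHS]invrK lef_pV2 ?posrE ?invr_gt0 ?powR_gt0//.
have -> : e^-1 = (e^-1 `^ ((- p)^-1)) `^ (- p).
  by rewrite -powRrM mulVf ?powRr1// ?invr_ge0 ?ltW// oppr_eq0 lt_eqF.
apply: ge0_ler_powR; rewrite ?nnegrE ?powR_ge0 ?oppr_ge0 ?(ltW p0) ?(ltW x0)//.
Unshelve. all: by end_near. Qed.

Lemma integral_powR0 b p : 0 < b -> 0 < p ->
  (\int[mu]_(x in `]0%R, b]) (x `^ (p - 1))%:E = (b `^ p / p)%:E)%E.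
Proof.
move=> b0 p0.
have -> : b `^ p / p = p^-1 * b `^ p - 0 by rewrite subr0 mulrC.
apply: (@FTC_at_zero _ (fun x => x `^ (p - 1)) (fun x => p^-1 * x `^ p)) => //.
- by move=> x x0; exact: powR_ge0.
- by move=> x x0; exact: powR_continuous.
- move=> x x0; have := is_deriveZ p^-1 (is_derive1_powR p x0).
  by rewrite /GRing.scale/= mulrA mulVf ?gt_eqF// mul1r.
- suff : p^-1 * x `^ p @[x --> 0^'+] --> p^-1 * 0 by rewrite mulr0.
  apply: cvgM; first exact: cvg_cst.
  exact: powR_cvg0.
Qed.

Lemma integral_powRy a p : 0 < a -> p < 0 ->
  (\int[mu]_(x in `[a, +oo[) (x `^ (p - 1))%:E = (a `^ p / - p)%:E)%E.
Proof.
move=> a0 p0.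
have -> : a `^ p / - p = 0 - p^-1 * a `^ p by rewrite sub0r invrN mulrN mulrC.
apply: (@FTC_at_infinity _ (fun x => x `^ (p - 1)) (fun x => p^-1 * x `^ p)) => //.
- by move=> x x0; exact: powR_ge0.
- by move=> x x0; exact: powR_continuous.
- move=> x x0; have := is_deriveZ p^-1 (is_derive1_powR p x0).
  by rewrite /GRing.scale/= mulrA mulVf ?lt_eqF// mul1r.
- rewrite -(mulr0 p^-1); apply: cvgM; first exact: cvg_cst.
  exact: powR_cvgy.
Qed.

(** The common endpoint [a] is counted twice so that both integrals have the form
    computed by [integral_powR0] and [integral_powRy]. *)
Lemma integral_Rpos_split (f : R -> R) a : 0 < a -> measurable_fun Rpos f ->
  (forall x, 0 < x -> 0 <= f x) ->
  (\int[mu]_(x in Rpos) (f x)%:E =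
   \int[mu]_(x in `]0%R, a]) (f x)%:E + \int[mu]_(x in `[a, +oo[) (f x)%:E)%E.
Proof.
move=> a0 mf f0.
have RE : Rpos = (`]0%R, a]%classic : set R) `|` (`]a, +oo[%classic : set R).
  apply/seteqP; split => x /=; rewrite !in_itv/= !andbT.
    by move=> x0; case: (leP x a) => h; [left; rewrite x0|right].
  by move=> [/andP[]//|/(lt_trans a0)].
rewrite -[in RHS]integral_itv_obnd_cbnd; last first.
  apply/measurable_EFinP; apply: measurable_funS mf => //.
  by apply: subset_itvr; rewrite bnd_simp ltW.
rewrite {1}RE ge0_integral_setU//.
- by rewrite -RE; apply/measurable_EFinP.
- rewrite -RE => x /=; rewrite in_itv/= andbT lee_fin; exact: f0.
- apply/disj_setPS => x /= []; rewrite !in_itv/= andbT => /andP[_ h1] h2.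
  by move: h1; rewrite leNgt h2.
Qed.

End powers.

Section rates.
Context {R : realType}.
Local Notation mu := (@lebesgue_measure R).
Implicit Types (x A B : R).
Variables (l1 l2 : R).
Hypothesis l1_gt0 : 0 < l1.
Hypothesis l2_gt0 : 0 < l2.

Definition rate A B x := A * x `^ (l1 - 1) + B * x `^ (l2 - 1).
Definition cumrate A B x := A / l1 * x `^ l1 + B / l2 * x `^ l2.

Lemma rate_ge0 A B x : 0 <= A -> 0 <= B -> 0 <= rate A B x.
Proof. by move=> A0 B0; rewrite addr_ge0// mulr_ge0// powR_ge0. Qed.

Lemma rate_continuous A B x : 0 < x -> {for x, continuous (rate A B)}.
Proof.
move=> x0; apply: cvgD; (apply: cvgM; first exact: cvg_cst); exact: powR_continuous.
Qed.

Lemma cumrate_derive A B x : 0 < x -> is_derive x 1 (cumrate A B) (rate A B x).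
Proof.
move=> x0.
have := is_deriveD (is_deriveZ (A / l1) (is_derive1_powR l1 x0))
  (is_deriveZ (B / l2) (is_derive1_powR l2 x0)).
by rewrite /GRing.scale/= !mulrA !divfK ?gt_eqF.
Qed.

Lemma cumrate_cvg0 A B : cumrate A B x @[x --> 0^'+] --> (0 : R).
Proof.
suff : cumrate A B x @[x --> 0^'+] --> A / l1 * 0 + B / l2 * 0.
  by rewrite !mulr0 addr0.
by apply: cvgD; (apply: cvgM; first exact: cvg_cst); exact: powR_cvg0.
Qed.

Lemma mul_rate A B x : 0 < x -> x * rate A B x = A * x `^ l1 + B * x `^ l2.
Proof.
move=> x0; rewrite /rate mulrDr ![x * (_ * _)]mulrCA.
by rewrite !mulr_powRB1 ?ltW.
Qed.

Lemma rate_le A1 B1 A2 B2 x : A1 <= A2 -> B1 <= B2 -> rate A1 B1 x <= rate A2 B2 x.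
Proof. by move=> hA hB; rewrite lerD// ler_wpM2r// powR_ge0. Qed.

End rates.

Section tail_moments.
Context {R : realType}.
Local Notation mu := (@lebesgue_measure R).
Local Notation Rpos := (`]0, +oo[%classic : set R).
Implicit Types (x r g : R) (P : R -> R).

(** The moment of order [r - 1] of the law of tail [P], that is
    [int_0^oo y^(r-1) d(-P)(y)], after an integration by parts;
    at [r = 1] it is the total mass. *)
Definition tail_moment r P : R := if r == 1 then 1 else
  (1 - r) * \int[mu]_(x in Rpos) (x `^ (r - 2) * (1 - P x)).

Section bounds.
Variables (r g x1 : R).
Hypothesis x1_gt0 : 0 < x1.
Hypothesis r_ge0 : 0 <= r.
Hypothesis r_le1 : r <= 1.
Hypothesis rg : 0 < g + r - 1.

Lemma integral_one_minus_tail C P : r < 1 -> tail_fun C P ->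
  (forall x, 0 < x -> 1 - P x <= (x / x1) `^ g) ->
  (\int[mu]_(x in Rpos) (x `^ (r - 2) * (1 - P x))%:E <=
     (x1 `^ (r - 1) / (g + r - 1) + x1 `^ (r - 1) / (1 - r))%:E)%E.
Proof.
move=> r1 PC Plo.
have cD x : 0 < x -> {for x, continuous (fun x => x `^ (r - 2) * (1 - P x))}.
  move=> x0; apply: cvgM; first exact: powR_continuous.
  by apply: cvgB; [exact: cvg_cst|exact: tail_fun_continuous PC x0].
have mD := continuous_gt0_measurable cD.
have D0 x : 0 < x -> 0 <= x `^ (r - 2) * (1 - P x).
  by move=> x0; rewrite mulr_ge0 ?powR_ge0// subr_ge0; have /andP[] := PC.1 _ x0.
rewrite (integral_Rpos_split x1_gt0)// EFinD; apply: leeD.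
  have -> : x1 `^ (r - 1) / (g + r - 1) = x1 `^ (- g) * (x1 `^ (g + r - 1) / (g + r - 1)).
    rewrite mulrA -powRD ?(gt_eqF x1_gt0) ?implybT//.
    by have -> : - g + (g + r - 1) = r - 1 by ring.
  rewrite EFinM -(integral_powR0 x1_gt0 rg) -ge0_integralZl//; last first.
  - by rewrite lee_fin powR_ge0.
  - by move=> x _; rewrite lee_fin powR_ge0.
  - apply/measurable_EFinP; exact: measurable_funTS (measurable_powR _).
  apply: ge0_le_integral => //.
  - by move=> x /=; rewrite in_itv/= lee_fin => /andP[x0 _]; exact: D0.
  - apply/measurable_EFinP; apply: measurable_funS mD => //.
    exact: subset_itvl.
  - apply/measurable_EFinP; apply: measurable_funM => //.
    exact: measurable_funTS (measurable_powR _).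
  move=> x /=; rewrite in_itv/= => /andP[x0 _]; rewrite lee_fin.
  have -> : x1 `^ (- g) * x `^ (g + r - 1 - 1) = x `^ (r - 2) * (x / x1) `^ g.
    rewrite powRM ?invr_ge0 ?ltW// -(powR_inv1 (ltW x1_gt0)) -powRrM mulN1r.
    rewrite mulrA -powRD ?(gt_eqF x0) ?implybT// mulrC.
    by have -> : g + r - 1 - 1 = r - 2 + g by ring.
  by rewrite ler_wpM2l ?powR_ge0// Plo.
have -> : x1 `^ (r - 1) / (1 - r) = x1 `^ (r - 1) / - (r - 1) by rewrite opprB.
rewrite -integral_powRy ?subr_lt0//.
apply: ge0_le_integral => //.
- move=> x /=; rewrite in_itv/= andbT lee_fin => h; apply: D0; exact: lt_le_trans h.
- apply/measurable_EFinP; apply: measurable_funS mD => //.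
  by apply: subset_itvr; rewrite bnd_simp.
- by apply/measurable_EFinP; exact: measurable_funTS (measurable_powR _).
move=> x /=; rewrite in_itv/= andbT => h; rewrite lee_fin.
have x0 := lt_le_trans x1_gt0 h.
have -> : r - 1 - 1 = r - 2 by ring.
by rewrite ler_piMr ?powR_ge0// lerBlDr lerDl; have /andP[] := PC.1 _ x0.
Qed.

Lemma one_minus_tail_integrable C P : r < 1 -> tail_fun C P ->
  (forall x, 0 < x -> 1 - P x <= (x / x1) `^ g) ->
  mu.-integrable Rpos (EFin \o (fun x => x `^ (r - 2) * (1 - P x))).
Proof.
move=> r1 PC Plo.
have cD x : 0 < x -> {for x, continuous (fun x => x `^ (r - 2) * (1 - P x))}.
  move=> x0; apply: cvgM; first exact: powR_continuous.
  by apply: cvgB; [exact: cvg_cst|exact: tail_fun_continuous PC x0].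
apply/integrableP; split.
  by apply/measurable_EFinP; exact: continuous_gt0_measurable.
under eq_integral => x.
  rewrite inE/= in_itv/= andbT => x0; rewrite ger0_norm; last first.
    by rewrite mulr_ge0 ?powR_ge0// subr_ge0; have /andP[] := PC.1 _ x0.
  over.
by apply: (le_lt_trans (integral_one_minus_tail r1 PC Plo)); rewrite ltry.
Qed.

Lemma tail_moment_ub C P : tail_fun C P ->
  (forall x, 0 < x -> 1 - P x <= (x / x1) `^ g) ->
  tail_moment r P <= (1 + (g + r - 1)^-1) * x1 `^ (r - 1).
Proof.
move=> PC Plo; rewrite /tail_moment; case: eqVneq => [rE|rN].
  by rewrite rE subrr powRr0 mulr1 lerDl invr_ge0 -{1}rE ltW.
have r1 : r < 1 by rewrite lt_neqAle rN.
have := integral_one_minus_tail r1 PC Plo.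
have fin : (\int[mu]_(x in Rpos) (x `^ (r - 2) * (1 - P x))%:E)%E \is a fin_num.
  by apply: integrable_fin_num => //; exact: one_minus_tail_integrable r1 PC Plo.
rewrite /Rintegral -(fineK fin) lee_fin => H.
apply: (le_trans (ler_wpM2l _ H)); first by rewrite subr_ge0.
have p0 : 0 < x1 `^ (r - 1) by rewrite powR_gt0.
rewrite mulrDr [X in _ + X]mulrCA divff ?mulr1; last by rewrite subr_eq0 eq_sym.
rewrite [leRHS]mulrDl mul1r addrC lerD2l mulrCA mulrC ler_wpM2r ?(ltW p0)//.
by rewrite ler_piMl ?invr_ge0 ?(ltW rg)// lerBlDr lerDl.
Qed.

(** As [r - 1 <= 0], moving mass to the right decreases the moment. *)
Lemma tail_moment_anti C1 C2 P1 P2 : tail_fun C1 P1 -> tail_fun C2 P2 ->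
  (forall x, 0 < x -> 1 - P1 x <= (x / x1) `^ g) ->
  (forall x, 0 < x -> P1 x <= P2 x) -> tail_moment r P2 <= tail_moment r P1.
Proof.
move=> PC1 PC2 Plo P12; rewrite /tail_moment; case: eqVneq => [//|rN].
have r1 : r < 1 by rewrite lt_neqAle rN.
rewrite ler_wpM2l ?subr_ge0//; apply: le_Rintegral => //.
- apply: (one_minus_tail_integrable r1 PC2) => x x0; apply: le_trans (Plo _ x0).
  by rewrite lerB// P12.
- exact: (one_minus_tail_integrable r1 PC1).
- move=> x /=; rewrite in_itv/= andbT => x0.
  by rewrite ler_wpM2l ?powR_ge0// lerB// P12.
Qed.

Lemma tail_moment_lb C P (T : R) : tail_fun C P -> 0 < T ->
  (forall x, 0 < x -> 1 - P x <= (x / x1) `^ g) ->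
  (forall x, T <= x -> P x <= 2^-1) -> 2^-1 * T `^ (r - 1) <= tail_moment r P.
Proof.
move=> PC T0 Plo Phi; rewrite /tail_moment; case: eqVneq => [->|rN].
  by rewrite subrr powRr0; lra.
have r1 : r < 1 by rewrite lt_neqAle rN.
have di := one_minus_tail_integrable r1 PC Plo.
have fin : (\int[mu]_(x in Rpos) (x `^ (r - 2) * (1 - P x))%:E)%E \is a fin_num.
  exact: integrable_fin_num.
have r10 : 0 < 1 - r by rewrite subr_gt0.
rewrite mulrC -ler_pdivrMl// -lee_fin /Rintegral fineK//.
have mD : measurable_fun Rpos (fun x => x `^ (r - 2) * (1 - P x)).
  by move/integrableP : di => [/measurable_EFinP].
have -> : (1 - r)^-1 * (T `^ (r - 1) / 2) = 2^-1 * (T `^ (r - 1) / - (r - 1)).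
  by rewrite opprB; ring.
rewrite EFinM -integral_powRy ?subr_lt0// -ge0_integralZl//; last 2 first.
- by apply/measurable_EFinP; exact: measurable_funTS (measurable_powR _).
- by move=> x _; rewrite lee_fin powR_ge0.
apply: (@le_trans _ _ (\int[mu]_(x in `[T, +oo[) (x `^ (r - 2) * (1 - P x))%:E)%E).
  apply: ge0_le_integral => //.
  - by move=> x _; rewrite lee_fin mulr_ge0// powR_ge0.
  - by apply/measurable_EFinP; apply: measurable_funM => //; exact: measurable_funTS (measurable_powR _).
  - apply/measurable_EFinP; apply: measurable_funS mD => //.
    by apply: subset_itvr; rewrite bnd_simp.
  move=> x /=; rewrite in_itv/= andbT => Tx; rewrite lee_fin.
  have -> : r - 1 - 1 = r - 2 by ring.
  rewrite mulrC ler_wpM2l ?powR_ge0//; have := Phi _ Tx; lra.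
apply: ge0_subset_integral => //.
- by apply/measurable_EFinP.
- move=> x /=; rewrite in_itv/= andbT => x0; rewrite lee_fin.
  by rewrite mulr_ge0 ?powR_ge0// subr_ge0; have /andP[] := PC.1 _ x0.
- by apply: subset_itvr; rewrite bnd_simp.
Qed.

End bounds.
End tail_moments.

(** * A stationary tail by monotone iteration *)

Section exponential_bounds.
Context {R : realType}.
Implicit Types (x p s l : R).

Lemma powR_expR_bounded p s l : 0 < p -> 0 < s -> 0 < l ->
  exists2 C, 0 <= C & forall x, 0 < x -> x `^ p * expR (1 - (x / s) `^ l) <= C.
Proof.
move=> p0 s0 l0; pose q := p / l; have q0 : 0 < q by rewrite divr_gt0.
(* With [u = (x / s)^l], the bound is [(u / q)^q <= exp(u / q)^q = exp u]. *)
exists (expR 1 * (s `^ p * q `^ q)).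
  by rewrite !mulr_ge0 ?expR_ge0 ?powR_ge0.
move=> x x0; rewrite expRD mulrCA ler_pM2l ?expR_gt0//.
rewrite expRN ler_pdivrMr ?expR_gt0//.
pose u := (x / s) `^ l; rewrite -/u.
have u0 : 0 <= u by exact: powR_ge0.
have xs0 : 0 <= x / s by rewrite divr_ge0 ?ltW.
have -> : expR u = expR (u / q) `^ q by rewrite -expRM divfK ?(gt_eqF q0).
have uqq : (u / q) `^ q = (x `^ p / s `^ p) / q `^ q.
  rewrite powRM ?invr_ge0 ?(ltW q0)// -?[q^-1](powR_inv1 (ltW q0)) -powRrM mulN1r powRN.
  congr (_ / _); rewrite /u -powRrM /q mulrCA mulfV ?(gt_eqF l0)// mulr1.
  by rewrite powRM ?invr_ge0 ?(ltW x0) ?(ltW s0)// -[s^-1](powR_inv1 (ltW s0)) -powRrM mulN1r powRN.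
have : (u / q) `^ q <= expR (u / q) `^ q.
  apply: ge0_ler_powR; rewrite ?nnegrE ?expR_ge0 ?(ltW q0)//.
    by rewrite mulr_ge0// invr_ge0 ltW.
  by have := expR_ge1Dx (u / q); lra.
rewrite uqq ler_pdivrMr ?powR_gt0// ler_pdivrMr ?powR_gt0// => h.
by apply: (le_trans h); rewrite le_eqVlt; apply/orP; left; apply/eqP; ring.
Qed.

Lemma expR_inv_le (t : R) : 0 < t -> expR (1 - t^-1) <= t.
Proof.
move=> t0; rewrite -[leRHS]invrK -[1 - t^-1]opprB expRN lef_pV2 ?posrE ?expR_gt0 ?invr_gt0//.
by have := expR_ge1Dx (t^-1 - 1); lra.
Qed.

End exponential_bounds.

Lemma one_powR {R : realType} (l : R) : 1 `^ l = 1 :> R.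
Proof. by rewrite powR1. Qed.

Section fixpoint.
Context {R : realType}.
Local Notation mu := (@lebesgue_measure R).
Local Notation Rpos := (`]0, +oo[%classic : set R).
Local Notation I := (`]0, 1[%classic : set R).
Implicit Types (P f : R -> R) (x y z t : R).
Variable nu : {finite_measure set (measurableTypeR R) -> \bar R}.
Hypothesis nuI : nu I = 1%E.
Variables (k0 l1 l2 cA cB : R).
Hypothesis k0_ge0 : 0 <= k0.
Hypothesis k0_lt1 : k0 < 1.
Hypothesis k0_l1 : k0 <= l1.
Hypothesis l12 : l1 <= l2.
Hypothesis l2_le1 : l2 <= 1.
Hypothesis l_gt1 : 1 < l1 + l2.
Hypothesis nu_k0 : nu.-integrable I (EFin \o (fun z => z `^ (k0 - 1))).
Hypothesis cA0 : 0 < cA.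
Hypothesis cB0 : 0 < cB.

Local Notation g := (1 - k0 + l1).
Local Notation C0 := (\int[nu]_(z in I) z `^ (k0 - 1)).
Local Notation kap := (\int[nu]_(z in I) z `^ l1).

Let l1_gt0 : 0 < l1. Proof. by move: k0_ge0 k0_l1 l12 l2_le1 l_gt1; lra. Qed.
Let l2_gt0 : 0 < l2. Proof. by move: k0_ge0 k0_l1 l12 l2_le1 l_gt1; lra. Qed.

Lemma nu_integral_gt0 f : nu.-integrable I (EFin \o f) ->
  (forall z, 0 < z < 1 -> 0 < f z) -> 0 < \int[nu]_(z in I) f z.
Proof.
move=> fi f0; rewrite lt0r; apply/andP; split; last first.
  by apply: Rintegral_ge0 => z /=; rewrite in_itv/= => /f0/ltW.
apply/negP => /eqP H.
have fin : (\int[nu]_(z in I) (f z)%:E)%E \is a fin_num by exact: integrable_fin_num.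
have H0 : (\int[nu]_(z in I) `|(f z)%:E| = 0)%E.
  transitivity (\int[nu]_(z in I) (f z)%:E)%E.
    apply: eq_integral.
    by move=> z; rewrite inE/= in_itv/= => /f0/ltW zf; rewrite /= ger0_norm.
  by rewrite -(fineK fin) -[fine _]/(Rintegral _ _ _) H.
have mf : measurable_fun I (EFin \o f) by case/integrableP : fi.
have /(ae_eq_integral_abs nu (measurable_itv _) mf) := H0.
move=> [N [mN N0 NP]].
have IN : I `<=` N.
  move=> z Iz; apply: NP => /= /(_ Iz) /eqP; rewrite eqe => /eqP fz.
  by move: Iz; rewrite /= in_itv/= => /f0; rewrite fz ltxx.
have : (nu I <= nu N)%E by apply: le_measure; rewrite ?inE.
by rewrite [X in (X <= _)%E]nuI N0 lee_fin ler10.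
Qed.

Lemma powR_l1_integrable : nu.-integrable I (EFin \o (fun z => z `^ l1)).
Proof.
apply: (@bounded_nu_integrable _ _ nuI _ 1).
  exact: measurable_funTS (measurable_powR _).
move=> z /andP[z0 z1]; rewrite ger0_norm ?powR_ge0//.
by rewrite -[leRHS](powRr0 z); apply: ger_powR; rewrite ?z0 ?(ltW z1)// ltW.
Qed.

Lemma mean_powR_l1_lt1 : kap < 1.
Proof.
rewrite -subr_gt0 -{1}(nu_cst nuI 1) -RintegralB//; last 2 first.
- exact: nu_cst_integrable.
- exact: powR_l1_integrable.
apply: nu_integral_gt0.
  exact: (integrableB _ (nu_cst_integrable nuI 1) powR_l1_integrable).
move=> z /andP[z0 z1]; rewrite subr_gt0.
by rewrite -[ltRHS](one_powR l1); apply: gt0_ltr_powR; rewrite ?nnegrE// ltW.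
Qed.

Lemma C0_gt0 : 0 < C0.
Proof. by apply: nu_integral_gt0 => // z /andP[z0 _]; exact: powR_gt0. Qed.

Section barriers.
Variables (x1 s C : R).
Hypothesis x1_gt0 : 0 < x1.
Hypothesis x1_s : x1 <= s.

Let s_gt0 : 0 < s. Proof. exact: lt_le_trans x1_s. Qed.

(** Tails between the two barriers [1 - (x / x1)^g] and
    [expR (1 - (x / s)^l1)]. *)
Definition admissible P := [/\ tail_fun C P,
  forall x, 0 < x -> 1 - P x <= (x / x1) `^ g
  & forall x, 0 < x -> P x <= expR (1 - (x / s) `^ l1)].

(** The deficit [1 - P] vanishes at 0 like the power [g], but only the weaker power
    [1 - k0] survives the average, because [z^(k0-1)] is the most singular power of [z]
    that [nu] is known to integrate. *)
Lemma fragment_tail_lower P x : admissible P -> 0 < x ->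
  1 - fragment_tail nu P x <= C0 * (x / x1) `^ (1 - k0).
Proof.
move=> [PC Plo _] x0.
have ii : nu.-integrable I (EFin \o (fun z => (x / x1) `^ (1 - k0) * z `^ (k0 - 1))).
  by apply: (@integrableZl _ _ _ _ _ _ ((x / x1) `^ (1 - k0)) _ nu_k0).
have i1 := nu_cst_integrable nuI 1.
suff : \int[nu]_(z in I) (1 - (x / x1) `^ (1 - k0) * z `^ (k0 - 1)) <= fragment_tail nu P x.
  rewrite RintegralB// nu_cst// RintegralZl//; lra.
apply: (fragment_tail_lb nuI PC x0); first exact: (integrableB _ i1 ii).
move=> z z01; case/andP: (z01) => z0 z1; rewrite lerBlDr -lerBlDl.
set v := x / z / x1.
have v0 : 0 < v by rewrite !divr_gt0.
have -> : (x / x1) `^ (1 - k0) * z `^ (k0 - 1) = v `^ (1 - k0).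
  have -> : v = x / x1 * z^-1 by rewrite /v mulrAC.
  rewrite [in RHS]powRM ?divr_ge0 ?invr_ge0 ?ltW//; congr (_ * _).
  by rewrite -(powR_inv1 (ltW z0)) -powRrM mulN1r opprB.
have [v1|/ltW v1] := leP v 1; last first.
  apply: (@le_trans _ _ 1).
    by rewrite lerBlDr lerDl; have /andP[] := PC.1 _ (divr_gt0 x0 z0).
  by rewrite -[leLHS](one_powR (1 - k0)); apply: ge0_ler_powR; rewrite ?nnegrE ?(ltW v0) ?subr_ge0 ?(ltW k0_lt1).
apply: (le_trans (Plo _ (divr_gt0 x0 z0))); rewrite -/v.
by apply: ger_powR; rewrite ?v0// lerDl ltW.
Qed.

(** Above [s], dividing the argument by [z] brings out a factor at most [z^l1] in
    front of the exponential; the strict inequality [int z^l1 d nu < 1] then makes the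
    exponential a supersolution. *)
Lemma fragment_tail_exp_decay P x : admissible P -> s <= x ->
  fragment_tail nu P x <= kap * expR (1 - (x / s) `^ l1).
Proof.
move=> [PC _ Phi] sx; have x0 : 0 < x by exact: lt_le_trans sx.
rewrite mulrC -RintegralZl//; last exact: powR_l1_integrable.
apply: (fragment_tail_ub nuI PC x0).
  by apply: (@integrableZl _ _ _ _ _ _ _ _ powR_l1_integrable).
move=> z /andP[z0 z1]; apply: (le_trans (Phi _ (divr_gt0 x0 z0))).
set v := (x / s) `^ l1; set t := z `^ l1.
have t0 : 0 < t by exact: powR_gt0.
have -> : (x / z / s) `^ l1 = v / t.
  rewrite mulrAC powRM ?divr_ge0 ?invr_ge0 ?ltW//; congr (_ * _).
  by rewrite -(powR_inv1 (ltW z0)) -powRrM mulN1r powRN.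
have v1 : 1 <= v.
  rewrite -[leLHS](one_powR l1) /v; apply: ge0_ler_powR; rewrite ?nnegrE ?ler01 ?(ltW l1_gt0)//.
    by rewrite divr_ge0 ?ltW.
  by rewrite ler_pdivlMr// mul1r.
have -> : 1 - v / t = (1 - v) + v * (1 - t^-1) by ring.
rewrite expRD ler_pM2l ?expR_gt0//.
apply: (le_trans _ (expR_inv_le t0)); rewrite ler_expR.
have ti : 1 <= t^-1.
  rewrite -[leLHS]invr1 lef_pV2 ?posrE//.
  by rewrite -[leRHS](one_powR l1) /t; apply: ge0_ler_powR; rewrite ?nnegrE ?ltW.
rewrite -subr_ge0; have -> : 1 - t^-1 - v * (1 - t^-1) = (v - 1) * (t^-1 - 1) by ring.
by rewrite mulr_ge0 ?subr_ge0.
Qed.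

Let K r : R := 1 + (g + r - 1)^-1.
Let Amax := cA * K l2 * x1 `^ (l2 - 1).
Let Bmax := cB * K l1 * x1 `^ (l1 - 1).
Let T := s * 2 `^ (l1^-1).
Let Amin := cA * (2^-1 * T `^ (l2 - 1)).

(** The constants are those for which [step] preserves the barriers: [Amin], [Amax]
    and [Bmax] bound the coefficients of the rate for every admissible tail, the
    lower barrier is a subsolution when [x1] is small, and the upper one a
    supersolution when [s] is large. *)
Hypothesis x1_small : (Amax * x1 `^ l1 + Bmax * x1 `^ l2) * C0 <= g.
Hypothesis s_large : l1 <= Amin * (1 - kap) * s `^ l1.
Hypothesis C_large : forall x, 0 < x ->
  (Amax * x `^ l1 + Bmax * x `^ l2) * expR (1 - (x / s) `^ l1) <= C.
Hypothesis g_le_C : g <= C.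

Definition gainA P := cA * tail_moment l2 P.
Definition gainB P := cB * tail_moment l1 P.

(** The solution of [y' = d[P] (fragment_tail P - y)], where both the rate and the
    source are those of [P]; a fixed point solves the nonlinear equation. *)
Definition step P :=
  duhamel (rate l1 l2 (gainA P) (gainB P)) (cumrate l1 l2 (gainA P) (gainB P)) (fragment_tail nu P).

Let g1 : 0 < g + l1 - 1.
Proof. by move: k0_l1 l1_gt0; lra. Qed.
Let g2 : 0 < g + l2 - 1.
Proof. by move: g1 l12; lra. Qed.
Let l1_le1 : l1 <= 1. Proof. exact: le_trans l2_le1. Qed.
Let T_gt0 : 0 < T. Proof. by rewrite mulr_gt0 ?powR_gt0. Qed.

Let half_beyond_T P x : admissible P -> T <= x -> P x <= 2^-1.
Proof.
move=> [_ _ Phi] Tx; apply: (le_trans (Phi _ (lt_le_trans T_gt0 Tx))).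
have h : 2 <= (x / s) `^ l1.
  have -> : 2 = (2 `^ l1^-1) `^ l1 :> R by rewrite -powRrM mulVf ?powRr1 ?gt_eqF.
  apply: ge0_ler_powR; rewrite ?nnegrE ?powR_ge0 ?(ltW l1_gt0)//.
    by rewrite divr_ge0 ?(ltW s_gt0)// (le_trans (ltW T_gt0)).
  by rewrite ler_pdivlMr// mulrC.
apply: (@le_trans _ _ (expR (-1))); first by rewrite ler_expR; lra.
rewrite expRN lef_pV2 ?posrE ?expR_gt0//.
by have := expR_ge1Dx (1 : R); lra.
Qed.

Lemma gain_bounds P : admissible P ->
  [/\ Amin <= gainA P <= Amax, 0 < gainB P <= Bmax & 0 < gainA P].
Proof.
move=> aP; case: (aP) => PC Plo Phi.
have ub2 := tail_moment_ub x1_gt0 (ltW l2_gt0) l2_le1 g2 PC Plo.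
have ub1 := tail_moment_ub x1_gt0 (ltW l1_gt0) l1_le1 g1 PC Plo.
have hT x : T <= x -> P x <= 2^-1 by exact: half_beyond_T.
have lb2 := tail_moment_lb x1_gt0 l2_le1 g2 PC T_gt0 Plo hT.
have lb1 := tail_moment_lb x1_gt0 l1_le1 g1 PC T_gt0 Plo hT.
have p r : 0 < 2^-1 * T `^ (r - 1) by rewrite mulr_gt0 ?invr_gt0 ?powR_gt0.
split.
- by rewrite /Amin /Amax /gainA -mulrA !ler_pM2l// lb2 ub2.
- rewrite /gainB /Bmax -mulrA ler_pM2l// ub1 andbT mulr_gt0//.
  exact: lt_le_trans lb1.
- by rewrite /gainA mulr_gt0//; exact: lt_le_trans lb2.
Qed.

Section step_properties.
Variable P : R -> R.
Hypothesis aP : admissible P.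
Let A := gainA P.
Let B := gainB P.
Let d := rate l1 l2 A B.
Let Lam := cumrate l1 l2 A B.
Let Q := fragment_tail nu P.

Let A0 : 0 <= A. Proof. by have [_ _ /ltW] := gain_bounds aP. Qed.
Let B0 : 0 <= B. Proof. by have [_ /andP[/ltW]] := gain_bounds aP. Qed.
Let PC : tail_fun C P. Proof. by case: aP. Qed.
Let QC : tail_fun C Q. Proof. exact: fragment_tail_tail_fun. Qed.
Let d_ge0 x : 0 < x -> 0 <= d x. Proof. by move=> _; exact: rate_ge0. Qed.
Let d_cont x : 0 < x -> {for x, continuous d}.
Proof. by move=> x0; exact: rate_continuous. Qed.
Let Lam_d x : 0 < x -> is_derive x 1 Lam (d x).
Proof. by move=> x0; exact: cumrate_derive. Qed.
Let Lam0 : Lam x @[x --> 0^'+] --> (0 : R).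
Proof. exact: cumrate_cvg0. Qed.
Let Q_cont x : 0 < x -> {for x, continuous Q}.
Proof. by move=> x0; exact: tail_fun_continuous QC x0. Qed.
Let Q01 x : 0 < x -> 0 <= Q x <= 1.
Proof. by move=> x0; exact: QC.1. Qed.
Let Q_nincr x y : 0 < x -> x <= y -> Q y <= Q x.
Proof. by move=> x0 xy; have [] := QC.2 _ _ x0 xy. Qed.

Lemma step_derive x : 0 < x -> is_derive x 1 (step P) (d x * (Q x - step P x)).
Proof. by move=> x0; exact: duhamel_derive. Qed.

Lemma step_geQ x : 0 < x -> Q x <= step P x.
Proof. by move=> x0; exact: duhamel_geQ. Qed.

Lemma step_le1 x : 0 < x -> step P x <= 1.
Proof. by move=> x0; exact: duhamel_le1. Qed.

Lemma step_ge_subsolution (h dh : R -> R) (b : R) : 0 < b ->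
  (forall x, 0 < x <= b -> is_derive x (1 : R) h (dh x)) ->
  (forall x, 0 < x <= b -> dh x <= d x * (Q x - h x)) ->
  (forall x, 0 < x <= b -> h x <= 1) -> h b <= step P b.
Proof. exact: (@duhamel_ge_subsolution R d Lam Q). Qed.

Lemma step_le_supersolution (h dh : R -> R) (a b : R) : 0 < a -> a <= b ->
  (forall x, a <= x <= b -> is_derive x (1 : R) h (dh x)) ->
  (forall x, a <= x <= b -> d x * (Q x - h x) <= dh x) ->
  step P a <= h a -> step P b <= h b.
Proof. exact: (@duhamel_le_supersolution R d Lam Q). Qed.

(** Multiplied by [t], the requirement on the barrier [h = 1 - u],
    [u = (t / x1)^g], is [t d(t) (1 - Q - u) <= g u].  Here
    [1 - Q <= C0 (t / x1)^(1-k0)], the product [t d(t)] is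
    [O((t / x1)^l1)] below [x1], and [g] is the sum of the two exponents. *)
Lemma step_lower x : 0 < x -> 1 - step P x <= (x / x1) `^ g.
Proof.
move=> x0; rewrite lerBlDr -lerBlDl.
have g0 : 0 < g by move: g1 l1_le1; lra.
(* Beyond [x1] the barrier is at most 0. *)
have [xx1|/ltW xx1] := leP x x1; last first.
  apply: (@le_trans _ _ 0); last by apply: le_trans (step_geQ x0); case/andP: (Q01 x0).
  rewrite subr_le0 -[leLHS](one_powR g); apply: ge0_ler_powR; rewrite ?nnegrE ?(ltW g0)//.
    by rewrite divr_ge0 ?ltW.
  by rewrite ler_pdivlMr ?mul1r.
pose u t := (t / x1) `^ g.
have uE t : 0 < t -> u t = x1 `^ (- g) * t `^ g.
  move=> t0; rewrite /u powRM ?invr_ge0 ?(ltW x1_gt0) ?(ltW t0)// mulrC.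
  by rewrite -(powR_inv1 (ltW x1_gt0)) -powRrM mulN1r.
pose h t := 1 - x1 `^ (- g) * t `^ g.
rewrite -/(u x) (uE _ x0).
apply: (@step_ge_subsolution h (fun t => - (x1 `^ (- g) * (g * t `^ (g - 1))))) => //.
- move=> t /andP[t0 _].
  have := is_deriveB (is_derive_cst (1 : R) t 1) (is_deriveZ (x1 `^ (- g)) (is_derive1_powR g t0)).
  by rewrite sub0r.
- move=> t /andP[t0 tx].
  have tx1 := le_trans tx xx1.
  have v0 : 0 < t / x1 by rewrite divr_gt0.
  have v1 : t / x1 <= 1 by rewrite ler_pdivrMr ?mul1r.
  have dQ := fragment_tail_lower aP t0.
  have h1 : h t <= 1 by rewrite lerBlDr lerDl mulr_ge0 ?powR_ge0.
  have [/andP[_ Ale] /andP[_ Ble] _] := gain_bounds aP.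
  rewrite -(ler_pM2l t0) [leRHS]mulrA [t * d t]mul_rate//.
  have -> : t * - (x1 `^ (- g) * (g * t `^ (g - 1))) = - (g * u t).
    by rewrite uE// -(mulr_powRB1 (ltW t0) g0); ring.
  have uS : u t = (t / x1) `^ l1 * (t / x1) `^ (1 - k0).
    by rewrite -powRD ?(gt_eqF v0) ?implybT// addrC.
  set w := (t / x1) `^ (1 - k0) in dQ uS.
  have w0 : 0 <= w by exact: powR_ge0.
  have tl l : 0 <= l -> t `^ l = (t / x1) `^ l * x1 `^ l.
    by move=> l0; rewrite -powRM ?(ltW v0) ?(ltW x1_gt0)// divfK// gt_eqF.
  have adle : gainA P * t `^ l1 + gainB P * t `^ l2 <=
      (t / x1) `^ l1 * (Amax * x1 `^ l1 + Bmax * x1 `^ l2).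
    rewrite mulrDr; apply: lerD.
      by rewrite (tl _ (ltW l1_gt0)) [leRHS]mulrCA ler_wpM2r// mulr_ge0 ?powR_ge0.
    rewrite (tl _ (ltW l2_gt0)) [leRHS]mulrCA.
    apply: ler_pM => //; first by rewrite mulr_ge0 ?powR_ge0.
    rewrite ler_wpM2r ?powR_ge0//; apply: ger_powR => //.
    by rewrite v0.
  set ad := gainA P * _ + _ in adle *.
  have ad0 : 0 <= ad by apply: addr_ge0; (apply: mulr_ge0; last exact: powR_ge0); [exact: A0|exact: B0].
  have C00 := C0_gt0.
  have : ad * (1 - Q t) <= g * u t.
    apply: (@le_trans _ _ (ad * (C0 * w))); first by rewrite ler_wpM2l.
    apply: (@le_trans _ _ ((t / x1) `^ l1 * (Amax * x1 `^ l1 + Bmax * x1 `^ l2) * (C0 * w))).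
      by rewrite ler_wpM2r// mulr_ge0// ltW.
    rewrite uS [leRHS]mulrCA -mulrA ler_wpM2l ?powR_ge0//.
    by rewrite mulrA ler_wpM2r.
  have : ad * (h t - Q t) <= ad * (1 - Q t) by rewrite ler_wpM2l// lerB.
  by rewrite -[Q t - h t]opprB mulrN lerN2; exact: le_trans.
- by move=> t _; rewrite lerBlDr lerDl mulr_ge0 ?powR_ge0.
Qed.

(** Multiplied by [t], the requirement on the barrier [k] is
    [l1 (t / s)^l1 <= t d(t) (1 - Q / k)], where [Q / k <= kap < 1] and
    [t d(t) >= Amin t^l1]. *)
Lemma step_upper x : 0 < x -> step P x <= expR (1 - (x / s) `^ l1).
Proof.
move=> x0.
(* Up to [s] the barrier is at least 1. *)
have [xs|/ltW sx] := leP x s.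
  apply: (le_trans (step_le1 x0)); rewrite -[leLHS]expR0 ler_expR subr_ge0.
  rewrite -[leRHS](one_powR l1); apply: ge0_ler_powR; rewrite ?nnegrE ?(ltW l1_gt0)//.
    by rewrite divr_ge0 ?ltW.
  by rewrite ler_pdivrMr ?mul1r.
pose h t := expR (1 - (t / s) `^ l1).
pose k t := expR (1 - s `^ (- l1) * t `^ l1).
have hE t : 0 < t -> h t = k t.
  move=> t0; rewrite /h powRM ?invr_ge0 ?(ltW s_gt0) ?(ltW t0)// mulrC.
  by rewrite -(powR_inv1 (ltW s_gt0)) -powRrM mulN1r.
rewrite -/(h x) hE//.
apply: (@step_le_supersolution k (fun t => k t * - (s `^ (- l1) * (l1 * t `^ (l1 - 1)))) s x) => //.
- move=> t /andP[st _]; have t0 := lt_le_trans s_gt0 st.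
  have H := is_deriveB (is_derive_cst (1 : R) t 1) (is_deriveZ (s `^ (- l1)) (is_derive1_powR l1 t0)).
  rewrite sub0r in H.
  exact: (is_derive1_comp (is_derive_expR _) H).
- move=> t /andP[st _]; have t0 := lt_le_trans s_gt0 st.
  have kt0 : 0 < k t by exact: expR_gt0.
  have Qle := fragment_tail_exp_decay aP st; rewrite -/(h t) hE// in Qle.
  have [/andP[Age _] /andP[Bge _] _] := gain_bounds aP.
  rewrite -(ler_pM2l t0) [leLHS]mulrA [t * d t]mul_rate//.
  have -> : t * (k t * - (s `^ (- l1) * (l1 * t `^ (l1 - 1)))) =
      - (k t * (l1 * (t / s) `^ l1)).
    have -> : (t / s) `^ l1 = s `^ (- l1) * t `^ l1.
      rewrite powRM ?invr_ge0 ?(ltW s_gt0) ?(ltW t0)// mulrC.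
      by rewrite -(powR_inv1 (ltW s_gt0)) -powRrM mulN1r.
    by rewrite -(mulr_powRB1 (ltW t0) l1_gt0); ring.
  have ts : t `^ l1 = (t / s) `^ l1 * s `^ l1.
    by rewrite -powRM ?divr_ge0 ?(ltW s_gt0) ?(ltW t0)// divfK// gt_eqF.
  set ad := gainA P * _ + _.
  have adge : Amin * s `^ l1 * (t / s) `^ l1 <= ad.
    rewrite /ad; apply: (@le_trans _ _ (gainA P * t `^ l1)).
      by rewrite ts mulrAC -mulrA ler_wpM2r// mulr_ge0 ?powR_ge0.
    by rewrite lerDl mulr_ge0 ?powR_ge0// ltW.
  have ad0 : 0 <= ad by apply: addr_ge0; (apply: mulr_ge0; last exact: powR_ge0); [exact: A0|exact: B0].
  have kap1 := mean_powR_l1_lt1.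
  have : l1 * (t / s) `^ l1 <= ad * (1 - kap).
    apply: (@le_trans _ _ (Amin * (1 - kap) * s `^ l1 * (t / s) `^ l1)).
      by rewrite ler_wpM2r// powR_ge0.
    rewrite (_ : _ * (t / s) `^ l1 = Amin * s `^ l1 * (t / s) `^ l1 * (1 - kap)); last by ring.
    by rewrite ler_wpM2r// subr_ge0 ltW.
  move=> /(ler_wpM2l (ltW kt0)) h1.
  have : ad * (Q t - k t) <= ad * (kap * k t - k t) by rewrite ler_wpM2l// lerD2r.
  move/le_trans; apply; rewrite lerNr; apply: (le_trans h1).
  by rewrite le_eqVlt; apply/orP; left; apply/eqP; ring.
- rewrite -(hE _ s_gt0) /h divff ?gt_eqF// one_powR subrr expR0.
  exact: step_le1.
Qed.

Lemma step_admissible : admissible (step P).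
Proof.
split; [split|exact: step_lower|exact: step_upper].
  move=> x x0; rewrite step_le1// andbT; apply: le_trans (step_geQ x0).
  by case/andP: (Q01 x0).
move=> x y x0 xy; split; first exact: (@duhamel_nincr R d Lam Q).
apply: (@duhamel_log_lipschitz R d Lam Q) => // t t0.
have [/andP[_ Ale] /andP[_ Ble] _] := gain_bounds aP.
rewrite mul_rate//; apply: le_trans (C_large t0).
have yQ : 0 <= duhamel d Lam Q t - Q t by rewrite subr_ge0; exact: step_geQ.
apply: ler_pM => //.
- by rewrite addr_ge0// mulr_ge0 ?powR_ge0.
- by apply: lerD; rewrite ler_wpM2r ?powR_ge0.
- apply: le_trans (step_upper t0); rewrite lerBlDr lerDl.
  by case/andP: (Q01 t0).
Qed.

End step_properties.

(** A larger tail has a larger source and, by [tail_moment_anti], a smaller rate;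
    since the solution stays above the source, both effects raise it.  So
    [step P1] is a subsolution of the equation that defines [step P2]. *)
Lemma step_mono P1 P2 : admissible P1 -> admissible P2 ->
  (forall x, 0 < x -> P1 x <= P2 x) -> forall x, 0 < x -> step P1 x <= step P2 x.
Proof.
move=> aP1 aP2 P12 x x0.
have [PC1 Plo1 _] := aP1; have [PC2 Plo2 _] := aP2.
have hA : gainA P2 <= gainA P1.
  by rewrite /gainA ler_pM2l//; exact: (@tail_moment_anti _ _ g x1 _ _ _ C C).
have hB : gainB P2 <= gainB P1.
  by rewrite /gainB ler_pM2l//; exact: (@tail_moment_anti _ _ g x1 _ _ _ C C).
have [_ /andP[/ltW B20 _] /ltW A20] := gain_bounds aP2.
pose dy t := rate l1 l2 (gainA P1) (gainB P1) t * (fragment_tail nu P1 t - step P1 t).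
apply: (@step_ge_subsolution _ aP2 (step P1) dy x x0) => [t /andP[t0 _]|t /andP[t0 _]|t /andP[t0 _]].
- exact: step_derive aP1 _ t0.
- have yQ := step_geQ aP1 t0.
  have QQ := fragment_tail_mono nuI PC1 PC2 t0 P12.
  have dd := rate_le l1 l2 t hA hB.
  have d0 := rate_ge0 l1 l2 t A20 B20.
  apply: (@le_trans _ _ (rate l1 l2 (gainA P2) (gainB P2) t * (fragment_tail nu P1 t - step P1 t))).
    by rewrite ler_wnM2r// subr_le0.
  by rewrite ler_wpM2l// lerD2r.
- exact: step_le1.
Qed.

(* The lower barrier, truncated at 0, shows that [subsols] is nonempty. *)
Let lower x := Num.max 0 (1 - (x / x1) `^ g).

Let lower_admissible : admissible lower.
Proof.
have g0 : 0 < g by move: g1 l1_le1; lra.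
have u0 x : 0 < x -> 0 < (x / x1) `^ g by move=> x0; rewrite powR_gt0 ?divr_gt0.
split; first split.
- move=> x x0; rewrite /lower le_max lexx/= ge_max ler01/=.
  by rewrite lerBlDr lerDl ltW// u0.
- move=> x y x0 xy; have y0 := lt_le_trans x0 xy.
  have xyg : (x / x1) `^ g <= (y / x1) `^ g.
    apply: ge0_ler_powR; rewrite ?nnegrE ?(ltW g0)//; try by rewrite divr_ge0 ?ltW.
    by rewrite ler_pM2r ?invr_gt0.
  split; first by rewrite /lower ge_max !le_max lexx/= lerB ?orbT.
  apply: (@le_trans _ _ (g * (ln y - ln x))); last first.
    by rewrite ler_wpM2r ?subr_ge0 ?ler_ln.
  (* In terms of [u] and [v], it is the concavity bound [ln t <= t - 1]. *)
  have -> : g * (ln y - ln x) = ln ((y / x1) `^ g) - ln ((x / x1) `^ g).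
    by rewrite !ln_powR !ln_div ?posrE//; ring.
  move: xyg (u0 _ x0) (u0 _ y0); rewrite /lower.
  set u := (x / x1) `^ g; set v := (y / x1) `^ g => uv ug vg.
  have lnle (t : R) : 0 < t -> ln t <= t - 1.
    move=> t0; have := @le_ln1Dx R (t - 1).
    have -> : 1 + (t - 1) = t by ring.
    by apply; lra.
  have lnuv : ln u <= ln v by rewrite ler_ln.
  have [u1|u1] := leP 1 u.
    have -> : Num.max 0 (1 - u) = 0 by apply/max_idPl; lra.
    apply: (@le_trans _ _ 0); last by lra.
    by rewrite sub0r oppr_le0 le_max lexx.
  have -> : Num.max 0 (1 - u) = 1 - u by apply/max_idPr; lra.
  have [v1|v1] := leP 1 v.
    have -> : Num.max 0 (1 - v) = 0 by apply/max_idPl; lra.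
    by have := lnle _ ug; have := ln_ge0 v1; lra.
  have -> : Num.max 0 (1 - v) = 1 - v by apply/max_idPr; lra.
  have := lnle _ (divr_gt0 ug vg); rewrite ln_div ?posrE// => h.
  have : v * (1 - u / v) <= 1 - u / v.
    by rewrite ler_piMl ?(ltW v1)// subr_ge0 ler_pdivrMr// mul1r.
  have -> : v * (1 - u / v) = v - u by field; rewrite gt_eqF.
  by lra.
- move=> x x0; rewrite lerBlDr -lerBlDl /lower le_max; apply/orP; right.
  by rewrite lexx.
- move=> x x0; rewrite /lower ge_max expR_ge0/=.
  have [xs|sx] := leP x s.
    apply: (@le_trans _ _ 1); first by rewrite lerBlDr lerDl ltW// u0.
    rewrite -[leLHS]expR0 ler_expR subr_ge0.
    rewrite -[leRHS](one_powR l1); apply: ge0_ler_powR; rewrite ?nnegrE ?(ltW l1_gt0)//.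
      by rewrite divr_ge0 ?ltW.
    by rewrite ler_pdivrMr ?mul1r.
  apply: (@le_trans _ _ 0); last exact: expR_ge0.
  rewrite subr_le0 -[leLHS](one_powR g); apply: ge0_ler_powR; rewrite ?nnegrE ?(ltW g0)//.
    by rewrite divr_ge0 ?ltW.
  by rewrite ler_pdivlMr ?mul1r// (le_trans x1_s)// ltW.
Qed.

Let subsols : set (R -> R) :=
  [set f | admissible f /\ forall x, 0 < x -> f x <= step f x].

Let lower_sub : subsols lower.
Proof.
split; first exact: lower_admissible.
move=> x x0; have [SC Slo _] := step_admissible lower_admissible.
rewrite /lower ge_max; apply/andP; split; first by have /andP[] := SC.1 _ x0.
by have := Slo _ x0; rewrite lerBlDr -lerBlDl.
Qed.

(* The Knaster-Tarski fixed point. *)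
Let P0 x := sup [set f x | f in subsols].

Let P0_ub f x : subsols f -> 0 < x -> f x <= P0 x.
Proof.
move=> sf x0; apply: ub_le_sup; last by exists f.
by exists 1 => _ [h [[hC _ _] _] <-]; have /andP[] := hC.1 _ x0.
Qed.

Let P0_lub M x : (forall f, subsols f -> f x <= M) -> P0 x <= M.
Proof.
move=> H; apply: ge_sup; first by exists (lower x); exists lower.
by move=> _ [f sf <-]; exact: H.
Qed.

Let P0_admissible : admissible P0.
Proof.
have [lC llo _] := lower_admissible.
split; first split.
- move=> x x0; apply/andP; split.
    by apply: le_trans (P0_ub lower_sub x0); have /andP[] := lC.1 _ x0.
  by apply: P0_lub => f [[fC _ _] _]; have /andP[] := fC.1 _ x0.
- move=> x y x0 xy; have y0 := lt_le_trans x0 xy; split.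
    apply: P0_lub => f sf; apply: le_trans (P0_ub sf x0).
    by case: sf => [[fC _ _] _]; have [] := fC.2 _ _ x0 xy.
  rewrite lerBlDr; apply: P0_lub => f sf; rewrite -lerBlDr.
  have [[fC _ _] _] := sf; have [_ h] := fC.2 _ _ x0 xy.
  by apply: le_trans h; rewrite lerB// P0_ub.
- by move=> x x0; apply: le_trans (llo _ x0); rewrite lerB// P0_ub.
- by move=> x x0; apply: P0_lub => f [[_ _ +] _]; exact.
Qed.

Let P0_le_step x : 0 < x -> P0 x <= step P0 x.
Proof.
move=> x0; apply: P0_lub => f sf; have [af fs] := sf.
apply: (le_trans (fs _ x0)); apply: step_mono => // t t0; exact: P0_ub.
Qed.

Lemma exists_fixpoint : exists P, [/\ admissible P, forall x, 0 < x -> P x = step P x,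
   0 < gainA P & 0 < gainB P].
Proof.
exists P0; have [_ /andP[b0 _] a0] := gain_bounds P0_admissible.
split => // x x0; apply/eqP; rewrite eq_le P0_le_step//=.
have sS : subsols (step P0).
  split; first exact: step_admissible P0_admissible.
  move=> t t0; apply: step_mono => //; exact: step_admissible P0_admissible.
exact: P0_ub.
Qed.

End barriers.

(** After substitution of the constants, [x1_small] reads [E x1^(l1+l2-1) <= g] and
    [s_large] reads [l1 <= D s^(l1+l2-1)]: both can be met because
    [l1 + l2 > 1]. *)
Theorem stationary_tail : exists x1 s C P,
  let A := cA * tail_moment l2 P in let B := cB * tail_moment l1 P in
  [/\ [/\ 0 < x1, 0 < s, 0 < A & 0 < B],
      admissible x1 s C P
    & forall x, 0 < x ->
        is_derive x 1 P (rate l1 l2 A B x * (fragment_tail nu P x - P x))].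
Proof.
have C00 := C0_gt0; have kap1 := mean_powR_l1_lt1.
have g1 : 0 < g + l1 - 1 by move: k0_l1 l1_gt0; lra.
have g2 : 0 < g + l2 - 1 by move: g1 l12; lra.
have g0 : 0 < g by move: g1 l12 l2_le1; lra.
pose K r : R := 1 + (g + r - 1)^-1.
have K1 : 0 < K l1 by rewrite addr_gt0 ?invr_gt0.
have K2 : 0 < K l2 by rewrite addr_gt0 ?invr_gt0.
pose al := l1 + l2 - 1; have al0 : 0 < al by move: l_gt1; rewrite /al; lra.
pose E := (cA * K l2 + cB * K l1) * C0.
have E0 : 0 < E by rewrite mulr_gt0// addr_gt0// mulr_gt0.
pose x1 := (g / E) `^ (al^-1).
have x10 : 0 < x1 by rewrite powR_gt0 ?divr_gt0.
have x1al : x1 `^ al = g / E.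
  by rewrite -powRrM mulVf ?gt_eqF// powRr1// ltW ?divr_gt0.
pose T0 := 2 `^ l1^-1 : R; have T00 : 0 < T0 by exact: powR_gt0.
pose kp := 1 - kap; have kp0 : 0 < kp by rewrite subr_gt0.
pose D := cA * (2^-1 * T0 `^ (l2 - 1)) * kp.
have D0 : 0 < D.
  by rewrite mulr_gt0// mulr_gt0// mulr_gt0 ?powR_gt0.
pose s := Num.max x1 ((l1 / D) `^ (al^-1)).
have x1s : x1 <= s by rewrite le_max lexx.
have s0 : 0 < s by exact: lt_le_trans x1s.
have sal : l1 / D <= s `^ al.
  have -> : l1 / D = ((l1 / D) `^ al^-1) `^ al.
    by rewrite -powRrM mulVf ?gt_eqF// powRr1// ltW ?divr_gt0.
  apply: ge0_ler_powR; rewrite ?nnegrE ?powR_ge0 ?(ltW al0) ?(ltW s0)//.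
  by rewrite le_max lexx orbT.
pose Am := cA * K l2 * x1 `^ (l2 - 1).
pose Bm := cB * K l1 * x1 `^ (l1 - 1).
have Am0 : 0 < Am by apply: mulr_gt0; [exact: mulr_gt0|exact: powR_gt0].
have Bm0 : 0 < Bm by apply: mulr_gt0; [exact: mulr_gt0|exact: powR_gt0].
have [CA CA0 HA] := powR_expR_bounded l1_gt0 s0 l1_gt0.
have [CB CB0 HB] := powR_expR_bounded l2_gt0 s0 l1_gt0.
pose C := g + Am * CA + Bm * CB.
have H1 : (Am * x1 `^ l1 + Bm * x1 `^ l2) * C0 <= g.
  have -> : Am * x1 `^ l1 + Bm * x1 `^ l2 = (cA * K l2 + cB * K l1) * x1 `^ al.
    rewrite /Am /Bm -![_ * x1 `^ _ * _]mulrA -!powRD ?(gt_eqF x10) ?implybT//.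
    have -> : l2 - 1 + l1 = al by rewrite /al; ring.
    have -> : l1 - 1 + l2 = al by rewrite /al; ring.
    by rewrite mulrDl.
  rewrite x1al mulrAC -/E mulrCA divff ?gt_eqF// mulr1//.
have H2 : l1 <= cA * (2^-1 * (s * T0) `^ (l2 - 1)) * kp * s `^ l1.
  have -> : cA * (2^-1 * (s * T0) `^ (l2 - 1)) * kp * s `^ l1 = D * s `^ al.
    have -> : al = (l2 - 1) + l1 by rewrite /al; ring.
    rewrite powRM ?(ltW s0) ?(ltW T00)// [in RHS]powRD ?(gt_eqF s0) ?implybT// /D; ring.
  by rewrite -ler_pdivrMl// mulrC.
have H4 x : 0 < x -> (Am * x `^ l1 + Bm * x `^ l2) * expR (1 - (x / s) `^ l1) <= C.
  move=> x0; have := HA _ x0; have := HB _ x0.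
  move=> /(ler_wpM2l (ltW Bm0)) hB /(ler_wpM2l (ltW Am0)) hA.
  rewrite mulrDl -[_ * _ * expR _]mulrA -[X in _ + X]mulrA /C -addrA.
  by apply: (le_trans (lerD hA hB)); rewrite lerDr ltW.
have H5 : g <= C.
  by rewrite /C -[leRHS]addrA lerDl addr_ge0// mulr_ge0// ltW.
have [P [aP PE A0 B0]] := exists_fixpoint x10 x1s H1 H2 H4 H5.
exists x1, s, C, P; split => // x x0.
have := step_derive x10 x1s aP x0.
rewrite -(PE _ x0); apply: near_eq_is_derive.
near=> t; apply/esym/PE; near: t; exact: lt_nbhsr.
Unshelve. all: by end_near. Qed.

End fixpoint.

(** * The flux identity *)

Section tonelli_on.
Local Open Scope ereal_scope.
Context d1 d2 (T1 : measurableType d1) (T2 : measurableType d2) (R : realType).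
Variables (m1 : {sigma_finite_measure set T1 -> \bar R})
          (m2 : {sigma_finite_measure set T2 -> \bar R}).

Lemma tonelli_on (D1 : set T1) (D2 : set T2) (f : T1 * T2 -> \bar R) :
  measurable D1 -> measurable D2 -> measurable_fun (D1 `*` D2) f ->
  (forall x y, D1 x -> D2 y -> 0 <= f (x, y)) ->
  \int[m1]_(x in D1) \int[m2]_(y in D2) f (x, y) =
  \int[m2]_(y in D2) \int[m1]_(x in D1) f (x, y).
Proof.
move=> mD1 mD2 mf f0; pose h := f \_ (D1 `*` D2).
have mD : measurable (D1 `*` D2) by exact: measurableX.
have mh : measurable_fun setT h by apply/(measurable_restrictT f).
have h0 z : 0 <= h z.
  by apply: erestrict_ge0 => -[x y] /= [D1x D2y]; exact: f0.
transitivity (\int[m1]_x \int[m2]_y h (x, y)).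
  rewrite integral_mkcond; apply: eq_integral => x _.
  rewrite patchE; case: ifPn => [/set_mem D1x|D1x].
    rewrite integral_mkcond; apply: eq_integral => y _.
    rewrite /h !patchE; congr (if _ then _ else _).
    by apply/idP/idP => [/set_mem D2y|/set_mem[_ D2y]]; rewrite inE.
  rewrite integral0_eq// => y _; rewrite /h patchE ifF//.
  by apply/negP => /set_mem[/mem_set D1x' _]; rewrite D1x' in D1x.
rewrite fubini_tonelli//; apply/esym.
rewrite integral_mkcond; apply: eq_integral => y _.
rewrite patchE; case: ifPn => [/set_mem D2y|D2y].
  rewrite integral_mkcond; apply: eq_integral => x _.
  rewrite /h !patchE; congr (if _ then _ else _).
  by apply/idP/idP => [/set_mem D1x|/set_mem[D1x _]]; rewrite inE.
rewrite integral0_eq// => x _; rewrite /h patchE ifF//.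
by apply/negP => /set_mem[_ /mem_set D2y']; rewrite D2y' in D2y.
Qed.

Lemma measurable_fst_on (D1 : set T1) (D2 : set T2) (f : T1 -> R) :
  measurable D1 -> measurable_fun D1 f ->
  measurable_fun (D1 `*` D2) (fun z => f z.1).
Proof.
move=> mD1 mf; apply: (measurable_comp mD1 _ mf).
- by move=> _ [[x y] [/= ? _] <-].
- exact: measurable_funTS measurable_fst.
Qed.

Lemma measurable_snd_on (D1 : set T1) (D2 : set T2) (f : T2 -> R) :
  measurable D2 -> measurable_fun D2 f ->
  measurable_fun (D1 `*` D2) (fun z => f z.2).
Proof.
move=> mD2 mf; apply: (measurable_comp mD2 _ mf).
- by move=> _ [[x y] [/= _ ?] <-].
- exact: measurable_funTS measurable_snd.
Qed.

End tonelli_on.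

(** Turns an inner integral over an interval that depends on the outer variable into
    one over a fixed domain, as Tonelli's theorem requires. *)
Lemma integral_Rpos_sub {R : realType} (f : R -> \bar R) (i : interval R) :
  [set` i] `<=` `]0, +oo[%classic ->
  (\int[@lebesgue_measure R]_(x in [set` i]) f x =
   \int[@lebesgue_measure R]_(x in `]0%R, +oo[) (if x \in i then f x else 0))%E.
Proof.
move=> iR.
have E : [set` i] = (`]0, +oo[%classic : set R) `&` [set` i].
  by apply/seteqP; split => [x xi|x []//]; split => //; exact: iR.
rewrite {1}E integral_mkcondr; apply: eq_integral => x _.
by rewrite patchE mem_setE.
Qed.

Section flux.
Context {R : realType}.
Local Notation mu := (@lebesgue_measure R).
Local Notation Rpos := (`]0, +oo[%classic : set R).
Local Notation I := (`]0, 1[%classic : set R).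
Implicit Types (x y z t : R).
Variable nu : {finite_measure set (measurableTypeR R) -> \bar R}.
Hypothesis nuI : nu I = 1%E.
Variables (P d : R -> R) (C : R).
Hypothesis PC : tail_fun C P.
Hypothesis d_ge0 : forall x, 0 < x -> 0 <= d x.
Hypothesis d_cont : forall x, 0 < x -> {for x, continuous d}.
Local Notation Q := (fragment_tail nu P).
Hypothesis P_derive : forall x, 0 < x -> is_derive x 1 P (d x * (Q x - P x)).

(** The probability that the fragment falls below [x] while its parent is above:
    [P (Y Z <= x < Y)]. *)
Definition deficit x := P x - fragment_tail nu P x.
Local Notation m := deficit.
(** The density of [Y]: the equation for [P] reads [P' = - jump_density]. *)
Definition jump_density x := d x * m x.
Local Notation psi := jump_density.

Lemma deficit_ge0 x : 0 < x -> 0 <= m x.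
Proof. by move=> x0; rewrite subr_ge0 (fragment_tail_le nuI PC x0). Qed.

Lemma deficit_continuous x : 0 < x -> {for x, continuous m}.
Proof.
move=> x0; apply: cvgB; first exact: tail_fun_continuous PC x0.
exact: tail_fun_continuous (fragment_tail_tail_fun nuI PC) x0.
Qed.

Lemma jump_density_ge0 x : 0 < x -> 0 <= psi x.
Proof. by move=> x0; rewrite mulr_ge0 ?d_ge0 ?deficit_ge0. Qed.

Lemma jump_density_continuous x : 0 < x -> {for x, continuous psi}.
Proof. by move=> x0; apply: cvgM; [exact: d_cont|exact: deficit_continuous]. Qed.

Lemma deficit_measurable : measurable_fun Rpos m.
Proof. by apply: continuous_gt0_measurable; exact: deficit_continuous. Qed.

Lemma jump_density_measurable : measurable_fun Rpos psi.
Proof. by apply: continuous_gt0_measurable; exact: jump_density_continuous. Qed.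

Lemma jump_density_derive x : 0 < x -> is_derive x 1 (fun t => - P t) (psi x).
Proof.
move=> x0; have := is_deriveN (P_derive x0).
by rewrite /jump_density /deficit -mulrN opprB.
Qed.

Lemma integral_jump_density a b : 0 < a -> a <= b ->
  (\int[mu]_(y in `[a, b]) (psi y)%:E = (P a - P b)%:E)%E.
Proof.
move=> a0 ab; have -> : P a - P b = - P b - - P a by rewrite opprK addrC.
apply: (@FTC_segment _ psi (fun t => - P t)) => //.
- by move=> x x0; exact: jump_density_continuous.
- by move=> x x0; exact: jump_density_derive.
Qed.

Lemma integral_nu_scaled_diff x (c : R) : 0 < x ->
  (\int[nu]_(z in I) (c * (P x - P (x / z)))%:E = (c * m x)%:E)%E.
Proof.
move=> x0.
have i1 := nu_cst_integrable nuI (P x).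
have i2 := tail_fun_scaled_integrable nuI PC x0.
have i3 : nu.-integrable I (EFin \o (fun z => P x - P (x / z))) by exact: (integrableB _ i1 i2).
rewrite -(_ : \int[nu]_(z in I) (c * (P x - P (x / z))) = c * m x).
  rewrite /Rintegral fineK//; apply: integrable_fin_num => //.
  by apply: (@integrableZl _ _ _ _ _ _ c _ i3).
rewrite RintegralZl//.
by rewrite RintegralB// nu_cst.
Qed.

(** Every event that takes a mass [y] to [z y] crosses exactly the levels of
    [[z y, y]], so weighting the levels by [phi] gives the same as weighting the
    events by the integral of [phi] over that segment.  Formally, the density
    [psi] is integrated over [[x, x / z]] to recover [P x - P (x / z)], and the
    order of integration is exchanged. *)
Lemma flux_identity (phi : R -> R) (Phi : R -> R -> R) :
  measurable_fun Rpos phi -> (forall x, 0 < x -> 0 <= phi x) ->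
  measurable_fun (I `*` Rpos : set (measurableTypeR R * measurableTypeR R)) (fun zy => Phi zy.1 zy.2) ->
  (forall z y : R, 0 < z < 1 -> 0 < y ->
    (\int[mu]_(x in `[(z * y)%R, y]) (phi x)%:E = (Phi z y)%:E)%E) ->
  (\int[mu]_(x in Rpos) (phi x * m x)%:E =
   \int[mu]_(y in Rpos) ((psi y)%:E * \int[nu]_(z in I) (Phi z y)%:E))%E.
Proof.
move=> mphi phi0 mPhi PhiE.
have mI : measurable (I : set (measurableTypeR R)) by exact: measurable_itv.
have mRp : measurable (Rpos : set (measurableTypeR R)) by exact: measurable_itv.
have mP := tail_fun_measurable PC.
have Phi0 z y : 0 < z < 1 -> 0 < y -> 0 <= Phi z y.
  move=> z01 y0; rewrite -lee_fin -PhiE//; apply: integral_ge0 => x /=.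
  rewrite in_itv/= lee_fin => /andP[zyx _]; apply: phi0; apply: lt_le_trans zyx.
  by case/andP: z01 => z0 _; exact: mulr_gt0.
transitivity (\int[mu]_(x in Rpos) \int[nu]_(z in I) (phi x * (P x - P (x / z)))%:E)%E.
  apply: eq_integral => x; rewrite inE/= in_itv/= andbT => x0.
  by rewrite integral_nu_scaled_diff.
rewrite (@tonelli_on _ _ _ _ _ mu nu _ _ (fun xz => (phi xz.1 * (P xz.1 - P (xz.1 / xz.2)))%:E)%E)//=; last 2 first.
- apply/measurable_EFinP; apply: measurable_funM; first exact: measurable_fst_on.
  apply: measurable_funB; first exact: measurable_fst_on.
  apply: (measurable_comp mRp _ mP).
    by move=> _ [[x z] [/= + +] <-]; rewrite /= !in_itv/= !andbT => x0 /andP[z0 _]; rewrite divr_gt0.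
  apply: measurable_funM; first exact: measurable_funTS measurable_fst.
  by apply: measurable_snd_on => //; exact: measurable_inv_itv01.
- move=> x z; rewrite /= !in_itv/= !andbT => x0 z01; rewrite lee_fin.
  rewrite mulr_ge0 ?phi0// subr_ge0.
  by have [] := PC.2 _ _ x0 (le_scaled x0 z01).
transitivity (\int[nu]_(z in I) \int[mu]_(y in Rpos) (psi y * Phi z y)%:E)%E; last first.
  rewrite (@tonelli_on _ _ _ _ _ nu mu _ _ (fun zy => (psi zy.2 * Phi zy.1 zy.2)%:E)%E)//=.
  + apply: eq_integral => y; rewrite inE/= in_itv/= andbT => y0.
    under eq_integral do rewrite EFinM.
    rewrite ge0_integralZl//.
    * apply/measurable_EFinP.
      rewrite -/(comp (fun zy => Phi zy.1 zy.2) (fun z => (z, y))).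
      apply: (measurable_comp (measurableX mI mRp) _ mPhi).
        by move=> _ [z Iz <-]; split => //=; rewrite in_itv/= y0.
      exact: measurable_funTS (measurable_pair2 _).
    * by move=> z /=; rewrite in_itv/= lee_fin => z01; exact: Phi0.
    * by rewrite lee_fin jump_density_ge0.
  + apply/measurable_EFinP; apply: measurable_funM => //.
    apply: measurable_snd_on; [exact: mRp|exact: jump_density_measurable].
  + move=> z y; rewrite /= !in_itv/= !andbT => z01 y0; rewrite lee_fin.
    by rewrite mulr_ge0 ?jump_density_ge0// Phi0.
apply: eq_integral => z; rewrite inE/= in_itv/= => z01; case/andP: (z01) => z0 z1.
pose F (xy : R * R) := if (xy.1 <= xy.2) && (z * xy.2 <= xy.1) then (phi xy.1 * psi xy.2)%:E else 0%E.
transitivity (\int[mu]_(x in Rpos) \int[mu]_(y in Rpos) F (x, y))%E.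
  apply: eq_integral => x; rewrite inE/= in_itv/= andbT => x0.
  rewrite EFinM -integral_jump_density ?le_scaled//.
  rewrite -ge0_integralZl//; last 3 first.
  + apply/measurable_EFinP; apply: measurable_funS jump_density_measurable => //.
    by move=> t /=; rewrite !in_itv/= andbT => /andP[xt _]; exact: lt_le_trans xt.
  + move=> t /=; rewrite in_itv/= lee_fin => /andP[xt _]; apply: jump_density_ge0.
    exact: lt_le_trans xt.
  + by rewrite lee_fin phi0.
  rewrite [LHS]integral_Rpos_sub; last first.
    by move=> t /=; rewrite !in_itv/= andbT => /andP[xt _]; exact: lt_le_trans xt.
  apply: eq_integral => y _.
  by rewrite in_itv/= /F /= ler_pdivlMr// [y * z]mulrC.
rewrite (@tonelli_on _ _ _ _ _ mu mu _ _ F)//=; last 2 first.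
- apply: measurable_fun_if; first exact: measurableX.
  + apply: measurable_funTS; apply: measurable_and.
      by apply: measurable_fun_ler; [exact: measurable_fst|exact: measurable_snd].
    apply: measurable_fun_ler; last exact: measurable_fst.
    by apply: measurable_funM => //; exact: measurable_snd.
  + apply/measurable_EFinP; apply: measurable_funS (measurableX mRp mRp) _ _.
      exact: subIsetl.
    apply: measurable_funM.
      apply: measurable_fst_on; [exact: mRp|exact: mphi].
    apply: measurable_snd_on; [exact: mRp|exact: jump_density_measurable].
  + exact: measurable_cst.
- move=> x y; rewrite /= !in_itv/= !andbT /F /= => x0 y0; case: ifP => // _.
  by rewrite lee_fin mulr_ge0 ?phi0 ?jump_density_ge0.
apply: eq_integral => y; rewrite inE/= in_itv/= andbT => y0.
have zy0 : 0 < z * y by exact: mulr_gt0.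
rewrite EFinM -PhiE// -ge0_integralZl//; last 3 first.
- apply/measurable_EFinP; apply: measurable_funS mphi => //.
  by move=> t /=; rewrite !in_itv/= andbT => /andP[xt _]; exact: lt_le_trans xt.
- move=> t /=; rewrite in_itv/= lee_fin => /andP[xt _]; apply: phi0.
  exact: lt_le_trans xt.
- by rewrite lee_fin jump_density_ge0.
rewrite [RHS]integral_Rpos_sub; last first.
  by move=> t /=; rewrite !in_itv/= andbT => /andP[xt _]; exact: lt_le_trans xt.
apply: eq_integral => x _.
by rewrite in_itv/= /F /= andbC EFinM muleC.
Qed.

End flux.

(** * Moments of the fragment measure *)

Section fragment_moments.
Context {R : realType}.
Local Notation mu := (@lebesgue_measure R).
Local Notation Rpos := (`]0, +oo[%classic : set R).
Local Notation I := (`]0, 1[%classic : set R).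
Implicit Types (r x y z : R).

(** The integral of [t^(r-2)] over [[z, 1]]. *)
Definition powint r z := if r == 1 then - ln z else (1 - z `^ (r - 1)) / (r - 1).

Lemma integral_powR_scaled r z y : 0 < z < 1 -> 0 < y ->
  (\int[mu]_(x in `[(z * y)%R, y]) (x `^ (r - 2))%:E = (y `^ (r - 1) * powint r z)%:E)%E.
Proof.
move=> /andP[z0 z1] y0; have zy0 : 0 < z * y by exact: mulr_gt0.
have zyy : z * y <= y by rewrite ler_piMl ?ltW.
have cpow x : 0 < x -> {for x, continuous (fun x => x `^ (r - 2))}.
  by move=> x0; exact: powR_continuous.
rewrite /powint; case: eqP => [r1|/eqP r1].
  have -> : y `^ (r - 1) * - ln z = ln y - ln (z * y).
    by rewrite r1 subrr powRr0 mul1r lnM// opprD addrCA subrr addr0.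
  apply: FTC_segment => // x x0; have := is_derive1_ln x0.
  by rewrite -[x^-1](powR_inv1 (ltW x0)) (_ : -1 = r - 2)// r1; ring.
have r10 : r - 1 != 0 by rewrite subr_eq0.
have -> : y `^ (r - 1) * ((1 - z `^ (r - 1)) / (r - 1)) =
   (r - 1)^-1 * y `^ (r - 1) - (r - 1)^-1 * (z * y) `^ (r - 1).
  by rewrite powRM ?ltW//; ring.
apply: (@FTC_segment _ _ (fun x => (r - 1)^-1 * x `^ (r - 1))) => // x x0.
have := is_deriveZ (r - 1)^-1 (is_derive1_powR (r - 1) x0).
by rewrite /GRing.scale/= mulrA mulVf// mul1r (_ : r - 1 - 1 = r - 2)//; ring.
Qed.

Lemma integral_powint r z : 0 < z < 1 ->
  (\int[mu]_(x in `[z, 1%R]) (x `^ (r - 2))%:E = (powint r z)%:E)%E.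
Proof.
move=> z01; have := @integral_powR_scaled r z 1 z01 ltr01.
by rewrite mulr1 one_powR mul1r.
Qed.

Lemma powint_gt0 r z : 0 < z < 1 -> 0 < powint r z.
Proof.
move=> /andP[z0 z1]; rewrite /powint; case: eqP => [_|/eqP r1].
  by rewrite oppr_gt0 ln_lt0// z0.
have H p : 0 < p -> z `^ p < 1.
  by move=> p0; rewrite -[ltRHS](one_powR p); apply: gt0_ltr_powR; rewrite ?nnegrE// ltW.
have [r_lt|r_gt] := ltP r 1.
  have := H (1 - r); rewrite subr_gt0 => /(_ r_lt) zr.
  rewrite nmulr_lgt0 ?invr_lt0 ?subr_lt0//.
  by rewrite ?subr_lt0 -[r - 1]opprB powRN -[ltLHS]invr1 ltf_pV2 ?posrE ?powR_gt0.
have r_gt' : 1 < r by rewrite lt_neqAle eq_sym r1.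
by rewrite divr_gt0 ?subr_gt0// H// subr_gt0.
Qed.

Lemma measurable_powint r : measurable_fun I (powint r).
Proof.
rewrite /powint; case: eqP => _.
  by apply: measurableT_comp => //; exact: measurable_funTS (@measurable_ln R).
apply: measurable_funM => //; apply: measurable_funB => //.
exact: measurable_funTS (measurable_powR _).
Qed.

Lemma powint_anti r r' z : r <= r' -> 0 < z < 1 -> powint r' z <= powint r z.
Proof.
move=> rr' z01; have /andP[z0 z1] := z01; rewrite -lee_fin -!integral_powint//.
have mp p : measurable_fun (`[z, 1] : set R) (fun x : R => (x `^ p)%:E).
  by apply/measurable_EFinP; exact: measurable_funTS (measurable_powR _).
apply: ge0_le_integral => //.
- by move=> x _; rewrite lee_fin powR_ge0.
- exact: mp.
- exact: mp.
- move=> x /=; rewrite in_itv/= lee_fin => /andP[zx x1].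
  by apply: ger_powR; [rewrite x1 (lt_le_trans z0)|rewrite lerD2r].
Qed.

Lemma powint_le r z : r < 1 -> 0 < z < 1 -> powint r z <= z `^ (r - 1) / (1 - r).
Proof.
move=> r1 _; rewrite /powint lt_eqF//.
have -> : (1 - z `^ (r - 1)) / (r - 1) = (z `^ (r - 1) - 1) / (1 - r).
  by rewrite -[1 - r]opprB invrN mulrN -mulNr opprB.
by rewrite ler_pM2r ?invr_gt0 ?subr_gt0//; lra.
Qed.

Section nu_moments.
Variable nu : {finite_measure set (measurableTypeR R) -> \bar R}.
Hypothesis nuI : nu I = 1%E.
Variable k0 : R.
Hypothesis k0_lt1 : k0 < 1.
Hypothesis nu_k0 : nu.-integrable I (EFin \o (fun z => z `^ (k0 - 1))).

Definition mean_powint r := \int[nu]_(z in I) powint r z.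

Lemma powint_integrable r : k0 <= r -> nu.-integrable I (EFin \o powint r).
Proof.
move=> k0r.
have mI : measurable (I : set (measurableTypeR R)) by exact: measurable_itv.
apply: (le_integrable mI _ _ (integrableZl mI (1 - k0)^-1 nu_k0)).
  by apply/measurable_EFinP; exact: measurable_powint.
move=> z /=; rewrite in_itv/= => z01.
rewrite lee_fin !ger0_norm ?(ltW (powint_gt0 _ _))//; last first.
  by rewrite mulr_ge0 ?powR_ge0// invr_ge0 subr_ge0 ltW.
by rewrite mulrC; apply: le_trans (powint_le _ _) => //; exact: powint_anti.
Qed.

Lemma mean_powint_gt0 r : k0 <= r -> 0 < mean_powint r.
Proof.
move=> k0r; apply: (nu_integral_gt0 nuI) => [|z]; first exact: powint_integrable.
exact: powint_gt0.
Qed.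

End nu_moments.
End fragment_moments.

(** * Densities and dilations *)

Section change_of_variables.
Local Open Scope ereal_scope.
Context d1 d2 (T1 : measurableType d1) (T2 : measurableType d2) (R : realType).
Variables (m1 : {measure set T1 -> \bar R}) (m2 : {measure set T2 -> \bar R}).
Variables (D1 : set T1) (D2 : set T2) (phi : T2 -> T1) (h : T2 -> R).
Hypothesis h0 : forall x, D2 x -> (0 <= h x)%R.
Hypothesis chg : forall f : T1 -> \bar R, (forall x, 0 <= f x) ->
  measurable_fun D1 f ->
  \int[m1]_(x in D1) f x = \int[m2]_(x in D2) (f (phi x) * (h x)%:E).

Lemma integral_change_signed (f : T1 -> \bar R) : measurable_fun D1 f ->
  \int[m1]_(x in D1) f x = \int[m2]_(x in D2) (f (phi x) * (h x)%:E).
Proof.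
move=> mf; rewrite [LHS]integralE [RHS]integralE.
rewrite (chg (f := f^\+)) ?(chg (f := f^\-))//; last 2 first.
- exact: measurable_funeneg.
- exact: measurable_funepos.
congr (_ - _); apply: eq_integral => x /set_mem/h0 hx.
  by rewrite !funeposE maxe_pMl// mul0e.
by rewrite !funenegE -mulNe maxe_pMl// mul0e.
Qed.

Lemma integrable_change (f : T1 -> \bar R) : measurable_fun D1 f ->
  measurable_fun D2 (fun x => f (phi x) * (h x)%:E) ->
  m2.-integrable D2 (fun x => f (phi x) * (h x)%:E) <-> m1.-integrable D1 f.
Proof.
move=> mf mfh.
have E : \int[m1]_(x in D1) `|f x| = \int[m2]_(x in D2) `|f (phi x) * (h x)%:E|.
  rewrite (chg (f := fun x => `|f x|))//; last exact: measurableT_comp.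
  by apply: eq_integral => x /set_mem/h0 hx; rewrite abseM [X in (_ = _ * X)%E]gee0_abs.
by split => /integrableP[_ fin]; apply/integrableP; split => //; [rewrite E|rewrite -E].
Qed.

End change_of_variables.

Section density.
Context {R : realType}.
Local Notation mu := (@lebesgue_measure R).
Local Notation I := (`]0, 1[%classic : set R).

(** Any density of this measure in the sense of Radon-Nikodym is almost everywhere
    [h], so the change of variables for such densities applies to [h]. *)
Lemma density_measure (h : R -> R) : measurable_fun setT h ->
  (forall x, 0 <= h x) -> (\int[mu]_x (h x)%:E < +oo)%E ->
  exists nu : {finite_measure set (measurableTypeR R) -> \bar R},
    (forall A, nu A = \int[mu]_(x in A) (h x)%:E)%E /\
    forall (D : set (measurableTypeR R)) (f : R -> \bar R), measurable D ->
      (forall x, 0 <= f x)%E -> measurable_fun D f ->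
      (\int[nu]_(x in D) f x = \int[mu]_(x in D) (f x * (h x)%:E))%E.
Proof.
move=> mh h0 hfin.
pose n0 (A : set (measurableTypeR R)) : \bar R := (\int[mu]_(x in A) (h x)%:E)%E.
have n00 : n0 set0 = 0%E by rewrite /n0 integral_set0.
have n0_ge0 A : (0 <= n0 A)%E by apply: integral_ge0 => x _; rewrite lee_fin.
have n0_sigma : semi_sigma_additive n0.
  move=> /= F mF tF mUF; rewrite /n0; apply: cvg_toP.
    apply: ereal_nondecreasing_is_cvgn => m n mn.
    by apply: lee_sum_nneg_natr => // k _ _; exact: n0_ge0.
  rewrite ge0_integral_bigcup//=; first by apply/measurable_funTS/measurable_EFinP.
  by move=> x _; rewrite lee_fin.
pose nm : {measure set (measurableTypeR R) -> \bar R} :=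
  HB.pack n0 (isMeasure.Build _ _ _ n0 n00 n0_ge0 n0_sigma).
have nfin : fin_num_fun nm.
  move=> A mA; rewrite ge0_fin_numE//; apply: le_lt_trans hfin.
  apply: ge0_subset_integral => //; first exact/measurable_EFinP.
  by move=> x _; rewrite lee_fin.
pose nu : {finite_measure set (measurableTypeR R) -> \bar R} :=
  HB.pack (Measure.sort nm) (Measure_isFinite.Build _ _ _ nm nfin).
exists nu; split => // D f mD f0 mf.
have numu : nu `<< mu.
  apply/null_content_dominatesP => A mA muA0.
  apply: (null_set_integral mA _ muA0) => //.
  by apply/measurable_EFinP; exact: measurable_funTS.
rewrite -(Radon_Nikodym_SigmaFinite.change_of_variables numu)//.
have fi := Radon_Nikodym_SigmaFinite.f_integrable numu.
apply: ae_eq_integral => //.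
- apply: emeasurable_funM => //; apply: measurable_funTS; exact: measurable_int fi.
- apply: emeasurable_funM => //; apply: measurable_funTS; exact/measurable_EFinP.
- have : ae_eq mu setT (Radon_Nikodym_SigmaFinite.f nu mu) (EFin \o h).
    apply: integral_ae_eq => //; first exact/measurable_EFinP.
    by move=> E _ mE; rewrite -(Radon_Nikodym_SigmaFinite.f_integral numu).
  move=> [N [mN N0 NP]]; exists N; split => //; apply: subset_trans NP => x /= H1 H2.
  by apply: H1 => _; rewrite H2.
Qed.

End density.

Section scaling.
Context {R : realType}.
Local Notation mu := (@lebesgue_measure R).
Local Notation I := (`]0, 1[%classic : set R).
Implicit Types (x w : R).

(** The integrand is merely measurable, so the substitution is made on the measures:
    Lebesgue measure is [x^-1] times its image under division by [x]. *)
Lemma ge0_integral_dilation x (f : R -> \bar R) : 0 < x ->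
  (forall t, 0 <= f t)%E -> measurable_fun setT f ->
  (\int[mu]_t f t = \int[mu]_z (f (z / x)%R * (x^-1)%:E))%E.
Proof.
move=> x0 f0 mf.
pose phi (z : measurableTypeR R) : measurableTypeR R := z / x.
have mphi : measurable_fun setT phi by exact: measurable_funM.
have xi0 : 0 <= x^-1 by rewrite invr_ge0 ltW.
pose k := NngNum xi0.
pose pm : {measure set (measurableTypeR R) -> \bar R} :=
  @measure_function_pushforward__canonical__measure_function_Measure _ _ _ _ _ mu phi mphi.
pose m := mscale k pm.
have mE A : measurable A -> mu A = m A.
  apply: lebesgue_measure_unique => _ [[a b]] _ <-.
  rewrite -[RHS]/((x^-1)%:E * mu (phi @^-1` [set` `]a, b]]))%E.
  have -> : phi @^-1` [set` `]a, b]] = [set` `](a * x), (b * x)]].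
    by apply/seteqP; split => z /=; rewrite !in_itv/= ltr_pdivlMr// ler_pdivrMr.
  rewrite !lebesgue_measure_itv/= !lte_fin ltr_pM2r//.
  case: ifP => _; last by rewrite mule0.
  by rewrite -!EFinB -EFinM; congr EFin; field; exact: lt0r_neq0.
transitivity (\int[m]_t f t)%E.
  by apply: eq_measure_integral => A mA _; exact: mE.
rewrite ge0_integral_mscale//= ge0_integral_pushforward//= preimage_setT.
rewrite -ge0_integralZl//; last exact: measurableT_comp.
by apply: eq_integral => z _; rewrite muleC.
Qed.

Lemma integral_dilation x w (f : R -> R) : 0 < x -> x <= w ->
  mu.-integrable I (EFin \o f) ->
  let F z := x^-1 * f (z / x) * \1_(`]0, x[%classic) z in
  mu.-integrable (`]0, w[ : set R) (EFin \o F) /\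
  \int[mu]_(z in `]0%R, w[) F z = \int[mu]_(t in I) f t.
Proof.
move=> x0 xw fi F.
have mI : measurable (I : set (measurableTypeR R)) by exact: measurable_itv.
pose g := (f \_ I) : R -> R.
have FE z : (F z)%:E = ((EFin \o g) (z / x)%R * (x^-1)%:E)%E.
  rewrite /F /g /= patchE -EFinM indicE; congr EFin.
  have -> : (z / x \in I) = (z \in (`]0, x[%classic : set R)).
    apply/idP/idP; rewrite !inE/= !in_itv/= => /andP[h1 h2].
      by move: h1 h2; rewrite ltr_pdivrMr// mul1r pmulr_lgt0 ?invr_gt0// => -> ->.
    by rewrite divr_gt0//= ltr_pdivrMr// mul1r.
  by case: ifP => _; rewrite ?mulr1 ?mulr0 ?mul0r// mulrC.
have gi : mu.-integrable setT (EFin \o g).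
  have := (@integrable_mkcond _ _ _ mu I (EFin \o f) mI).1 fi.
  by apply: eq_integrable => // t _; rewrite /g /= !patchE; case: ifP.
have mg := measurable_int _ gi.
have F0 : F = F \_ (`]0, w[ : set R).
  apply/funext => z; rewrite patchE; case: ifPn => // zw.
  rewrite /F indicE memNset ?mulr0// => /=; rewrite in_itv/= => /andP[z0 zx].
  by move/negP: zw; apply; rewrite inE/= in_itv/= z0 (lt_le_trans zx).
have mgx : measurable_fun setT (fun z : R => (EFin \o g) (z / x)%R * (x^-1)%:E)%E.
  apply: emeasurable_funM => //; apply: measurableT_comp => //.
  exact: measurable_funM.
have x1 (z : R) : [set: R] z -> 0 <= x^-1 by rewrite invr_ge0 ltW.
have chg (p : R -> \bar R) (p0 : (forall t, 0 <= p t)%E) (mp : measurable_fun setT p) :=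
  ge0_integral_dilation x0 p0 mp.
have Fi : mu.-integrable setT (EFin \o F).
  have := (integrable_change (m1 := mu) (m2 := mu) x1 chg mg mgx).2 gi.
  by apply: eq_integrable => // z _; rewrite /= FE.
have EF0 : EFin \o F = (EFin \o F) \_ (`]0, w[ : set R).
  by apply/funext => z; rewrite /= {1}F0 !patchE; case: ifP.
split.
  apply/(@integrable_mkcond _ _ _ mu) => //; rewrite -EF0.
  exact: Fi.
rewrite /Rintegral; congr fine.
rewrite integral_mkcond -EF0 [RHS]integral_mkcond.
transitivity (\int[mu]_t (EFin \o g) t)%E; last first.
  by apply: eq_integral => t _; rewrite /g /= !patchE; case: ifP.
rewrite (integral_change_signed (m1 := mu) (m2 := mu) x1 chg mg).
by apply: eq_integral => z _; rewrite /= FE.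
Qed.

End scaling.

(** * The derivative of sigma(x) / x *)

Section quotient.
Context {R : realType}.
Local Notation mu := (@lebesgue_measure R).
Local Notation Rpos := (`]0, +oo[%classic : set R).
Implicit Types (x y a b c L : R).
Variables (sg g : R -> R) (L : R).
Hypothesis L_gt0 : 0 < L.
Hypothesis sg0 : sg 0 = 0.
Hypothesis sgL : forall x y, `|sg x - sg y| <= L * `|x - y|.
Hypothesis mg : measurable_fun setT g.
Hypothesis gL : forall x, `|g x| <= L.
Hypothesis sg_g : {ae mu, forall x, derivable sg x 1 /\ derive1 sg x = g x}.

Lemma lipschitz0_le x : 0 < x -> `|sg x| <= L * x.
Proof. by move=> x0; have := sgL x 0; rewrite sg0 !subr0 (gtr0_norm x0). Qed.

Lemma lipschitz_measurable : measurable_fun setT sg.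
Proof. exact: continuous_measurable_fun (lipschitz_continuous sgL). Qed.

Definition quotient_derivative x := (x * g x - sg x) / x ^+ 2.

Lemma quotient_derivative_le x : 0 < x -> `|quotient_derivative x| <= 2 * L / x.
Proof.
move=> x0; have x20 : 0 < x ^+ 2 by exact: exprn_gt0.
rewrite /quotient_derivative normrM normfV (gtr0_norm x20) ler_pdivrMr//.
have -> : 2 * L / x * x ^+ 2 = x * L + L * x by field; exact: lt0r_neq0.
apply: (le_trans (ler_normB _ _)); apply: lerD; last exact: lipschitz0_le.
by rewrite normrM (gtr0_norm x0) ler_pM2l.
Qed.

Lemma quotient_derivative_measurable : measurable_fun Rpos quotient_derivative.
Proof.
apply: measurable_funM; last first.
  apply: continuous_gt0_measurable => x x0; apply: cvgV; first by rewrite expf_neq0// lt0r_neq0.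
  exact: exprn_continuous.
apply: measurable_funTS; apply: measurable_funB; last exact: lipschitz_measurable.
exact: measurable_funM.
Qed.

(** Composed with the projection onto [[a, b]], the quotient [sg x / x] becomes
    Lipschitz on the line. *)
Lemma lipschitz_quotient_FTC a b : 0 < a -> a <= b ->
  \int[mu]_(x in `[a, b]) quotient_derivative x = sg b / b - sg a / a.
Proof.
move=> a0 ab; have b0 : 0 < b by exact: lt_le_trans ab.
pose cl x := Num.max a (Num.min x b).
have cl_ge x : a <= cl x by rewrite le_max lexx.
have cl_gt0 x : 0 < cl x by exact: lt_le_trans (cl_ge x).
have cl_id x : a <= x <= b -> cl x = x.
  by move=> /andP[ax xb]; rewrite /cl min_l// max_r.
have clL x y : `|cl x - cl y| <= `|x - y|.
  rewrite /cl; case: (leP x b); case: (leP y b) => yb xb;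
   rewrite !maxEle; do ?case: ifP => ?; rewrite ler_norml; apply/andP; split;
   have := ler_norm (x - y); have := ler_norm (y - x); rewrite ?[`|y - x|]distrC; lra.
pose q x := sg (cl x) / cl x.
have K0 : 0 < 2 * L / a by rewrite divr_gt0// mulr_gt0.
have qL x y : `|q x - q y| <= 2 * L / a * `|x - y|.
  apply: (@le_trans _ _ (2 * L / a * `|cl x - cl y|)); last by rewrite ler_pM2l.
  rewrite /q; move: (cl x) (cl y) (cl_ge x) (cl_ge y) (cl_gt0 x) (cl_gt0 y) => u v au av u0 v0.
  have -> : sg u / u - sg v / v = (sg u - sg v) / u - (sg v / v) * ((u - v) / u).
    by field; rewrite !lt0r_neq0.
  have H1 : `|(sg u - sg v) / u| <= L / a * `|u - v|.
    rewrite normrM normfV (gtr0_norm u0) mulrAC; apply: ler_pM => //.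
      by rewrite invr_ge0 ltW.
    by rewrite lef_pV2 ?posrE.
  have H2 : `|sg v / v * ((u - v) / u)| <= L / a * `|u - v|.
    rewrite normrM -mulrA; apply: ler_pM => //.
      by rewrite normrM normfV (gtr0_norm v0) ler_pdivrMr// lipschitz0_le.
    rewrite normrM normfV (gtr0_norm u0) mulrC ler_wpM2r//.
    by rewrite lef_pV2 ?posrE.
  by apply: (le_trans (ler_normB _ _)); have := lerD H1 H2; lra.
have [g' [mg' _ qg' qE]] := lipschitz_FTC K0 qL.
have -> : sg b / b - sg a / a = q b - q a by rewrite /q !cl_id// ?lexx ?ab.
rewrite -qE// /Rintegral; congr fine.
have mq (D : set R) : measurable D -> D `<=` `[a, b] -> measurable_fun D (EFin \o quotient_derivative).
  move=> mD Dab; apply/measurable_EFinP; apply: measurable_funS quotient_derivative_measurable => //.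
  by move=> x /Dab /=; rewrite !in_itv/= andbT => /andP[ax _]; exact: lt_le_trans ax.
rewrite [LHS]integral_itv_bndoo; last first.
  by apply: mq => //; exact: subset_itv_oo_cc.
rewrite [RHS]integral_itv_bndoo; last first.
  by apply/measurable_EFinP; exact: measurable_funS mg'.
apply: ae_eq_integral => //.
- by apply: mq => //; exact: subset_itv_oo_cc.
- by apply/measurable_EFinP; exact: measurable_funS mg'.
move: qg' sg_g; apply: filterS2; first exact: (ae_filter_ringOfSetsType mu).
move=> x /= [_ <-] [dsg sgE]; rewrite in_itv/= => /andP[ax xb]; congr EFin.
have x0 : 0 < x by exact: lt_trans ax.
have xn0 : x != 0 by exact: lt0r_neq0.
have d1 := is_derive_of_derive1 dsg sgE.
have d2 := is_deriveM d1 (is_deriveV (f := id) xn0 (is_derive_id x (1 : R))).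
suff d3 : is_derive x 1 q (quotient_derivative x) by rewrite derive1E derive_val.
apply: (near_eq_is_derive (f := (fun y => sg y * y^-1))).
  near=> y; rewrite /q cl_id//; apply/andP; split; apply: ltW; near: y.
    exact: lt_nbhsr.
  exact: lt_nbhsl.
apply: (is_derive_eq d2).
by rewrite /quotient_derivative /GRing.scale/=; field.
Unshelve. all: by end_near. Qed.

End quotient.

(** * The profile and its weak equation *)

(** [x^2 eta(x)] is proportional to the rate at which breakage carries mass across
    the level [x]; the constant makes the first moment 1. *)
Definition profile {R : realType}
    (nu : {finite_measure set (measurableTypeR R) -> \bar R}) (P : R -> R) (x : R) :=
  (mean_powint nu 1)^-1 * (x `^ (-2) * deficit nu P x).

(** [int_0^1 sg (y z) beta(z) dz - sg y], written with [nu(dz) = z beta(z) dz]: the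
    change of the total of [sg] when a particle of mass [y] breaks. *)
Definition fragmentation_gain {R : realType}
    (nu : {finite_measure set (measurableTypeR R) -> \bar R}) (sg : R -> R) (y : R) :=
  \int[nu]_(z in `]0, 1[) (sg (y * z) / z) - sg y.

Section profile_moments.
Context {R : realType}.
Local Notation mu := (@lebesgue_measure R).
Local Notation Rpos := (`]0, +oo[%classic : set R).
Local Notation I := (`]0, 1[%classic : set R).
Implicit Types (r x y z : R).
Variable nu : {finite_measure set (measurableTypeR R) -> \bar R}.
Hypothesis nuI : nu I = 1%E.
Variables (k0 l1 l2 : R).
Hypothesis k0_ge0 : 0 <= k0.
Hypothesis k0_lt1 : k0 < 1.
Hypothesis k0_l1 : k0 <= l1.
Hypothesis l12 : l1 <= l2.
Hypothesis l2_le1 : l2 <= 1.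
Hypothesis l_gt1 : 1 < l1 + l2.
Hypothesis nu_k0 : nu.-integrable I (EFin \o (fun z => z `^ (k0 - 1))).
Variables (A B x1 s C : R) (P : R -> R).
Hypothesis x1_gt0 : 0 < x1.
Hypothesis s_gt0 : 0 < s.
Hypothesis A_gt0 : 0 < A.
Hypothesis B_gt0 : 0 < B.
Hypothesis P_adm : admissible k0 l1 x1 s C P.
Hypothesis P_derive : forall x, 0 < x ->
  is_derive x 1 P (rate l1 l2 A B x * (fragment_tail nu P x - P x)).
Local Notation d := (rate l1 l2 A B).
Local Notation m := (deficit nu P).
Local Notation psi := (jump_density nu P d).
Local Notation C0 := (\int[nu]_(z in I) z `^ (k0 - 1)).

Let PC : tail_fun C P. Proof. by case: P_adm. Qed.
Let l1_gt0 : 0 < l1. Proof. by move: k0_ge0 k0_l1 l12 l2_le1 l_gt1; lra. Qed.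
Let l2_gt0 : 0 < l2. Proof. exact: lt_le_trans l12. Qed.
Let d_ge0 x : 0 < x -> 0 <= d x. Proof. by move=> _; exact: rate_ge0 (ltW _) (ltW _). Qed.
Let d_cont x : 0 < x -> {for x, continuous d}. Proof. exact: rate_continuous. Qed.
Let psi_ge0 x : 0 < x -> 0 <= psi x. Proof. exact: (jump_density_ge0 nuI PC). Qed.
Let m_ge0 x : 0 < x -> 0 <= m x. Proof. exact: (deficit_ge0 nuI PC). Qed.
Let mpsi : measurable_fun Rpos psi.
Proof. exact: (jump_density_measurable nuI PC d_cont). Qed.
Let mm : measurable_fun Rpos m.
Proof. exact: (deficit_measurable nuI PC). Qed.

Lemma deficit_le_powR x : 0 < x -> m x <= C0 * (x / x1) `^ (1 - k0).
Proof.
move=> x0; rewrite /deficit.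
have := fragment_tail_lower nuI k0_ge0 k0_lt1 k0_l1 l12 l2_le1 l_gt1 nu_k0 x1_gt0 P_adm x0.
by have /andP[_] := PC.1 _ x0; lra.
Qed.

Lemma deficit_le_expR x : 0 < x -> m x <= expR (1 - (x / s) `^ l1).
Proof.
move=> x0; case: P_adm => _ _ /(_ _ x0); apply: le_trans.
rewrite /deficit gerBl; apply: fragment_tail_ge0 => // t t0.
by have /andP[] := PC.1 _ t0.
Qed.

(** The flux identity for the weight [x^(r-2)]. *)
Lemma moment_flux r : k0 <= r ->
  (\int[mu]_(x in Rpos) (x `^ (r - 2) * m x)%:E =
   (mean_powint nu r)%:E * \int[mu]_(y in Rpos) (y `^ (r - 1) * psi y)%:E)%E.
Proof.
move=> k0r.
have mI : measurable (I : set (measurableTypeR R)) by exact: measurable_itv.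
have mRp : measurable (Rpos : set (measurableTypeR R)) by exact: measurable_itv.
rewrite (@flux_identity _ _ nuI _ _ _ PC d_ge0 d_cont P_derive _
  (fun z y => y `^ (r - 1) * powint r z)).
- rewrite -ge0_integralZl//; last first.
  + by rewrite lee_fin ltW// (mean_powint_gt0 nuI k0_lt1).
  + move=> y; rewrite /= in_itv/= andbT => y0.
    by rewrite lee_fin mulr_ge0 ?powR_ge0 ?psi_ge0.
  + apply/measurable_EFinP; apply: measurable_funM => //.
    exact: measurable_funTS (measurable_powR _).
  apply: eq_integral => y; rewrite inE/= in_itv/= andbT => y0.
  under eq_integral do rewrite EFinM.
  rewrite integralZl//; last exact: powint_integrable nu_k0 _ _.
  rewrite -[X in (_ * (_ * X))%E]fineK; last first.
    by apply: integrable_fin_num => //; exact: powint_integrable nu_k0 _ _.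
  by rewrite -!EFinM; congr EFin; rewrite /mean_powint /Rintegral; ring.
- exact: measurable_funTS (measurable_powR _).
- by move=> x x0; exact: powR_ge0.
- apply: measurable_funM.
    apply: (measurable_snd_on (f := fun y => y `^ (r - 1))); first exact: mRp.
    exact: measurable_funTS (measurable_powR _).
  by apply: measurable_fst_on; [exact: mI|exact: measurable_powint].
- by move=> z y z01 y0; exact: integral_powR_scaled.
Qed.

Lemma mul_jump_density r x : 0 < x ->
  x `^ (r - 1) * psi x = (A * x `^ l1 + B * x `^ l2) * (x `^ (r - 2) * m x).
Proof.
move=> x0; rewrite -(mul_rate l1_gt0 l2_gt0 A B x0) /jump_density.
rewrite (_ : x `^ (r - 1) = x * x `^ (r - 2)); first by ring.
rewrite -{2}[x](powRr1 (ltW x0)) -powRD ?(gt_eqF x0) ?implybT//.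
by congr (_ `^ _); ring.
Qed.

(** Near 0 the integrand is [O(y^(l1-1))] thanks to the power bound on the
    deficit, for which [r >= k0] is just enough; the exponential bound settles
    infinity. *)
Lemma jump_moment_finite r : k0 <= r ->
  (\int[mu]_(y in Rpos) (y `^ (r - 1) * psi y)%:E < +oo)%E.
Proof.
move=> k0r; pose h y := y `^ (r - 1) * psi y.
have h0 y : 0 < y -> 0 <= h y by move=> y0; rewrite mulr_ge0 ?powR_ge0 ?psi_ge0.
have mh : measurable_fun Rpos h.
  by apply: measurable_funM => //; exact: measurable_funTS (measurable_powR _).
have AB0 : 0 < A + B by exact: addr_gt0.
rewrite -/(h _) (integral_Rpos_split ltr01)//; apply: lte_add_pinfty.
- have := C0_gt0 nuI nu_k0.
  set c0 := Rintegral _ _ _ => c00.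
  pose K := (A + B) * (c0 * (x1^-1) `^ (1 - k0)).
  have K0 : 0 <= K by rewrite !mulr_ge0 ?powR_ge0// ltW.
  apply: (@le_lt_trans _ _ (\int[mu]_(y in `]0%R, 1%R]) (K%:E * (y `^ (l1 - 1))%:E))%E).
    apply: ge0_le_integral => //.
    + by move=> y /=; rewrite in_itv/= => /andP[y0 _]; rewrite lee_fin h0.
    + apply/measurable_EFinP; apply: measurable_funS mh => //.
      by move=> y /=; rewrite !in_itv/= andbT => /andP[].
    + apply/measurable_EFinP; apply: measurable_funM => //.
      exact: measurable_funTS (measurable_powR _).
    + move=> y /=; rewrite in_itv/= => /andP[y0 y1]; rewrite -EFinM lee_fin /h.
      rewrite mul_jump_density//.
      have yl : y `^ l2 <= y `^ l1 by apply: ger_powR; rewrite ?y0.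
      have e1 : A * y `^ l1 + B * y `^ l2 <= (A + B) * y `^ l1.
        by rewrite mulrDl lerD2l ler_pM2l.
      have e2 : y `^ (r - 2) * m y <= c0 * (x1^-1) `^ (1 - k0) * y^-1.
        have := deficit_le_powR y0; rewrite -/c0 powRM ?invr_ge0 ?(ltW y0) ?(ltW x1_gt0)// => Hm.
        apply: (le_trans (ler_wpM2l (powR_ge0 _ _) Hm)).
        have {Hm} : y `^ (r - 2) * y `^ (1 - k0) <= y^-1.
          rewrite -powRD ?(gt_eqF y0) ?implybT// -(powR_inv1 (ltW y0)).
          by apply: ger_powR; [rewrite y0 y1|move: k0r; lra].
        have K1 : 0 <= c0 * (x1^-1) `^ (1 - k0) by rewrite mulr_ge0 ?powR_ge0// ltW.
        move=> /(ler_wpM2l K1); apply: le_trans.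
        by rewrite le_eqVlt; apply/orP; left; apply/eqP; ring.
      apply: (le_trans (ler_pM _ _ e1 e2)).
        by rewrite addr_ge0// mulr_ge0 ?powR_ge0// ltW.
        by rewrite mulr_ge0 ?powR_ge0 ?m_ge0.
      rewrite /K -(mulr_powRB1 (ltW y0) l1_gt0).
      rewrite le_eqVlt; apply/orP; left; apply/eqP; field; exact: lt0r_neq0.
  rewrite ge0_integralZl// ?integral_powR0// ?ltry//.
    by apply/measurable_EFinP; exact: measurable_funTS (measurable_powR _).
  by move=> y _; rewrite lee_fin powR_ge0.
- have p0 : 0 < r + 1 by move: k0_ge0 k0r; lra.
  have [K K0 HK] := powR_expR_bounded p0 s_gt0 l1_gt0.
  pose K' := (A + B) * K.
  have K'0 : 0 <= K' by rewrite mulr_ge0// ltW.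
  apply: (@le_lt_trans _ _ (\int[mu]_(y in `[1%R, +oo[) (K'%:E * (y `^ (-1 - 1))%:E))%E).
    apply: ge0_le_integral => //.
    + by move=> y /=; rewrite in_itv/= andbT => y1; rewrite lee_fin h0// (lt_le_trans ltr01).
    + apply/measurable_EFinP; apply: measurable_funS mh => //.
      by move=> y /=; rewrite !in_itv/= !andbT; exact: lt_le_trans.
    + apply/measurable_EFinP; apply: measurable_funM => //.
      exact: measurable_funTS (measurable_powR _).
    + move=> y /=; rewrite in_itv/= andbT => y1; rewrite -EFinM lee_fin /h.
      have y0 : 0 < y by exact: lt_le_trans y1.
      rewrite mul_jump_density//.
      have yl l : l <= 1 -> y `^ l <= y.
        by move=> l1'; rewrite -[leRHS](powRr1 (ltW y0)); exact: ler_powR.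
      have e1 : A * y `^ l1 + B * y `^ l2 <= (A + B) * y.
        by rewrite mulrDl lerD// ler_pM2l// yl//; exact: le_trans l2_le1.
      have e2 : y `^ (r - 2) * m y <= K * y `^ (-3).
        have -> : r - 2 = r + 1 + -3 by ring.
        rewrite powRD ?(gt_eqF y0) ?implybT// mulrAC ler_pM2r ?powR_gt0//.
        apply: le_trans (HK _ y0); rewrite ler_pM2l ?powR_gt0//.
        exact: deficit_le_expR.
      apply: (le_trans (ler_pM _ _ e1 e2)).
        by rewrite addr_ge0// mulr_ge0 ?powR_ge0// ltW.
        by rewrite mulr_ge0 ?powR_ge0 ?m_ge0.
      rewrite /K' (_ : -1 - 1 = -3 + 1) ?powRD ?(gt_eqF y0) ?implybT//; last by ring.
      rewrite powRr1 ?(ltW y0)// le_eqVlt; apply/orP; left; apply/eqP; ring.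
  rewrite ge0_integralZl// ?integral_powRy// ?ltry//.
    by apply/measurable_EFinP; exact: measurable_funTS (measurable_powR _).
  by move=> y _; rewrite lee_fin powR_ge0.
Qed.

Let P_cvg1 : P x @[x --> 0^'+] --> (1 : R).
Proof.
have g0 : 0 < 1 - k0 + l1 by move: k0_lt1 l1_gt0; lra.
apply: (@squeeze_cvgr _ _ _ _ (fun x => 1 - (x1^-1) `^ (1 - k0 + l1) * x `^ (1 - k0 + l1)) (cst 1)).
- near=> x; have x0 : 0 < x by near: x; exact: nbhs_right_gt.
  have /andP[_ ->] := PC.1 _ x0; rewrite andbT.
  case: P_adm => _ /(_ _ x0) + _.
  by rewrite powRM ?invr_ge0 ?(ltW x0) ?(ltW x1_gt0)//; lra.
- rewrite -[X in _ --> X](subr0 (1 : R)); apply: cvgB; first exact: cvg_cst.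
  rewrite -[X in _ --> X](mulr0 ((x1^-1) `^ (1 - k0 + l1))); apply: cvgM; first exact: cvg_cst.
  exact: powR_cvg0.
- exact: cvg_cst.
Unshelve. all: by end_near. Qed.

Let P_cvg0 : P x @[x --> +oo] --> (0 : R).
Proof.
have [K K0 HK] := powR_expR_bounded ltr01 s_gt0 l1_gt0.
apply: (@squeeze_cvgr _ _ _ _ (cst 0) (fun x => K * x `^ (-1))).
- near=> x; have x0 : 0 < x by near: x; exact: nbhs_pinfty_gt.
  have /andP[-> _] /= := PC.1 _ x0.
  rewrite powR_inv1 ?(ltW x0)// ler_pdivlMr// mulrC.
  apply: le_trans (HK _ x0); rewrite powRr1 ?(ltW x0)// ler_pM2l//.
  by case: P_adm => _ _; apply.
- exact: cvg_cst.
- rewrite -[X in _ --> X](mulr0 K); apply: cvgM; first exact: cvg_cst.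
  exact: powR_cvgy.
Unshelve. all: by end_near. Qed.

Lemma integral_jump_density0 t : 0 < t ->
  (\int[mu]_(y in `]0%R, t]) (psi y)%:E = (1 - P t)%:E)%E.
Proof.
move=> t0; rewrite (_ : 1 - P t = - P t - -1); last by ring.
apply: (@FTC_at_zero _ psi (fun t => - P t)) => //.
- by move=> x x0; exact: (jump_density_continuous nuI PC).
- by move=> x x0; exact: jump_density_derive.
- by apply: cvgN; exact: P_cvg1.
Qed.

(** Fubini, after writing [y^(r-1)] as [(1 - r)] times the integral of [t^(r-2)]
    over [[y, +oo)]. *)
Lemma jump_moment r : 0 < r -> r <= 1 ->
  (\int[mu]_(y in Rpos) (y `^ (r - 1) * psi y)%:E = (tail_moment r P)%:E)%E.
Proof.
move=> r0 r1; rewrite /tail_moment; case: eqP => [->|/eqP rn1].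
  transitivity (\int[mu]_(y in Rpos) (psi y)%:E)%E.
    by apply: eq_integral => y _; rewrite subrr powRr0 mul1r.
  rewrite (integral_Rpos_split ltr01)// integral_jump_density0//.
  have -> : (\int[mu]_(x in `[1%R, +oo[) (psi x)%:E = (0 - - P 1)%:E)%E.
    apply: (@FTC_at_infinity _ psi (fun t => - P t)) => //.
    + by move=> x x0; exact: (jump_density_continuous nuI PC).
    + by move=> x x0; exact: jump_density_derive.
    + by rewrite -[X in _ --> X]oppr0; apply: cvgN; exact: P_cvg0.
  by rewrite -EFinD; congr EFin; ring.
have {}r1 : r < 1 by rewrite lt_neqAle rn1.
have mRp : measurable (Rpos : set (measurableTypeR R)) by exact: measurable_itv.
pose F (yt : R * R) :=
  if yt.1 <= yt.2 then ((1 - r) * (yt.2 `^ (r - 2) * psi yt.1))%:E else 0%E.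
transitivity (\int[mu]_(y in Rpos) \int[mu]_(t in Rpos) F (y, t))%E.
  apply: eq_integral => y; rewrite inE/= in_itv/= andbT => y0.
  have := integral_powRy y0 (_ : r - 1 < 0); rewrite subr_lt0 => /(_ r1) E.
  have -> : y `^ (r - 1) * psi y = (1 - r) * psi y * (y `^ (r - 1) / - (r - 1)).
    by rewrite opprB mulrC; field; rewrite subr_eq0 eq_sym.
  rewrite EFinM -E -ge0_integralZl//; last 3 first.
  + by apply/measurable_EFinP; exact: measurable_funTS (measurable_powR _).
  + by move=> t _; rewrite lee_fin powR_ge0.
  + by rewrite lee_fin mulr_ge0 ?psi_ge0// subr_ge0 ltW.
  rewrite integral_Rpos_sub; last first.
    by move=> t /=; rewrite !in_itv/= !andbT; exact: lt_le_trans.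
  apply: eq_integral => t _; rewrite /F /= in_itv/= andbT; case: ifP => // _.
  by rewrite -EFinM; congr EFin; rewrite (_ : r - 1 - 1 = r - 2); ring.
rewrite (@tonelli_on _ _ _ _ _ mu mu _ _ F)//=; last 2 first.
- apply: measurable_fun_if; first exact: measurableX.
  + apply: measurable_funTS.
    by apply: measurable_fun_ler; [exact: measurable_fst|exact: measurable_snd].
  + apply/measurable_EFinP; apply: measurable_funS (measurableX mRp mRp) _ _.
      exact: subIsetl.
    apply: measurable_funM => //; apply: measurable_funM.
      apply: (measurable_snd_on (f := fun y => y `^ (r - 2))); [exact: mRp|].
      exact: measurable_funTS (measurable_powR _).
    by apply: measurable_fst_on; [exact: mRp|exact: mpsi].
  + exact: measurable_cst.
- move=> y t; rewrite /= !in_itv/= !andbT /F /= => y0 t0; case: ifP => // _.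
  by rewrite lee_fin mulr_ge0 ?subr_ge0 ?(ltW r1)// mulr_ge0 ?powR_ge0 ?psi_ge0.
have g1 : 0 < 1 - k0 + l1 + r - 1 by move: k0_l1 r0; lra.
have int : mu.-integrable Rpos (fun x => (x `^ (r - 2) * (1 - P x))%:E).
  have [_ Plo _] := P_adm.
  exact: (one_minus_tail_integrable x1_gt0 g1 r1 PC Plo).
transitivity (\int[mu]_(t in Rpos) ((1 - r)%:E * (t `^ (r - 2) * (1 - P t))%:E))%E.
  apply: eq_integral => t; rewrite inE/= in_itv/= andbT => t0.
  rewrite EFinM -integral_jump_density0//.
  rewrite muleA -EFinM -ge0_integralZl//; last 3 first.
  + apply/measurable_EFinP; apply: measurable_funS mpsi => //.
    by move=> y /=; rewrite !in_itv/= andbT => /andP[].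
  + by move=> y /=; rewrite in_itv/= => /andP[y0 _]; rewrite lee_fin psi_ge0.
  + by rewrite lee_fin mulr_ge0 ?powR_ge0// subr_ge0 ltW.
  rewrite [RHS]integral_Rpos_sub; last by move=> y /=; rewrite !in_itv/= andbT => /andP[].
  apply: eq_integral => y; rewrite inE/= in_itv/= andbT => y0.
  rewrite /F /= in_itv/= y0/=; case: ifP => // _.
  by rewrite -EFinM mulrA.
rewrite integralZl// -[X in (_ * X)%E]fineK; last exact: integrable_fin_num.
by [].
Qed.

Local Notation ell := (mean_powint nu 1).
Local Notation eta := (profile nu P).

Let ell_gt0 : 0 < ell.
Proof. by apply: (mean_powint_gt0 nuI k0_lt1 nu_k0); exact: ltW. Qed.

Lemma powR_profile r x : 0 < x -> x `^ r * eta x = ell^-1 * (x `^ (r - 2) * m x).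
Proof.
by move=> x0; rewrite /profile powRD ?(gt_eqF x0) ?implybT//; ring.
Qed.

Lemma profile_ge0 x : 0 < x -> 0 <= eta x.
Proof. by move=> x0; rewrite mulr_ge0 ?invr_ge0 ?(ltW ell_gt0)// mulr_ge0 ?powR_ge0 ?m_ge0. Qed.

Lemma profile_measurable : measurable_fun Rpos eta.
Proof.
apply: measurable_funM => //; apply: measurable_funM => //.
exact: measurable_funTS (measurable_powR _).
Qed.

Lemma moment_deficit_integrable r : k0 <= r ->
  mu.-integrable Rpos (EFin \o (fun x => x `^ (r - 2) * m x)).
Proof.
move=> k0r; apply/integrableP; split.
  apply/measurable_EFinP; apply: measurable_funM => //.
  exact: measurable_funTS (measurable_powR _).
under eq_integral => x.
  rewrite inE/= in_itv/= andbT => x0; rewrite /= ger0_norm ?mulr_ge0 ?powR_ge0 ?m_ge0//.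
  over.
rewrite moment_flux//; apply: lte_mul_pinfty => //; last exact: jump_moment_finite.
by rewrite lee_fin ltW// (mean_powint_gt0 nuI k0_lt1).
Qed.

Lemma profile_in_S r : k0 <= r -> in_S r eta.
Proof.
move=> k0r; have mRp : measurable (Rpos : set (measurableTypeR R)) by exact: measurable_itv.
have := integrableZl mRp ell^-1 (moment_deficit_integrable k0r).
apply: eq_integrable => // x.
by rewrite inE/= in_itv/= andbT => x0; rewrite powR_profile// -EFinM.
Qed.

Lemma profile_moment r : k0 <= r -> 0 < r -> r <= 1 ->
  moment r eta = ell^-1 * (mean_powint nu r * tail_moment r P).
Proof.
move=> k0r r0 r1; rewrite /moment.
transitivity (\int[mu]_(x in Rpos) (ell^-1 * (x `^ (r - 2) * m x))).
  by apply: eq_Rintegral => x; rewrite inE/= in_itv/= andbT => x0; rewrite powR_profile.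
rewrite RintegralZl//; last exact: moment_deficit_integrable.
by congr (_ * _); rewrite /Rintegral moment_flux// jump_moment.
Qed.

(** The power bound on the deficit is exactly of order [1 - k0]. *)
Lemma profile_Linfty : in_weighted_Linfty (k0 + 1) eta.
Proof.
split; first exact: profile_measurable.
exists (ell^-1 * (C0 * (x1^-1) `^ (1 - k0))); apply: aeW => x x0.
rewrite powR_profile// ger0_norm; last first.
  by rewrite mulr_ge0 ?invr_ge0 ?(ltW ell_gt0)// mulr_ge0 ?powR_ge0 ?m_ge0.
rewrite ler_pM2l ?invr_gt0//.
apply: (le_trans (ler_wpM2l (powR_ge0 _ _) (deficit_le_powR x0))).
rewrite powRM ?invr_ge0 ?(ltW x0) ?(ltW x1_gt0)//.
have -> : x `^ (k0 + 1 - 2) * (C0 * (x `^ (1 - k0) * x1^-1 `^ (1 - k0))) =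
  (x `^ (k0 + 1 - 2) * x `^ (1 - k0)) * (C0 * x1^-1 `^ (1 - k0)) by ring.
rewrite -powRD ?(gt_eqF x0) ?implybT// (_ : k0 + 1 - 2 + (1 - k0) = 0); last by ring.
by rewrite powRr0 mul1r.
Qed.

Section weak_form.
Variables (sg g : R -> R) (L : R).
Hypothesis L_gt0 : 0 < L.
Hypothesis sg0 : sg 0 = 0.
Hypothesis sgL : forall x y, `|sg x - sg y| <= L * `|x - y|.
Hypothesis mg : measurable_fun setT g.
Hypothesis gL : forall x, `|g x| <= L.
Hypothesis sg_g : {ae mu, forall x, derivable sg x 1 /\ derive1 sg x = g x}.
Local Notation U := (fragmentation_gain nu sg).
Local Notation qd := (quotient_derivative sg g).

Let msg : measurable_fun setT sg := lipschitz_measurable sgL.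

Lemma scaled_quotient_le y z : 0 < y -> 0 < z < 1 -> `|sg (y * z) / z| <= L * y.
Proof.
move=> y0 /andP[z0 z1]; rewrite normrM normfV (gtr0_norm z0) ler_pdivrMr// -mulrA.
by apply: lipschitz0_le => //; exact: mulr_gt0.
Qed.

Lemma scaled_quotient_integrable y : 0 < y ->
  nu.-integrable I (EFin \o (fun z => sg (y * z) / z)).
Proof.
move=> y0; apply: (bounded_nu_integrable nuI) => [|z]; last exact: scaled_quotient_le.
apply: measurable_funM; last exact: measurable_inv_itv01.
apply: measurableT_comp => //; apply: measurable_funTS; exact: measurable_funM.
Qed.

Lemma fragmentation_gain_le y : 0 < y -> `|U y| <= 2 * L * y.
Proof.
move=> y0; apply: (le_trans (ler_normB _ _)).
have -> : 2 * L * y = L * y + L * y by ring.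
apply: lerD; last exact: lipschitz0_le.
apply: (le_trans (le_normr_Rintegral _ (scaled_quotient_integrable y0))) => //.
rewrite -[leRHS](nu_cst nuI); apply: (le_nu_integral).
- exact: (integrable_norm (scaled_quotient_integrable y0)).
- exact: nu_cst_integrable.
- by move=> z; exact: scaled_quotient_le.
Qed.

Lemma fragmentation_gain_measurable : measurable_fun Rpos U.
Proof.
apply: continuous_gt0_measurable => y y0.
apply: cvgB; last exact: (lipschitz_continuous sgL).
apply/cvgrPdist_le => e e0; near=> t.
have t0 : 0 < t by near: t; exact: lt_nbhsr.
rewrite -RintegralB//; try exact: scaled_quotient_integrable.
have iB : nu.-integrable I (EFin \o (fun z => sg (y * z) / z - sg (t * z) / z)).
  exact: (integrableB _ (scaled_quotient_integrable y0) (scaled_quotient_integrable t0)).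
apply: (le_trans (le_normr_Rintegral _ iB)) => //.
apply: (@le_trans _ _ (L * `|y - t|)); last first.
  by rewrite mulrC -ler_pdivlMr//; near: t; apply: cvgr_dist_le; rewrite ?divr_gt0//; exact: cvg_id.
rewrite -[leRHS](nu_cst nuI); apply: (le_nu_integral).
- exact: (integrable_norm iB).
- exact: nu_cst_integrable.
move=> z /andP[z0 z1]; rewrite -mulrBl normrM normfV (gtr0_norm z0) ler_pdivrMr//.
apply: (le_trans (sgL _ _)); rewrite -mulrBl normrM (gtr0_norm z0) mulrA.
by [].
Unshelve. all: by end_near. Qed.

Lemma nu_integral_increment y : 0 < y ->
  (\int[nu]_(z in I) (2 * L * powint 1 z + (sg y / y - sg (z * y) / (z * y)))%:E =
   (2 * L * ell - U y / y)%:E)%E.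
Proof.
move=> y0.
have i1 : nu.-integrable I (EFin \o (fun z => 2 * L * powint 1 z)).
  by apply: (@integrableZl _ _ _ _ _ _ (2 * L) _ (powint_integrable k0_lt1 nu_k0 (ltW k0_lt1))).
have i2 := nu_cst_integrable nuI (sg y / y).
have i3 : nu.-integrable I (EFin \o (fun z => y^-1 * (sg (y * z) / z))).
  by apply: (@integrableZl _ _ _ _ _ _ y^-1 _ (scaled_quotient_integrable y0)).
have i4 : nu.-integrable I (EFin \o (fun z => sg y / y - y^-1 * (sg (y * z) / z))).
  exact: (integrableB _ i2 i3).
have i5 : nu.-integrable I (EFin \o (fun z => 2 * L * powint 1 z + (sg y / y - y^-1 * (sg (y * z) / z)))).
  exact: (integrableD _ i1 i4).
transitivity (\int[nu]_(z in I) (2 * L * powint 1 z + (sg y / y - y^-1 * (sg (y * z) / z)))%:E)%E.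
  apply: eq_integral => z; rewrite inE/= in_itv/= => /andP[z0 _]; congr EFin.
  by congr (_ + (_ - _)); rewrite [z * y]mulrC; field; rewrite !lt0r_neq0.
rewrite -[LHS]fineK; last exact: integrable_fin_num i5.
congr EFin; rewrite -[LHS]/(\int[nu]_(z in I) _).
rewrite RintegralD// RintegralB// [X in X + _]RintegralZl// ?[X in _ - X]RintegralZl//; last 2 first.
- exact: scaled_quotient_integrable.
- exact: (powint_integrable k0_lt1 nu_k0 (ltW k0_lt1)).
by rewrite nu_cst// /fragmentation_gain /mean_powint; ring.
Qed.

Lemma integral_increment y z : 0 < z < 1 -> 0 < y ->
  (\int[mu]_(x in `[(z * y)%R, y]) (2 * L * x `^ (1 - 2) + qd x)%:E =
    (2 * L * powint 1 z + (sg y / y - sg (z * y) / (z * y)))%:E)%E.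
Proof.
move=> z01 y0; have /andP[z0 z1] := z01; have zy0 : 0 < z * y by exact: mulr_gt0.
have zyy : z * y <= y by rewrite ler_piMl ?ltW.
pose J := `[(z * y)%R, y]%classic : set R.
have JR : J `<=` Rpos.
  by move=> t /=; rewrite !in_itv/= andbT => /andP[+ _]; exact: lt_le_trans zy0.
have mJ : measurable (J : set (measurableTypeR R)) by exact: measurable_itv.
have Jfin : (mu J < +oo)%E by rewrite lebesgue_measure_itv/=; case: ifP => _; rewrite ?ltry// -EFinB ltry.
have iq : mu.-integrable J (EFin \o qd).
  apply: measurable_bounded_integrable => //.
    by apply: measurable_funS (quotient_derivative_measurable sgL mg) => //.
  exists (2 * L / (z * y)); split; [exact: num_real|move=> M MN x /= Jx].
  have x0 := JR _ Jx; move: Jx x0; rewrite /= !in_itv/= andbT => /andP[zx _] x0.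
  apply: (le_trans (quotient_derivative_le sg0 sgL gL x0)); apply: le_trans (ltW MN).
  by rewrite ler_pM2l ?mulr_gt0// lef_pV2.
have ip : mu.-integrable J (EFin \o (fun x => x `^ (1 - 2))).
  apply/integrableP; split.
    by apply/measurable_EFinP; exact: measurable_funTS (measurable_powR _).
  under eq_integral => x _ do rewrite /= ger0_norm ?powR_ge0//.
  by rewrite integral_powR_scaled// ltry.
have ip' : mu.-integrable J (EFin \o (fun x => 2 * L * x `^ (1 - 2))).
  by apply: (@integrableZl _ _ _ _ _ _ (2 * L) _ ip).
have i5 : mu.-integrable J (EFin \o (fun x => 2 * L * x `^ (1 - 2) + qd x)).
  exact: (integrableD _ ip' iq).
rewrite -[LHS]fineK; last exact: integrable_fin_num i5.
congr EFin; rewrite -[LHS]/(\int[mu]_(x in J) _).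
rewrite RintegralD// RintegralZl// (lipschitz_quotient_FTC L_gt0 sg0 sgL mg sg_g)//.
by rewrite {1}/Rintegral integral_powR_scaled//= subrr powRr0 mul1r.
Qed.

(** The flux identity for the weight whose primitive is [sg(x) / x].  The weight
    [2 L / x] is added to make it nonnegative and subtracted at the end; its own
    flux identity is [moment_flux] at [r = 1]. *)
Lemma weak_flux :
  \int[mu]_(x in Rpos) ((sg x - x * g x) * eta x) =
  \int[mu]_(y in Rpos) (U y * (A * y `^ l1 + B * y `^ l2) * eta y).
Proof.
have mI : measurable (I : set (measurableTypeR R)) by exact: measurable_itv.
have mRp : measurable (Rpos : set (measurableTypeR R)) by exact: measurable_itv.
have mU := fragmentation_gain_measurable.
have mqd := quotient_derivative_measurable sgL mg.
have mpow p : measurable_fun Rpos (fun x : R => x `^ p).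
  exact: measurable_funTS (measurable_powR _).
have mPhi1 := measurable_powint 1.
pose phi x := 2 * L * x `^ (1 - 2) + qd x.
pose Phi z y := 2 * L * powint 1 z + (sg y / y - sg (z * y) / (z * y)).
have p12 x : 0 < x -> x `^ (1 - 2) = x^-1.
  by move=> x0; rewrite (_ : 1 - 2 = -1) ?powR_inv1 ?(ltW x0)//; ring.
have flux : (\int[mu]_(x in Rpos) (phi x * m x)%:E =
    \int[mu]_(y in Rpos) (psi y * (2 * L * ell - U y / y))%:E)%E.
  rewrite (@flux_identity _ _ nuI _ _ _ PC d_ge0 d_cont P_derive phi Phi).
  - apply: eq_integral => y; rewrite inE/= in_itv/= andbT => y0.
    by rewrite nu_integral_increment.
  - by apply: measurable_funD => //; exact: measurable_funM.
  - move=> x x0; have := quotient_derivative_le sg0 sgL gL x0.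
    by rewrite ler_norml /phi p12// => /andP[+ _]; lra.
  - apply: measurable_funD.
      apply: measurable_funM => //.
      by apply: measurable_fst_on; [exact: mI|exact: mPhi1].
    have minv : measurable_fun Rpos (@GRing.inv R).
      by apply: continuous_gt0_measurable => x x0; apply: inv_continuous; exact: lt0r_neq0.
    have msgx : measurable_fun Rpos (fun x => sg x / x).
      by apply: measurable_funM => //; exact: measurable_funTS.
    apply: measurable_funB.
      by apply: (measurable_snd_on (f := fun x => sg x / x)); [exact: mRp|exact: msgx].
    apply: (measurable_comp mRp _ msgx).
      move=> _ [[z y] [/= + +] <-]; rewrite /= !in_itv/= !andbT => /andP[z0 _] y0.
      exact: mulr_gt0.
    by apply: measurable_funTS; apply: measurable_funM; [exact: measurable_fst|exact: measurable_snd].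
  - by move=> z y; exact: integral_increment.
have k01 : k0 <= 1 by exact: ltW.
have i1 := moment_deficit_integrable k01.
have ipsi : mu.-integrable Rpos (EFin \o psi).
  apply/integrableP; split; first exact/measurable_EFinP.
  have := jump_moment_finite k01; apply: le_lt_trans; rewrite le_eqVlt; apply/orP; left; apply/eqP.
  apply: eq_integral => y; rewrite inE/= in_itv/= andbT => y0.
  by rewrite /= subrr powRr0 mul1r ger0_norm ?psi_ge0.
have iqm : mu.-integrable Rpos (EFin \o (fun x => qd x * m x)).
  apply: (le_integrable mRp _ _ (integrableZl mRp (2 * L) i1)).
    by apply/measurable_EFinP; exact: measurable_funM.
  move=> x /=; rewrite in_itv/= andbT => x0; rewrite lee_fin !normrM.
  rewrite (ger0_norm (m_ge0 x0)) (ger0_norm (powR_ge0 _ _)) -!normrM mulrA.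
  rewrite ler_wpM2r ?m_ge0//; apply: (le_trans (quotient_derivative_le sg0 sgL gL x0)).
  by rewrite p12// gtr0_norm// mulr_gt0.
have mUy : measurable_fun Rpos (fun y => U y / y).
  apply: measurable_funM => //.
  by apply: continuous_gt0_measurable => x x0; apply: inv_continuous; exact: lt0r_neq0.
have iU : mu.-integrable Rpos (EFin \o (fun y => psi y * (U y / y))).
  apply: (le_integrable mRp _ _ (integrableZl mRp (2 * L) ipsi)).
    by apply/measurable_EFinP; exact: measurable_funM.
  move=> x /=; rewrite in_itv/= andbT => x0; rewrite lee_fin normrM [leRHS]normrM.
  rewrite (ger0_norm (psi_ge0 x0)) mulrC ler_wpM2r ?psi_ge0//.
  rewrite [leRHS]gtr0_norm ?mulr_gt0// normrM normfV (gtr0_norm x0) ler_pdivrMr//.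
  exact: fragmentation_gain_le.
have key : \int[mu]_(x in Rpos) (qd x * m x) = - \int[mu]_(y in Rpos) (psi y * (U y / y)).
  have : \int[mu]_(x in Rpos) (2 * L * (x `^ (1 - 2) * m x) + qd x * m x) =
     \int[mu]_(y in Rpos) (2 * L * ell * psi y - psi y * (U y / y)).
    rewrite /Rintegral; congr fine.
    transitivity (\int[mu]_(x in Rpos) (phi x * m x)%:E)%E.
      by apply: eq_integral => x _; congr EFin; rewrite /phi; ring.
    by rewrite flux; apply: eq_integral => y _; congr EFin; ring.
  rewrite RintegralD//; last first.
    by apply: (@integrableZl _ _ _ _ _ _ (2 * L) _ i1).
  rewrite RintegralB//; last first.
    by apply: (@integrableZl _ _ _ _ _ _ (2 * L * ell) _ ipsi).
  rewrite !RintegralZl//.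
  have -> : \int[mu]_(x in Rpos) psi x = 1.
    rewrite /Rintegral; have := jump_moment ltr01 (lexx 1); rewrite /tail_moment eqxx => E.
    rewrite (_ : (\int[mu]_(x in _) (psi x)%:E = 1)%E)// -[RHS]E.
    by apply: eq_integral => y _; rewrite subrr powRr0 mul1r.
  have -> : \int[mu]_(x in Rpos) (x `^ (1 - 2) * m x) = ell.
    by rewrite /Rintegral moment_flux// jump_moment// /tail_moment eqxx mule1.
  lra.
transitivity (\int[mu]_(x in Rpos) (- ell^-1 * (qd x * m x))).
  apply: eq_Rintegral => x; rewrite inE/= in_itv/= andbT => x0.
  rewrite /profile /quotient_derivative powRN powR_mulrn ?(ltW x0)//.
  by ring.
rewrite RintegralZl// key mulrNN -RintegralZl//.
apply: eq_Rintegral => y; rewrite inE/= in_itv/= andbT => y0.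
have := mul_jump_density 0 y0; rewrite !sub0r powR_inv1 ?(ltW y0)// => E.
have -> : psi y * (U y / y) = U y * (y^-1 * psi y) by ring.
by rewrite E /profile; ring.
Qed.

End weak_form.

End profile_moments.

(** * The collision integral *)

Section bilinear.
Context {R : realType}.
Local Notation mu := (@lebesgue_measure R).
Local Notation Rpos := (`]0, +oo[%classic : set R).
Implicit Types (c x y : R).

Lemma Rintegral_lin2 (f1 f2 : R -> R) c1 c2 :
  mu.-integrable Rpos (EFin \o f1) -> mu.-integrable Rpos (EFin \o f2) ->
  mu.-integrable Rpos (EFin \o (fun x => c1 * f1 x + c2 * f2 x)) /\
  \int[mu]_(x in Rpos) (c1 * f1 x + c2 * f2 x) =
  c1 * \int[mu]_(x in Rpos) f1 x + c2 * \int[mu]_(x in Rpos) f2 x.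
Proof.
move=> i1 i2.
have j1 : mu.-integrable Rpos (EFin \o (fun x => c1 * f1 x)).
  by apply: (@integrableZl _ _ _ _ _ _ c1 _ i1).
have j2 : mu.-integrable Rpos (EFin \o (fun x => c2 * f2 x)).
  by apply: (@integrableZl _ _ _ _ _ _ c2 _ i2).
split; first exact: (integrableD _ j1 j2).
by rewrite RintegralD// !RintegralZl.
Qed.

(** For the product kernel and a gain of the form [U x + U y] the double
    integral is a sum of four products of simple ones, equal in pairs. *)
Lemma integral_symmetric_kernel (l1 l2 : R) (eta U : R -> R) :
  in_S l1 eta -> in_S l2 eta ->
  mu.-integrable Rpos (EFin \o (fun x => x `^ l1 * (U x * eta x))) ->
  mu.-integrable Rpos (EFin \o (fun x => x `^ l2 * (U x * eta x))) ->
  \int[mu]_(x in Rpos) \int[mu]_(y in Rpos)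
     ((U x + U y) * product_kernel l1 l2 x y * eta x * eta y) =
  2 * (moment l2 eta * \int[mu]_(x in Rpos) (x `^ l1 * (U x * eta x)) +
       moment l1 eta * \int[mu]_(x in Rpos) (x `^ l2 * (U x * eta x))).
Proof.
move=> i1 i2 j1 j2; rewrite /moment.
set M1 := \int[mu]_(x in Rpos) (x `^ l1 * eta x).
set M2 := \int[mu]_(x in Rpos) (x `^ l2 * eta x).
set J1 := \int[mu]_(x in Rpos) (x `^ l1 * (U x * eta x)).
set J2 := \int[mu]_(x in Rpos) (x `^ l2 * (U x * eta x)).
have inner x : \int[mu]_(y in Rpos)
     ((U x + U y) * product_kernel l1 l2 x y * eta x * eta y) =
   1 * (M2 * (x `^ l1 * (U x * eta x)) + M1 * (x `^ l2 * (U x * eta x))) +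
   1 * (J2 * (x `^ l1 * eta x) + J1 * (x `^ l2 * eta x)).
  pose a l := x `^ l * eta x; pose b l := x `^ l * (U x * eta x).
  have [k1 E1] := Rintegral_lin2 (b l1) (b l2) i2 i1.
  have [k2 E2] := Rintegral_lin2 (a l1) (a l2) j2 j1.
  have [_ E] := Rintegral_lin2 1 1 k1 k2.
  transitivity (1 * \int[mu]_(y in Rpos) (b l1 * (y `^ l2 * eta y) + b l2 * (y `^ l1 * eta y)) +
    1 * \int[mu]_(y in Rpos) (a l1 * (y `^ l2 * (U y * eta y)) + a l2 * (y `^ l1 * (U y * eta y)))).
    rewrite -E; apply: eq_Rintegral => y _; rewrite /product_kernel /a /b; ring.
  by rewrite E1 E2 -/M1 -/M2 -/J1 -/J2 /a /b; ring.
under eq_Rintegral do rewrite inner.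
have [k1 E1] := Rintegral_lin2 M2 M1 j1 j2.
have [k2 E2] := Rintegral_lin2 J2 J1 i1 i2.
have [_ ->] := Rintegral_lin2 1 1 k1 k2.
by rewrite E1 E2 -/M1 -/M2 -/J1 -/J2; ring.
Qed.

End bilinear.

Section fragment_measure.
Context {R : realType}.
Local Notation mu := (@lebesgue_measure R).
Local Notation I := (`]0, 1[%classic : set R).
Variables (beta : R -> R) (k0 : R).
Hypothesis beta_meas : measurable_fun I beta.
Hypothesis beta_ge0 : forall z : R, 0 < z < 1 -> 0 <= beta z.
Hypothesis beta_mass : (\int[mu]_(z in `]0%R, 1%R[) (z * beta z)%:E = 1)%E.
Hypothesis beta_k0 : (\int[mu]_(z in `]0%R, 1%R[) (z `^ k0 * beta z)%:E < +oo)%E.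

(** [nu] has density [z beta(z)], stated through the integrals it computes. *)
Definition fragment_law (nu : {finite_measure set (measurableTypeR R) -> \bar R}) :=
  forall f : R -> R, measurable_fun I f ->
    (mu.-integrable I (EFin \o (fun z => f z * (z * beta z))) <->
      nu.-integrable I (EFin \o f)) /\
    \int[nu]_(z in I) f z = \int[mu]_(z in I) (f z * (z * beta z)).

Lemma fragment_measure : exists nu : {finite_measure set (measurableTypeR R) -> \bar R},
  [/\ nu I = 1%E, nu.-integrable I (EFin \o (fun z => z `^ (k0 - 1)))
    & fragment_law nu].
Proof.
have mI : measurable (I : set (measurableTypeR R)) by exact: measurable_itv.
have mzb : measurable_fun I (fun z => z * beta z) by exact: measurable_funM.
have zb0 z : I z -> 0 <= z * beta z.
  by rewrite /= in_itv/= => z01; rewrite mulr_ge0 ?beta_ge0//; case/andP: z01 => /ltW.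
pose h : R -> R := (fun z => z * beta z) \_ I.
have mh : measurable_fun setT h by apply/(measurable_restrictT _ _).1.
have h0 z : 0 <= h z.
  by rewrite /h patchE; case: ifPn => // /set_mem; exact: zb0.
have hI z : z \in (I : set R) -> h z = z * beta z by rewrite /h patchE => ->.
have hT : (\int[mu]_z (h z)%:E = 1)%E.
  rewrite -beta_mass [RHS]integral_mkcond; apply: eq_integral => z _.
  by rewrite /h !patchE; case: ifP.
have [|nu [nuE nu_int]] := density_measure mh h0; first by rewrite hT ltry.
exists nu.
have chg (f : R -> \bar R) : (forall x, 0 <= f x)%E -> measurable_fun I f ->
   (\int[nu]_(x in I) f x = \int[mu]_(x in I) (f x * (x * beta x)%:E))%E.
  move=> f0 mf; rewrite nu_int//; apply: eq_integral => x xI.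
  by rewrite hI.
have nuP : fragment_law nu.
  move=> f mf.
  have mf' : measurable_fun I (EFin \o f) by exact/measurable_EFinP.
  have mfh : measurable_fun I (fun x => (EFin \o f) x * (x * beta x)%:E)%E.
    by apply: emeasurable_funM => //; exact/measurable_EFinP.
  split; first exact: (integrable_change (m1 := nu) (m2 := mu) zb0 chg mf' mfh).
  by rewrite /Rintegral (integral_change_signed (m1 := nu) (m2 := mu) zb0 chg mf').
split => //.
  by rewrite nuE -beta_mass; apply: eq_integral => z zI; rewrite hI.
have mpow : measurable_fun I (fun z : R => z `^ (k0 - 1)).
  exact: measurable_funTS (measurable_powR _).
apply/(nuP _ mpow).1; apply/integrableP; split.
  by apply/measurable_EFinP; exact: measurable_funM.
apply: le_lt_trans beta_k0; rewrite le_eqVlt; apply/orP; left; apply/eqP.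
apply: eq_integral => z; rewrite inE/= in_itv/= => z01; have /andP[z0 z1] := z01.
rewrite /= ger0_norm ?mulr_ge0 ?powR_ge0 ?beta_ge0 ?(ltW z0)//.
congr EFin; rewrite mulrA -{2}[z](powRr1 (ltW z0)) -powRD ?(gt_eqF z0) ?implybT//.
by congr (_ `^ _ * _); ring.
Qed.

End fragment_measure.

Section breakage_gain.
Context {R : realType}.
Local Notation mu := (@lebesgue_measure R).
Local Notation I := (`]0, 1[%classic : set R).
Implicit Types (w x y : R).
Variables (beta : R -> R) (nu : {finite_measure set (measurableTypeR R) -> \bar R}).
Hypothesis nuI : nu I = 1%E.
Hypothesis nu_beta : fragment_law beta nu.
Variables (sg : R -> R) (L : R).
Hypothesis sg0 : sg 0 = 0.
Hypothesis sgL : forall x y, `|sg x - sg y| <= L * `|x - y|.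

Lemma integral_fragments w x : 0 < x -> x <= w ->
  let F z := sg z * (x^-1 * beta (z / x) * \1_(`]0, x[%classic) z) in
  mu.-integrable (`]0, w[ : set R) (EFin \o F) /\
  \int[mu]_(z in `]0%R, w[) F z = fragmentation_gain nu sg x + sg x.
Proof.
move=> x0 xw F.
have iq := scaled_quotient_integrable nuI sg0 sgL x0.
have mq : measurable_fun I (fun z => sg (x * z) / z).
  by case/integrableP : iq => /measurable_EFinP.
have [nu_i nu_E] := nu_beta mq.
have fE z : I z -> sg (x * z) / z * (z * beta z) = sg (x * z) * beta z.
  rewrite /= in_itv/= => /andP[z0 _]; field; exact: lt0r_neq0.
have ib : mu.-integrable I (EFin \o (fun t => sg (x * t) * beta t)).
  move: (nu_i.2 iq); apply: eq_integrable => // z /set_mem zI.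
  by rewrite /= fE.
have [Fi FE] := integral_dilation x0 xw ib.
have E z : x^-1 * (sg (x * (z / x)) * beta (z / x)) * \1_(`]0, x[%classic) z = F z.
  by rewrite /F [x * (z / x)]mulrC divfK ?(lt0r_neq0 x0)//; ring.
split.
  by move: Fi; apply: eq_integrable => // z _; rewrite /= E.
rewrite /fragmentation_gain subrK nu_E.
transitivity (\int[mu]_(t in I) (sg (x * t) * beta t)).
  by rewrite -FE; apply: eq_Rintegral => z _; rewrite E.
by apply: eq_Rintegral => z /set_mem zI; rewrite fE.
Qed.

(** The two particles break independently of each other, so their contributions
    add up; each is brought to the unit interval by a dilation. *)
Lemma Upsilon_breakage x y : 0 < x -> 0 < y ->
  Upsilon (breakage beta) sg x y = fragmentation_gain nu sg x + fragmentation_gain nu sg y.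
Proof.
move=> x0 y0.
have xw : x <= x + y by rewrite lerDl ltW.
have yw : y <= x + y by rewrite lerDr ltW.
have [ix Ex] := integral_fragments x0 xw.
have [iy Ey] := integral_fragments y0 yw.
rewrite /Upsilon /breakage.
under eq_Rintegral do rewrite mulrDr.
by rewrite RintegralD// Ex Ey; ring.
Qed.

End breakage_gain.

(** * Existence of a self-similar profile *)

(** Extension by the constant [sigma 0] makes the theory of Lipschitz functions on
    the whole line available. *)
Lemma in_T1_extension {R : realType} (sigma : R -> R) : in_T1 sigma ->
  let sg (x : R) := sigma (Num.max 0 x) in
  exists2 L, 0 < L & forall x y : R, `|sg x - sg y| <= L * `|x - y|.
Proof.
move=> [sl _] sg.
near (pinfty_nbhs R) => L.
have L0 : 0 < L by near: L; exact: nbhs_pinfty_gt.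
exists L => // x y.
have sL : L.-lipschitz_(`[0, +oo[) sigma by near: L; exact: sl.
have mx (t : R) : 0 <= Num.max 0 t by rewrite le_max lexx.
apply: (@le_trans _ _ (L * `|Num.max 0 x - Num.max 0 y|)).
  by apply: (sL (Num.max 0 x, Num.max 0 y)); split; rewrite /= in_itv/= mx.
rewrite ler_pM2l//; case: (leP 0 x); case: (leP 0 y) => hy hx;
  rewrite ler_norml; apply/andP; split;
  have := ler_norm (x - y); have := ler_norm (y - x); rewrite ?[`|y - x|]distrC; lra.
Unshelve. all: by end_near. Qed.

Theorem theorem2p3 (R : realType) (k0 lam1 lam2 : R) (beta : R -> R)
    (k0_ge0 : 0 <= k0) (k0_lt1 : k0 < 1)
    (k0_lam1 : k0 <= lam1) (lam12 : lam1 <= lam2) (lam2_le1 : lam2 <= 1)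
    (lam_gt1 : 1 < lam1 + lam2) (lam_le2 : lam1 + lam2 <= 2)
    (beta_meas : measurable_fun (`]0, 1[%classic : set R) beta)
    (beta_ge0 : forall z : R, 0 < z < 1 -> 0 <= beta z)
    (beta_mass : (\int[@lebesgue_measure R]_(z in `]0%R, 1%R[)
                    (z * beta z)%:E = 1)%E)
    (beta_k0 : (\int[@lebesgue_measure R]_(z in `]0%R, 1%R[)
                  (z `^ k0 * beta z)%:E < +oo)%E) :
  exists eta : R -> R,
    [/\ self_similar_profile lam1 lam2 (product_kernel lam1 lam2)
          (breakage beta) eta,
        in_weighted_Linfty (k0 + 1) eta
      & forall k : R, k0 <= k -> in_S k eta].
Proof.
have [nu [nuI nu_k0 nu_beta]] := fragment_measure beta_meas beta_ge0 beta_mass beta_k0.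
have l1_gt0 : 0 < lam1 by lra.
have l2_gt0 : 0 < lam2 by lra.
have k0_lam2 : k0 <= lam2 by lra.
have lam1_le1 : lam1 <= 1 by lra.
pose alpha := lam1 + lam2 - 1; have al0 : 0 < alpha by rewrite /alpha; lra.
have cm0 (r : R) : k0 <= r -> 0 < mean_powint nu r by exact: (mean_powint_gt0 nuI k0_lt1 nu_k0).
have ell0 : 0 < mean_powint nu 1 by apply: cm0; exact: ltW.
pose cA := alpha * (mean_powint nu lam2 / mean_powint nu 1).
pose cB := alpha * (mean_powint nu lam1 / mean_powint nu 1).
have cA0 : 0 < cA by rewrite mulr_gt0// divr_gt0// cm0.
have cB0 : 0 < cB by rewrite mulr_gt0// divr_gt0// cm0.
have [x1 [s [C [P]]]] := stationary_tail nuI k0_ge0 k0_lt1 k0_lam1 lam12 lam2_le1 lam_gt1 nu_k0 cA0 cB0.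
set A := cA * _; set B := cB * _.
move=> [[x1_gt0 s_gt0 A_gt0 B_gt0] P_adm P_derive].
have in_Sk := profile_in_S nuI k0_ge0 k0_lt1 k0_lam1 lam12 lam2_le1 lam_gt1 nu_k0
  x1_gt0 s_gt0 A_gt0 B_gt0 P_adm P_derive.
have momentE := profile_moment nuI k0_ge0 k0_lt1 k0_lam1 lam12 lam2_le1 lam_gt1 nu_k0
  x1_gt0 s_gt0 A_gt0 B_gt0 P_adm P_derive.
exists (profile nu P); split => //; last first.
  exact: (profile_Linfty nuI k0_ge0 k0_lt1 k0_lam1 lam12 lam2_le1 lam_gt1 nu_k0 x1_gt0 P_adm).
set eta := profile nu P in in_Sk momentE *.
have eta_ge0 (x : R) : 0 < x -> 0 <= eta x.
  exact: (profile_ge0 nuI k0_lt1 nu_k0 P_adm).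
have AE : A = alpha * moment lam2 eta by rewrite momentE// /A /cA; ring.
have BE : B = alpha * moment lam1 eta by rewrite momentE// /B /cB; ring.
split.
- by apply: aeW => x; exact: eta_ge0.
- exact: in_Sk.
- by apply: in_Sk; lra.
- by rewrite momentE ?(ltW k0_lt1)// /tail_moment eqxx mulr1 mulVf ?lt0r_neq0.
move=> sigma sigma_T1; pose sg (x : R) := sigma (Num.max 0 x).
have sg_pos (x : R) : 0 < x -> sg x = sigma x by move=> x0; rewrite /sg max_r// ltW.
have sg0 : sg 0 = 0 by rewrite /sg maxxx; case: sigma_T1.
have [L L0 sgL] := in_T1_extension sigma_T1; rewrite -/sg in sgL.
have [g [mg gL sg_g _]] := lipschitz_FTC L0 sgL.
pose U := fragmentation_gain nu sg.
have -> : \int[@lebesgue_measure R]_(x in `]0, +oo[) ((sigma x - x * derive1 sigma x) * eta x) =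
    \int[@lebesgue_measure R]_(x in `]0, +oo[) ((sg x - x * g x) * eta x).
  rewrite /Rintegral; congr fine; apply: ae_eq_integral_nonmeas.
  move: sg_g; apply: filterS; first exact: (ae_filter_ringOfSetsType (@lebesgue_measure R)).
  move=> x [_ <-] /=; rewrite in_itv/= andbT => x0; rewrite sg_pos// !derive1E.
  congr ((_ - _ * _) * _)%:E; apply: near_eq_derive.
  near=> y; apply: esym; apply: sg_pos; near: y; exact: lt_nbhsr.
rewrite (weak_flux nuI k0_ge0 k0_lt1 k0_lam1 lam12 lam2_le1 lam_gt1 nu_k0
  x1_gt0 s_gt0 A_gt0 B_gt0 P_adm P_derive L0 sg0 sgL mg gL sg_g) -/eta -/U.
have mRp : measurable (`]0, +oo[%classic : set (measurableTypeR R)) by exact: measurable_itv.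
have mU : measurable_fun (`]0, +oo[ : set R) U by exact: (fragmentation_gain_measurable nuI L0 sg0 sgL).
have meta : measurable_fun (`]0, +oo[ : set R) eta.
  exact: (profile_measurable nuI P_adm).
have iU (l : R) : k0 <= l -> (@lebesgue_measure R).-integrable `]0, +oo[
    (EFin \o (fun x => x `^ l * (U x * eta x))).
  move=> k0l; have k0l1 : k0 <= l + 1 by lra.
  apply: (le_integrable mRp _ _ (integrableZl mRp (2 * L) (in_Sk _ k0l1))).
    apply/measurable_EFinP; apply: measurable_funM; first exact: measurable_funTS (measurable_powR _).
    exact: measurable_funM.
  move=> x /=; rewrite in_itv/= andbT => x0; rewrite lee_fin.
  rewrite powRD ?(gt_eqF x0) ?implybT// powRr1 ?(ltW x0)//.
  have xl0 := powR_ge0 x l; have e0 := eta_ge0 _ x0.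
  have -> : `|x `^ l * (U x * eta x)| = x `^ l * (`|U x| * eta x).
    by rewrite normrM (ger0_norm xl0) normrM (ger0_norm e0).
  have L20 : 0 < 2 * L by rewrite mulr_gt0.
  rewrite [leRHS]ger0_norm; last exact: (mulr_ge0 (ltW L20) (mulr_ge0 (mulr_ge0 xl0 (ltW x0)) e0)).
  have := fragmentation_gain_le nuI sg0 sgL x0; rewrite -/U => Ux.
  have -> : 2 * L * (x `^ l * x * eta x) = x `^ l * (2 * L * x * eta x) by ring.
  by rewrite ler_wpM2l// ler_wpM2r.
have [_] := Rintegral_lin2 A B (iU _ k0_lam1) (iU _ k0_lam2).
have <- : \int[@lebesgue_measure R]_(y in `]0, +oo[) (U y * (A * y `^ lam1 + B * y `^ lam2) * eta y) =
  \int[@lebesgue_measure R]_(x in `]0, +oo[)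
     (A * (x `^ lam1 * (U x * eta x)) + B * (x `^ lam2 * (U x * eta x))).
  by apply: eq_Rintegral => x _; ring.
move=> ->.
transitivity (alpha / 2 * (2 *
    (moment lam2 eta *
       \int[@lebesgue_measure R]_(x in `]0, +oo[) (x `^ lam1 * (U x * eta x)) +
     moment lam1 eta *
       \int[@lebesgue_measure R]_(x in `]0, +oo[) (x `^ lam2 * (U x * eta x))))).
  by rewrite AE BE; field.
rewrite -(integral_symmetric_kernel (in_Sk _ k0_lam1) (in_Sk _ k0_lam2) (iU _ k0_lam1) (iU _ k0_lam2)).
congr (_ * _); apply: eq_Rintegral => x; rewrite inE/= in_itv/= andbT => x0.
apply: eq_Rintegral => y; rewrite inE/= in_itv/= andbT => y0.
congr (_ * _ * _ * _); rewrite /U -(Upsilon_breakage nuI nu_beta sg0 sgL x0 y0).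
rewrite /Upsilon !sg_pos//; congr (_ - _ - _).
apply: eq_Rintegral => z; rewrite inE/= in_itv/= => /andP[z0 _]; rewrite sg_pos//.
Unshelve. all: by end_near. Qed.
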